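(* Let $\mathcal A$ be an infinite radially symmetric antitree with sphere numbers $\{s_n\}_{n\ge0}$ and edge lengths $\{\ell_n\}_{n\ge0}$, and let $\mathbf H$ be its minimal Kirchhoff Laplacian. The orthogonal decomposition $$L^2(\mathcal A)=\mathcal F_{\rm sym}\oplus\bigoplus_{n\ge1}\mathcal F_n\oplus\bigoplus_{n\ge1}\mathcal F_n^0$$ reduces the operator $\mathbf H$. Moreover, with respect to this decomposition, $\mathbf H$ is unitarily equivalent to the following orthogonal sum of Sturm--Liouville operators: $$\mathrm H\ \oplus\ \bigoplus_{n\ge1}\Big(\bigoplus_{j=1}^{(s_n-1)(s_{n+1}-1)}\mathrm h_n\Big)\ \oplus\ \bigoplus_{n\ge1}\Big(\bigoplus_{j=1}^{s_n-1}\widetilde{\mathrm h}_n\Big),$$ where the summand $\mathrm H$ corresponds to $\mathcal F_{\rm sym}$, the $(s_n-1)(s_{n+1}-1)$ copies of $\mathrm h_n$ correspond to $\mathcal F_n^0$, and the $s_n-1$ copies of $\widetilde{\mathrm h}_n$ correspond to $\mathcal F_n$.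
   Context: Radially symmetric antitree: let $s_0=1$, $s_n\in\mathbb Z_{\ge1}$ ($n\ge1$) and $\ell_n>0$ ($n\ge0$). The infinite radially symmetric (metric) antitree $\mathcal A$ with sphere numbers $\{s_n\}$ and edge lengths $\{\ell_n\}$ is the rooted metric graph whose vertex set $\mathcal V$ is the disjoint union of finite sets $S_n$, $\#S_n=s_n$ ($S_0=\{o\}$, $o$ the root), in which every vertex of $S_n$ is joined by exactly one edge to every vertex of $S_{n+1}$ for all $n\ge 0$, there are no other edges, and each edge joining $S_n$ with $S_{n+1}$ is identified with an interval of length $\ell_n$. $\mathcal E$ is the edge set. Kirchhoff Laplacian: $L^2(\mathcal A)=\bigoplus_{e\in\mathcal E}L^2(e)$. The operator $\mathbf H_0$ acts edgewise as $f_e\mapsto -f_e''$ on the set of all $f\in L^2(\mathcal A)$ vanishing outside finitely many edges, with $f_e\in H^2(e)$ for every $e\in\mathcal E$, and such that at every vertex $v$: $f$ is continuous at $v$, and $\sum_e f_e'(v)=0$, the sum running over the edges incident to $v$ and $f_e'(v)$ being the derivative at $v$ directed from $v$ into $e$. It is symmetric; the minimal Kirchhoff Laplacian is its closure $\mathbf H=\overline{\mathbf H_0}$. Notation: $t_0=0$, $t_n=\sum_{j=0}^{n-1}\ell_j$, $I_n=[t_n,t_{n+1})$, $\mathcal L=\sum_{n\ge0}\ell_n\in(0,\infty]$, and $\mu(t)=s_ns_{n+1}$ for $t\in I_n$, $n\ge 0$ (a function on $[0,\mathcal L)$). $\mathcal E_n^+$ is the set of edges joining $S_n$ and $S_{n+1}$;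 for a vertex $v\in S_n$, $\mathcal E_v^{+}$ and $\mathcal E_v^{-}$ are the sets of edges joining $v$ to $S_{n+1}$ and to $S_{n-1}$, respectively, and $\mathcal E_v=\mathcal E_v^+\cup\mathcal E_v^-$. For a point $x$ on an edge of $\mathcal E_n^+$, $|x|$ is $t_n$ plus the distance along the edge from its endpoint in $S_n$; functions on different edges of $\mathcal E_n^+$ are compared and added via the parameter $t=|x|\in I_n$. Subspaces: $\mathcal F_{\rm sym}=\{f\in L^2(\mathcal A): f(x)=f(y)\text{ if }|x|=|y|\}$. For $n\ge1$, $\mathcal F_n^0=\{f\in L^2(\mathcal A): f\equiv0\text{ off }\mathcal E_n^+,\ \sum_{e\in\mathcal E_v^+}f_e\equiv0\ \forall v\in S_n,\ \sum_{e\in\mathcal E_u^-}f_e\equiv0\ \forall u\in S_{n+1}\}$. For $v\ne o$, $\widetilde{\mathcal F}_v=\{f\in L^2(\mathcal A): f\equiv 0\text{ off }\mathcal E_v,\ f(x)=f(y)\text{ for a.e. }x,y\in\mathcal E_v\text{ with }|x|=|y|\}$, $\widetilde{\mathcal F}_n=\bigoplus_{v\in S_n}\widetilde{\mathcal F}_v$, and $\mathcal F_n=\{f\in\widetilde{\mathcal F}_n:\sum_{e\in\mathcal E_m^+}f_e\equiv0\ \forall m\ge0\}$. Operators: $\mathrm H=\overline{\mathrm H_0}$, where $\mathrm H_0$ acts in $L^2([0,\mathcal L);\mu)$ by $\tau=-\frac1{\mu}\frac{d}{dt}\mu\frac{d}{dt}$ on the functions $f$ with compact support in $[0,\mathcal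 L)$ such that $f,\mu f'\in AC_{\rm loc}([0,\mathcal L))$, $\tau f\in L^2([0,\mathcal L);\mu)$ and $f'(0)=0$. The operator $\mathrm h_n=-\frac{d^2}{dt^2}$ acts in $L^2(I_n)$ with domain $\{f\in H^2(I_n): f(t_n+)=f(t_{n+1}-)=0\}$. The operator $\widetilde{\mathrm h}_n$ acts in $L^2((t_{n-1},t_{n+1});\mu)$ by $-\frac1\mu\frac{d}{dt}\mu\frac d{dt}$ with Dirichlet conditions at both endpoints; i.e. its domain consists of functions that are $H^2$ on $I_{n-1}$ and on $I_n$, vanish at $t_{n-1}$ and $t_{n+1}$, and satisfy $f(t_n+)=f(t_n-)$ and $s_{n-1}f'(t_n-)=s_{n+1}f'(t_n+)$. A decomposition reduces an operator if the operator commutes with the orthogonal projections onto the summands (the projections leave the domain invariant). *)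

(* Defs.v *)
From HB Require Import structures.
From mathcomp Require Import all_boot all_order all_algebra.
From mathcomp Require Import all_classical all_reals all_analysis.
From mathcomp Require Import complex.

Set Implicit Arguments.
Unset Strict Implicit.
Unset Printing Implicit Defensive.

Import Order.TTheory GRing.Theory Num.Theory.
Import numFieldNormedType.Exports.

Local Open Scope classical_set_scope.
Local Open Scope complex_scope.
Local Open Scope ring_scope.

(* Hilbert spaces are represented by functions (not by classes): a space is   *)
(* the set [hmem] of its elements inside a vector space V of functions, with  *)
(* an inner product which is positive semidefinite on [hmem]; f and g stand   *)
(* for the same vector iff hnorm X (f - g) = 0. The values of [hdot] outside  *)
(* [hmem] are meaningless. Accordingly an operator is given by its graph, a   *)
(* relation on V invariant under replacing f or g by another representative.  *)
Record hspace (R : realType) (V : lmodType R[i]) := HSpace {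
  hmem : set V ;
  hdot : V -> V -> R[i]
}.

Section Hilbert.
Context {R : realType} {V : lmodType R[i]}.
Implicit Types (X : hspace V) (F : set V) (T : V -> V -> Prop).

Definition hnorm X (f : V) : R := Num.sqrt (complex.Re (hdot X f f)).

Definition closed_subspace X F :=
  [/\ F `<=` hmem X,
      F 0,
      forall (a : R[i]) f g, F f -> F g -> F (a *: f + g) &
      forall f, hmem X f ->
        (forall eps : R, 0 < eps -> exists2 g, F g & hnorm X (f - g) < eps) ->
        F f].

(* The last clause is the unconditional convergence of f = \sum_k fk k.       *)
Definition orthogonal_decomposition X (K : eqType) (F : K -> set V) :=
  [/\ forall k, closed_subspace X (F k),
      forall k l f g, k != l -> F k f -> F l g -> hdot X f g = 0 &
      forall f, hmem X f -> exists fk : K -> V,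
        (forall k, F k (fk k)) /\
        forall eps : R, 0 < eps -> exists s0 : seq K,
          forall s, uniq s -> {subset s0 <= s} ->
            hnorm X (f - \sum_(k <- s) fk k) < eps].

Definition is_orthproj X F (f p : V) :=
  F p /\ forall h, F h -> hdot X (f - p) h = 0.

(* P (dom T) is contained in dom T and T P f = P T f for f in dom T, where P  *)
(* is the orthogonal projection onto F.                                       *)
Definition commutes_with_projection X F T :=
  forall f g, T f g ->
    exists p q, [/\ is_orthproj X F f p, is_orthproj X F g q & T p q].

Definition op_closure X T : V -> V -> Prop := fun f g =>
  [/\ hmem X f, hmem X g &
      forall eps : R, 0 < eps -> exists f' g',
        [/\ T f' g', hnorm X (f - f') < eps & hnorm X (g - g') < eps]].

End Hilbert.

Definition unitary (R : realType) (V W : lmodType R[i]) (X : hspace V)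
    (Y : hspace W) (U : V -> W) :=
  [/\ forall f, hmem X f -> hmem Y (U f),
      forall (a : R[i]) f g, hmem X f -> hmem X g ->
        hnorm Y (U (a *: f + g) - (a *: U f + U g)) = 0,
      forall f g, hmem X f -> hmem X g -> hdot Y (U f) (U g) = hdot X f g &
      forall g, hmem Y g -> exists2 f, hmem X f & hnorm Y (U f - g) = 0].

(* Sums of absolutely summable families.                                      *)
Definition rsum (R : realType) (I : choiceType) (a : I -> R) : R :=
  fine (\esum_(i in [set: I]) ((EFin \o a)^\+ i)%E)
  - fine (\esum_(i in [set: I]) ((EFin \o a)^\- i)%E).

Definition csum (R : realType) (I : choiceType) (a : I -> R[i]) : R[i] :=
  rsum (fun i => complex.Re (a i)) +i* rsum (fun i => complex.Im (a i)).

Section OrthogonalSum.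
Context {R : realType} {V : lmodType R[i]} {I : choiceType}.

Definition hsum (X : I -> hspace V) : hspace (I -> V) := {|
  hmem := [set f | (forall i, hmem (X i) (f i)) /\
    (\esum_(i in [set: I]) (complex.Re (hdot (X i) (f i) (f i)))%:E < +oo)%E] ;
  hdot := fun f g => csum (fun i => hdot (X i) (f i) (g i))
|}.

Definition op_sum (X : I -> hspace V) (T : I -> V -> V -> Prop) :
    (I -> V) -> (I -> V) -> Prop := fun f g =>
  [/\ hmem (hsum X) f, hmem (hsum X) g & forall i, T i (f i) (g i)].

End OrthogonalSum.

Notation cfun R := (R -> (R[i])^o) (only parsing).

Section Functions.
Context {R : realType}.
Implicit Types (D : set R) (w : R -> R) (f g : cfun R) (a b : R).

Let mu := @lebesgue_measure R.

Definition cmeasurable D f :=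
  measurable_fun D (fun x => complex.Re (f x)) /\
  measurable_fun D (fun x => complex.Im (f x)).

Definition cintegrable D f :=
  mu.-integrable D (fun x => (complex.Re (f x))%:E) /\
  mu.-integrable D (fun x => (complex.Im (f x))%:E).

Definition cintegral D f : R[i] :=
  (\int[mu]_(x in D) complex.Re (f x)) +i* (\int[mu]_(x in D) complex.Im (f x)).

Definition aeq D f g := {ae mu, forall x, D x -> f x = g x}.

Definition L2 D w : hspace (cfun R) := {|
  hmem := [set f | cmeasurable D f /\
    (\int[mu]_(x in D)
       ((complex.Re (f x) ^+ 2 + complex.Im (f x) ^+ 2) * w x)%:E < +oo)%E] ;
  hdot := fun f g => cintegral D (fun x => f x * conjc (g x) * (w x)%:C)
|}.

(* f is absolutely continuous on [a, b], i.e. a primitive of an integrable    *)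
(* function f1, which is then f' almost everywhere.                           *)
Definition abscont a b f f1 :=
  cintegrable `[a, b] f1 /\
  forall x, a <= x <= b -> f x = f a + cintegral `[a, x] f1.

(* f belongs to H^2(a, b); F is its continuous representative, F1 = F' (with  *)
(* the one-sided derivatives at a and b) and F2 = F''.                        *)
Definition H2 a b f F F1 F2 :=
  [/\ aeq `[a, b] f F, abscont a b F F1, abscont a b F1 F2 &
      hmem (L2 `[a, b] (cst 1)) F2].

End Functions.

(* S_n is [sphere n], and s_n is its cardinal.                                *)
Record antitree (R : realType) := Antitree {
  sphere : nat -> finType ;
  len : nat -> R ;
  sphere0 : #|sphere 0| = 1%N ;
  sphere_gt0 : forall n, (0 < #|sphere n|)%N ;
  len_gt0 : forall n, 0 < len n
}.

Section Antitree.
Context {R : realType}.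
Variable A : antitree R.

Definition sn (n : nat) : nat := #|sphere A n|.

Definition vertex : choiceType := {n : nat & sphere A n}.

(* The edge joining v in S_n and u in S_n.+1 is (n; (v, u)).                  *)
Definition edge : choiceType :=
  {n : nat & (sphere A n * sphere A n.+1)%type}.

Definition vtx n (v : sphere A n) : vertex := Tagged (fun n => sphere A n) v.
Definition lvl (e : edge) : nat := tag e.
Definition lower (e : edge) : vertex := vtx (tagged e).1.
Definition upper (e : edge) : vertex := vtx (tagged e).2.

Definition Eplus (v : vertex) : set edge := [set e | lower e = v].
Definition Eminus (v : vertex) : set edge := [set e | upper e = v].
Definition Elevel (n : nat) : set edge := [set e | lvl e = n].

Definition tn (n : nat) : R := \sum_(j < n) len A j.
Definition Iseg (n : nat) : set R := `[tn n, tn n.+1[.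
Definition totlen : \bar R := (\sum_(0 <= n <oo) (len A n)%:E)%E.
Definition interval0L : set R := [set x | 0 <= x /\ (x%:E < totlen)%E].

(* There is exactly one n in the sum when x is in [0, totlen).                *)
Definition weight (x : R) : R :=
  \sum_(n \in [set n | Iseg n x]) ((sn n * sn n.+1)%:R : R).

(* A function on the antitree; f e is a function of the parameter t = |x|.    *)
Notation afun := (edge -> cfun R).

Definition L2A : hspace afun := hsum (fun e => L2 (Iseg (lvl e)) (cst 1)).

Definition aeqA (f g : afun) := forall e, aeq (Iseg (lvl e)) (f e) (g e).

Definition H0_antitree (f g : afun) :=
  [/\ hmem L2A f, hmem L2A g,
      finite_set [set e | ~ aeq (Iseg (lvl e)) (f e) (cst 0)] &
  exists F F1 F2 : afun,
  [/\ forall e, H2 (tn (lvl e)) (tn (lvl e).+1) (f e) (F e) (F1 e) (F2 e),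
      forall v : vertex, exists c : R[i],
        forall e, Eplus v e \/ Eminus v e -> F e (tn (tag v)) = c,
      (* the derivative directed from v into e is - F1 e when e is in Eminus v *)
      forall v : vertex,
        \sum_(e \in Eplus v) F1 e (tn (tag v))
        + \sum_(e \in Eminus v) - F1 e (tn (tag v)) = 0 &
      forall e, aeq (Iseg (lvl e)) (g e) (fun x => - F2 e x)]].

Definition kirchhoff (f g : afun) : Prop := op_closure L2A H0_antitree f g.

Definition Fsym : set afun := [set f | hmem L2A f /\
  forall e e', lvl e = lvl e' -> aeq (Iseg (lvl e)) (f e) (f e')].

Definition Fzero (n : nat) : set afun := [set f |
  [/\ hmem L2A f,
      forall e, ~ Elevel n e -> aeq (Iseg (lvl e)) (f e) (cst 0),
      forall v : sphere A n,
        aeq (Iseg n) (fun x => \sum_(e \in Eplus (vtx v)) f e x) (cst 0) &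
      forall u : sphere A n.+1,
        aeq (Iseg n) (fun x => \sum_(e \in Eminus (vtx u)) f e x) (cst 0)]].

Definition Ftilde_vertex (v : vertex) : set afun := [set f |
  let E_v := Eplus v `|` Eminus v in
  [/\ hmem L2A f,
      forall e, ~ E_v e -> aeq (Iseg (lvl e)) (f e) (cst 0) &
      forall e e', E_v e -> E_v e' -> lvl e = lvl e' ->
        aeq (Iseg (lvl e)) (f e) (f e')]].

Definition Ftilde (n : nat) : set afun := [set f | hmem L2A f /\
  exists h : sphere A n -> afun,
    (forall v, Ftilde_vertex (vtx v) (h v)) /\ aeqA f (\sum_v h v)].

Definition Fanti (n : nat) : set afun := [set f | Ftilde n f /\
  forall m, aeq (Iseg m) (fun x => \sum_(e \in Elevel m) f e x) (cst 0)].

Definition H0_line (f g : cfun R) :=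
  [/\ hmem (L2 interval0L weight) f, hmem (L2 interval0L weight) g &
  exists F F1 Q : cfun R,
  [/\ aeq interval0L f F,
      exists2 b, interval0L b &
        forall x, interval0L x -> b < x -> F x = 0,
      (* F1 is the representative of F' for which weight * F' is continuous *)
      forall b, interval0L b ->
        abscont 0 b F F1 /\ abscont 0 b (fun x => (weight x)%:C * F1 x) Q,
      F1 0 = 0 &
      aeq interval0L g (fun x => - ((weight x)^-1)%:C * Q x)]].

Definition H_line : cfun R -> cfun R -> Prop :=
  op_closure (L2 interval0L weight) H0_line.

Definition h_edge (n : nat) (f g : cfun R) :=
  [/\ hmem (L2 (Iseg n) (cst 1)) f, hmem (L2 (Iseg n) (cst 1)) g &
  exists F F1 F2 : cfun R,
  [/\ H2 (tn n) (tn n.+1) f F F1 F2,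
      F (tn n) = 0, F (tn n.+1) = 0 &
      aeq (Iseg n) g (fun x => - F2 x)]].

Definition I_vertex (n : nat) : set R := `]tn n.-1, tn n.+1[.

(* For n >= 1. The action is written - F2, - G2 since the weight is constant  *)
(* on each of the two intervals.                                              *)
Definition h_vertex (n : nat) (f g : cfun R) :=
  [/\ hmem (L2 (I_vertex n) weight) f, hmem (L2 (I_vertex n) weight) g &
  exists F F1 F2 G G1 G2 : cfun R,
  [/\ H2 (tn n.-1) (tn n) f F F1 F2 /\ H2 (tn n) (tn n.+1) f G G1 G2,
      F (tn n.-1) = 0 /\ G (tn n.+1) = 0,
      F (tn n) = G (tn n),
      (sn n.-1)%:R * F1 (tn n) = (sn n.+1)%:R * G1 (tn n) &
      aeq (Iseg n.-1) g (fun x => - F2 x) /\ aeq (Iseg n) g (fun x => - G2 x)]].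

(* The argument n of the last two constructors stands for the index n.+1,     *)
(* and similarly below.                                                       *)
Inductive component := CSym | CAnti of nat | CZero of nat.

Definition summand (k : component) : set afun :=
  match k with
  | CSym => Fsym
  | CAnti n => Fanti n.+1
  | CZero n => Fzero n.+1
  end.

(* One index for each summand of the Sturm-Liouville side: (sn n.+1 - 1) *    *)
(* (sn n.+2 - 1) copies of h_edge n.+1, sn n.+1 - 1 copies of h_vertex n.+1.  *)
Inductive sl_index :=
| SLsym
| SLzero n of 'I_((sn n.+1 - 1) * (sn n.+2 - 1))
| SLanti n of 'I_(sn n.+1 - 1).

Definition sl_component (i : sl_index) : component :=
  match i with
  | SLsym => CSym
  | SLzero n _ => CZero n
  | SLanti n _ => CAnti n
  end.

Definition sl_space (i : sl_index) : hspace (cfun R) :=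
  match i with
  | SLsym => L2 interval0L weight
  | SLzero n _ => L2 (Iseg n.+1) (cst 1)
  | SLanti n _ => L2 (I_vertex n.+1) weight
  end.

Definition sl_op (i : sl_index) : cfun R -> cfun R -> Prop :=
  match i with
  | SLsym => H_line
  | SLzero n _ => h_edge n.+1
  | SLanti n _ => h_vertex n.+1
  end.

End Antitree.

Arguments summand {R} A k.
Arguments kirchhoff {R} A f g.

HB.instance Definition _ := gen_eqMixin component.
HB.instance Definition _ (R : realType) (A : antitree R) :=
  gen_eqMixin (sl_index A).
HB.instance Definition _ (R : realType) (A : antitree R) :=
  gen_choiceMixin (sl_index A).

Definition sl_sum_space (R : realType) (A : antitree R) :
  hspace (sl_index A -> cfun R) := hsum (@sl_space R A).

Definition sl_sum_op (R : realType) (A : antitree R) :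
    (sl_index A -> cfun R) -> (sl_index A -> cfun R) -> Prop :=
  op_sum (@sl_space R A) (@sl_op R A).

Arguments sl_sum_op {R} A _ _.

(* Main.v *)
(* For every n fix an orthogonal basis b_0 = 1, b_1, ... of R^(S_n) with |b_j|^2 = s_n, and expand
   f on the edges between S_n and S_(n+1) (level n) in the products b_j (x) b_k. Across S_n the
   Kirchhoff conditions only couple the coefficient of 1 (x) b_j on level n-1 with that of
   b_j (x) 1 on level n. Hence the coefficients of 1 (x) 1 on all levels form the radial part;
   for j > 0 those of 1 (x) b_j on level n-1 and of b_j (x) 1 on level n form one function on
   (t_(n-1), t_(n+1)); and for j, k > 0 that of b_j (x) b_k satisfies Dirichlet conditions on a
   single level. With suitable weights this expansion is unitary (Parseval).
   It maps the pre-minimal operator into the sum of the pre-minimal line operator and the operators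
   h_edge, h_vertex. The latter are already closed, because f is recovered from g = T f by a
   bounded solution operator; this gives one inclusion for the closures. Conversely an element of
   the domain of the sum is approximated by keeping finitely many components and replacing the
   radial one by an element of the pre-minimal domain, which has compact support. *)
Require Import Defs.
From mathcomp Require Import all_boot all_order all_algebra.
From mathcomp Require Import all_classical all_reals all_analysis.
From mathcomp Require Import complex measurable_realfun ring lra.
Set Implicit Arguments.
Unset Strict Implicit.
Unset Printing Implicit Defensive.

Import Order.TTheory GRing.Theory Num.Theory.
Import numFieldNormedType.Exports.

Local Open Scope classical_set_scope.
Local Open Scope complex_scope.
Local Open Scope ring_scope.

(** The Kirchhoff conditions are pointwise statements about continuous representatives, whereas
    membership, norms and the unitary map only see functions almost everywhere. Hence boundary data
    are never read off [Ut f]: they are carried along as [F], [F1], [F2] on closed segments, and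
    [mode_solution] is the common format into which the antitree operator and all three kinds of
    Sturm-Liouville operators are translated in both directions. The normalization |b_j|^2 = s_n
    with b_0 = 1 lets values pass across a sphere without any factor. The sum of outgoing
    derivatives at S_(n+1) produces the factor s_(n+2), the sum of incoming ones s_n; multiplied by
    s_(n+1) this says that mu F' is continuous. The radial component is the only one with infinitely
    many levels and the only one whose operator is defined as a closure; every other component has
    at most two levels. That the projections reduce the operator is deduced from the equivalence: on
    the Sturm-Liouville side a projection keeps some coordinates and replaces the others by 0. *)

Local Notation cre := complex.Re.
Local Notation cim := complex.Im.

Local Notation mset D := (@measurable _ (measurableTypeR _) D).
Local Notation mfun D f := (@measurable_fun _ _ (measurableTypeR _) _ D f).
Local Notation mu := (@lebesgue_measure _).

(** * Semi-inner product spaces and orthogonal sums *)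

Section ComplexParts.
Context {R : realType}.
Implicit Types z t : R[i].

Lemma creD z t : cre (z + t) = cre z + cre t. Proof. by case: z t => [? ?] []. Qed.
Lemma cimD z t : cim (z + t) = cim z + cim t. Proof. by case: z t => [? ?] []. Qed.
Lemma creN z : cre (- z) = - cre z. Proof. by case: z. Qed.
Lemma cimN z : cim (- z) = - cim z. Proof. by case: z. Qed.
Lemma creM z t : cre (z * t) = cre z * cre t - cim z * cim t.
Proof. by case: z t => [? ?] []. Qed.
Lemma cimM z t : cim (z * t) = cre z * cim t + cim z * cre t.
Proof. by case: z t => [? ?] []. Qed.
Lemma creJ z : cre (conjc z) = cre z. Proof. by case: z. Qed.
Lemma cimJ z : cim (conjc z) = - cim z. Proof. by case: z. Qed.
Lemma creR (r : R) : cre r%:C = r. Proof. by []. Qed.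
Lemma cimR (r : R) : cim r%:C = 0. Proof. by []. Qed.
Lemma creZ z (t : (R[i])^o) : cre (z *: t) = cre z * cre t - cim z * cim t.
Proof. exact: creM. Qed.
Lemma cimZ z (t : (R[i])^o) : cim (z *: t) = cre z * cim t + cim z * cre t.
Proof. exact: cimM. Qed.
Lemma cre_sum I (r : seq I) (P : pred I) (F : I -> R[i]) :
  cre (\sum_(i <- r | P i) F i) = \sum_(i <- r | P i) cre (F i).
Proof. by elim/big_rec2: _ => // i y z _ <-; rewrite creD. Qed.
Lemma cim_sum I (r : seq I) (P : pred I) (F : I -> R[i]) :
  cim (\sum_(i <- r | P i) F i) = \sum_(i <- r | P i) cim (F i).
Proof. by elim/big_rec2: _ => // i y z _ <-; rewrite cimD. Qed.
Lemma complexP z t : cre z = cre t -> cim z = cim t -> z = t.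
Proof. by case: z t => [? ?] [? ?] /= -> ->. Qed.

Definition partsE := (creD, cimD, creN, cimN, creM, cimM, creJ, cimJ, creR, cimR,
  creZ, cimZ).

Definition sqn z : R := cre z ^+ 2 + cim z ^+ 2.

Lemma sqn_ge0 z : 0 <= sqn z. Proof. by rewrite addr_ge0 ?sqr_ge0. Qed.
Lemma sqn0 : sqn 0 = 0. Proof. by rewrite /sqn /= expr0n addr0. Qed.
Lemma sqnM z t : sqn (z * t) = sqn z * sqn t.
Proof. by rewrite /sqn !partsE; ring. Qed.
Lemma sqnR (r : R) : sqn r%:C = r ^+ 2.
Proof. by rewrite /sqn /= expr0n addr0. Qed.
Lemma sqnD z t : sqn (z + t) <= 2 * sqn z + 2 * sqn t.
Proof.
rewrite /sqn !partsE -subr_ge0.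
rewrite (_ : _ - _ = (cre z - cre t) ^+ 2 + (cim z - cim t) ^+ 2); last by ring.
by rewrite addr_ge0 ?sqr_ge0.
Qed.
Lemma sqn_eq0 z : sqn z = 0 -> z = 0.
Proof.
move=> /eqP; rewrite /sqn paddr_eq0 ?sqr_ge0// !sqrf_eq0 => /andP[/eqP a /eqP b].
exact: complexP.
Qed.

End ComplexParts.

Definition hsq (R : realType) (V : lmodType R[i]) (X : hspace V) (f : V) : R :=
  cre (hdot X f f).

Section SemiHilbert.
Context {R : realType}.

(* Stated through the square norm only, with the inner product recovered by polarization, so that
   it passes to orthogonal sums and isometries by comparing [hsq]. *)
Record semihilbert (V : lmodType R[i]) (X : hspace V) : Prop := SemiHilbert {
  hmem0 : hmem X 0 ;
  hmemL : forall (a : R[i]) f g, hmem X f -> hmem X g -> hmem X (a *: f + g) ;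
  hsq_ge0 : forall f, 0 <= hsq X f ;
  hsqZ : forall (a : R[i]) f, hmem X f -> hsq X (a *: f) = sqn a * hsq X f ;
  hsqD : forall f g, hmem X f -> hmem X g ->
    hsq X (f + g) <= 2 * hsq X f + 2 * hsq X g ;
  hdot_re : forall f g, hmem X f -> hmem X g ->
    cre (hdot X f g) =
    hsq X ((2^-1)%:C *: (f + g)) - hsq X ((2^-1)%:C *: (f - g)) ;
  hdot_im : forall f g, hmem X f -> hmem X g ->
    cim (hdot X f g) = cre (hdot X f ('i%C *: g))
}.

Section Consequences.
Context (V : lmodType R[i]) (X : hspace V) (HX : semihilbert X).
Implicit Types f g : V.

Lemma hmemZ (a : R[i]) f : hmem X f -> hmem X (a *: f).
Proof. by move=> Hf; rewrite -[_ *: _]addr0; apply: hmemL => //; exact: hmem0. Qed.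
Lemma hmemD f g : hmem X f -> hmem X g -> hmem X (f + g).
Proof. by move=> Hf Hg; rewrite -[f]scale1r; exact: hmemL. Qed.
Lemma hmemN f : hmem X f -> hmem X (- f).
Proof. by move=> Hf; rewrite -scaleN1r; exact: hmemZ. Qed.
Lemma hmemB f g : hmem X f -> hmem X g -> hmem X (f - g).
Proof. by move=> Hf Hg; apply: hmemD => //; exact: hmemN. Qed.
Lemma hmem_sum I (r : seq I) (P : pred I) (F : I -> V) :
  (forall i, P i -> hmem X (F i)) -> hmem X (\sum_(i <- r | P i) F i).
Proof. by move=> HF; apply: big_ind => //; [exact: hmem0|exact: hmemD]. Qed.

Lemma hsqN f : hmem X f -> hsq X (- f) = hsq X f.
Proof.
move=> Hf; rewrite -scaleN1r hsqZ// /sqn creN cimN /=.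
by rewrite sqrrN oppr0 expr1n expr0n addr0 mul1r.
Qed.

Lemma hsqB f g : hmem X f -> hmem X g -> hsq X (f - g) = hsq X (g - f).
Proof. by move=> Hf Hg; rewrite -opprB hsqN//; exact: hmemB. Qed.

Lemma hsq0 : hsq X 0 = 0.
Proof.
by rewrite -[0 in LHS](scale0r (0 : V)) (hsqZ HX) ?sqn0 ?mul0r//; exact: hmem0 HX.
Qed.

Lemma hnorm_lt f (e : R) : 0 < e -> (hnorm X f < e) = (hsq X f < e ^+ 2).
Proof.
move=> e0; rewrite /hnorm -/(hsq X f).
by rewrite -[in LHS](ger0_norm (ltW e0)) -sqrtr_sqr ltr_sqrt ?exprn_gt0.
Qed.

Lemma hnorm_eq0 f : hnorm X f = 0 <-> hsq X f = 0.
Proof.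
rewrite /hnorm -/(hsq X f); split=> [/eqP|->]; last by rewrite sqrtr0.
by rewrite sqrtr_eq0 => h; apply/eqP; rewrite eq_le h hsq_ge0.
Qed.

(** An arbitrary real [C] is allowed so that approximation arguments can be run with whatever
    constant they produce. *)
Lemma hsq_close0 f (C : R) : hmem X f ->
  (forall e, 0 < e -> hsq X f <= C * e) -> hsq X f = 0.
Proof.
move=> Hf h; apply/eqP; rewrite eq_le hsq_ge0// andbT.
apply/ler_addgt0Pr => e e0; rewrite add0r.
have C0 : 0 < `|C| + 1 by rewrite ltr_wpDl.
have := h (e / (`|C| + 1)) (divr_gt0 e0 C0); move/le_trans; apply.
rewrite mulrCA ger_pMr// ler_pdivrMr// mul1r.
by rewrite (le_trans (ler_norm _))// lerDl.
Qed.

End Consequences.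
End SemiHilbert.

(** * Sums of families over arbitrary index sets *)

Section SummableFamilies.
Context {R : realType} {I : choiceType}.
Implicit Types a b : I -> R.

Lemma esum_fin_num a : (forall i, 0 <= a i) ->
  (\esum_(i in [set: I]) (a i)%:E < +oo)%E ->
  (\esum_(i in [set: I]) (a i)%:E \is a fin_num)%E.
Proof.
by move=> a0 ?; rewrite ge0_fin_numE//; apply: esum_ge0 => i _; rewrite lee_fin.
Qed.

Lemma rsum_ge0E a : (forall i, 0 <= a i) ->
  rsum a = fine (\esum_(i in [set: I]) (a i)%:E)%E.
Proof.
move=> a0; rewrite /rsum [X in _ - fine X]esum1 ?subr0.
  congr fine; apply: eq_esum => i _; rewrite funeposE/=.
  by apply/max_idPl; rewrite lee_fin.
move=> i _; rewrite funenegE/=; apply/max_idPr.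
by rewrite lee_fin oppr_le0.
Qed.

(** Polarization presents the terms of an inner product as differences of two nonnegative summable
    families; this is the form in which [rsum] has to be additive. *)
Lemma rsumB a b : (forall i, 0 <= a i) -> (forall i, 0 <= b i) ->
  (\esum_(i in [set: I]) (a i)%:E < +oo)%E ->
  (\esum_(i in [set: I]) (b i)%:E < +oo)%E ->
  rsum (fun i => a i - b i) = rsum a - rsum b.
Proof.
move=> a0 b0 fa fb.
have sm (c : I -> R) : (forall i, 0 <= c i) -> (\esum_(i in [set: I]) (c i)%:E < +oo)%E ->
    summable [set: I] (EFin \o c).
  move=> c0; rewrite /summable; apply: le_lt_trans; apply: le_esum => i _.
  by rewrite /= lee_fin ger0_norm.
have := @esumB R I setT (EFin \o a) (EFin \o b) (sm _ a0 fa) (sm _ b0 fb).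
move=> /(_ (fun i _ => a0 i)) /(_ (fun i _ => b0 i)) e.
rewrite (rsum_ge0E a0) (rsum_ge0E b0) -fineB ?esum_fin_num// -e.
have fp : (\esum_(i in [set: I]) ((EFin \o (fun i => (a i - b i)%R))^\+ i) \is a fin_num)%E.
  rewrite ge0_fin_numE; last by apply: esum_ge0.
  apply: le_lt_trans fa; apply: le_esum => i _.
  rewrite funeposE /= ge_max !lee_fin a0 andbT gerBl; exact: b0.
have fm : (\esum_(i in [set: I]) ((EFin \o (fun i => (a i - b i)%R))^\- i) \is a fin_num)%E.
  rewrite ge0_fin_numE; last by apply: esum_ge0.
  apply: le_lt_trans fb; apply: le_esum => i _.
  rewrite funenegE /= ge_max !lee_fin b0 andbT opprB gerBl; exact: a0.
by rewrite fineB//; congr fine.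
Qed.

Lemma esum_scale (c : R) a : 0 <= c -> (forall i, 0 <= a i) ->
  (\esum_(i in [set: I]) (c * a i)%:E = c%:E * \esum_(i in [set: I]) (a i)%:E)%E.
Proof.
have le (d : R) (b : I -> R) : 0 <= d -> (forall i, 0 <= b i) ->
  (\esum_(i in [set: I]) (d * b i)%:E <= d%:E * \esum_(i in [set: I]) (b i)%:E)%E.
  move=> d0 b0; rewrite [X in (X <= _)%E]/esum; apply: ge_ereal_sup => _ [A [fA _] <-].
  rewrite fsbig_finite//= (eq_bigr (fun i => d%:E * (b i)%:E)%E) => [|i _ //].
  rewrite -ge0_sume_distrr => [|i _]; last by rewrite lee_fin.
  apply: lee_wpmul2l; first by rewrite lee_fin.
  apply: ereal_sup_ubound; exists A; last by rewrite fsbig_finite.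
  by split.
move=> c0 a0; apply/eqP; rewrite eq_le le//=.
have [->|cn0] := eqVneq c 0.
  by rewrite mul0e; apply: esum_ge0 => i _; rewrite mul0r.
have cp : 0 < c by rewrite lt_neqAle eq_sym cn0.
(* The reverse inequality is [le] for the factor [c^-1] and the family [c * a i]. *)
have := le c^-1 (fun i => c * a i); rewrite invr_ge0 => /(_ c0).
move=> /(_ (fun i => mulr_ge0 c0 (a0 i))).
under eq_esum do rewrite mulKf//.
move=> h; have : (0 <= c%:E)%E by rewrite lee_fin.
move=> /lee_wpmul2l /(_ _ _ h); rewrite muleA -EFinM divff// mul1e; exact.
Qed.

End SummableFamilies.

Section OrthogonalSumTheory.
Context {R : realType} {V : lmodType R[i]} {I : choiceType} (X : I -> hspace V).
Hypothesis HX : forall i, semihilbert (X i).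
Implicit Types f g : I -> V.

Lemma hsq_hsumE f : hsq (hsum X) f = fine (\esum_(i in [set: I]) (hsq (X i) (f i))%:E)%E.
Proof. by rewrite /hsq /= rsum_ge0E// => i; exact: hsq_ge0. Qed.

Lemma hsq_hsum_EFin f : hmem (hsum X) f ->
  (hsq (hsum X) f)%:E = (\esum_(i in [set: I]) (hsq (X i) (f i))%:E)%E.
Proof.
move=> [_ Hf]; rewrite hsq_hsumE fineK// esum_fin_num// => i; exact: hsq_ge0.
Qed.

Lemma semihilbert_hsum : semihilbert (hsum X).
Proof.
have H0 i v : 0 <= hsq (X i) v := hsq_ge0 (HX i) v.
have ZE (a : R[i]) f : (forall i, hmem (X i) (f i)) ->
    (\esum_(i in [set: I]) (hsq (X i) ((a *: f) i))%:E =
    (sqn a)%:E * \esum_(i in [set: I]) (hsq (X i) (f i))%:E)%E.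
  move=> Hf; rewrite -esum_scale ?sqn_ge0//.
  by apply: eq_esum => i _; rewrite -hsqZ.
have DE f g : (forall i, hmem (X i) (f i)) -> (forall i, hmem (X i) (g i)) ->
    (\esum_(i in [set: I]) (hsq (X i) ((f + g) i))%:E <=
    \esum_(i in [set: I]) (2 * hsq (X i) (f i))%:E +
    \esum_(i in [set: I]) (2 * hsq (X i) (g i))%:E)%E.
  move=> Hf Hg; rewrite -esumD; last 2 first.
  - by move=> i _; rewrite lee_fin mulr_ge0.
  - by move=> i _; rewrite lee_fin mulr_ge0.
  by apply: le_esum => i _; rewrite -EFinD lee_fin; exact: hsqD.
have fin2 (c : R) f : 0 <= c -> (\esum_(i in [set: I]) (hsq (X i) (f i))%:E < +oo)%E ->
    (\esum_(i in [set: I]) (c * hsq (X i) (f i))%:E < +oo)%E.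
  by move=> c0 ef; rewrite esum_scale// lte_mul_pinfty// lee_fin.
have L (a : R[i]) f g : hmem (hsum X) f -> hmem (hsum X) g -> hmem (hsum X) (a *: f + g).
  move=> [Hf ef] [Hg eg]; split=> [i|]; first exact: hmemL.
  apply: le_lt_trans (DE (a *: f) g _ _) _ => //.
    by move=> i; exact: hmemZ.
  apply: lte_add_pinfty; apply: (fin2) => //.
  by rewrite ZE// lte_mul_pinfty// lee_fin sqn_ge0.
have M0 : hmem (hsum X) 0.
  split=> [i|]; first exact: hmem0.
  by rewrite esum1// => i _; rewrite -/(hsq _ _) hsq0.
have MZ (a : R[i]) f : hmem (hsum X) f -> hmem (hsum X) (a *: f).
  by move=> Hf; rewrite -[_ *: _]addr0; exact: L.
have MD f g : hmem (hsum X) f -> hmem (hsum X) g -> hmem (hsum X) (f + g).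
  by move=> Hf Hg; rewrite -[f]scale1r; exact: L.
have MB f g : hmem (hsum X) f -> hmem (hsum X) g -> hmem (hsum X) (f - g).
  by move=> Hf Hg; apply: MD => //; rewrite -scaleN1r; exact: MZ.
split => //.
- by move=> f; rewrite hsq_hsumE fine_ge0// esum_ge0// => i _; rewrite lee_fin.
- move=> a f [Hf ef]; rewrite !hsq_hsumE ZE// fineM// esum_fin_num// => i; exact: H0.
- move=> f g Hf Hg; have := DE f g Hf.1 Hg.1.
  by rewrite !esum_scale// -!hsq_hsum_EFin//; exact: MD.
- move=> f g Hf Hg; rewrite /hsq /= -rsumB.
  + congr rsum; apply/funext => i; rewrite (hdot_re (HX i)) //; [exact: Hf.1|exact: Hg.1].
  + by move=> i; exact: H0.
  + by move=> i; exact: H0.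
  + by have [] : hmem (hsum X) ((2^-1)%:C *: (f + g)) by exact/MZ/MD.
  + by have [] : hmem (hsum X) ((2^-1)%:C *: (f - g)) by exact/MZ/MB.
- move=> f g Hf Hg /=; congr rsum; apply/funext => i.
  by rewrite (hdot_im (HX i)) //; [exact: Hf.1|exact: Hg.1].
Qed.

Lemma hdot_hsum0 f g : (forall i, hdot (X i) (f i) (g i) = 0) -> hdot (hsum X) f g = 0.
Proof.
move=> h; rewrite /= /csum.
have -> : (fun i => cre (hdot (X i) (f i) (g i))) = cst 0 by apply/funext => i; rewrite h.
have -> : (fun i => cim (hdot (X i) (f i) (g i))) = cst 0 by apply/funext => i; rewrite h.
by rewrite rsum_ge0E// esum1.
Qed.

End OrthogonalSumTheory.

(** * Weighted square integrable functions *)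

Section L2Theory.
Context {R : realType}.
Implicit Types (D : set R) (w : R -> R) (f g : cfun R).

Global Instance ae_lebesgue_filter : Filter (almost_everywhere (@lebesgue_measure R)).
Proof. exact: ae_filter_ringOfSetsType. Qed.

Lemma cmeasurable0 D : cmeasurable D (0 : cfun R).
Proof. by split; exact: measurable_cst. Qed.

Lemma cmeasurableL D (a : R[i]) f g :
  cmeasurable D f -> cmeasurable D g -> cmeasurable D (a *: f + g).
Proof.
move=> [fr fi] [gr gi]; split.
  under eq_fun do rewrite /= !partsE.
  apply: measurable_funD => //; apply: measurable_funB;
  by apply: measurable_funM => //; exact: measurable_cst.
under eq_fun do rewrite /= !partsE.
apply: measurable_funD => //; apply: measurable_funD;
by apply: measurable_funM => //; exact: measurable_cst.
Qed.

Lemma measurable_sqn D f : cmeasurable D f -> mfun D (fun x => sqn (f x)).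
Proof. by move=> [fr fi]; apply: measurable_funD; exact: measurable_funX. Qed.

Lemma integrable_addr D (f g : R -> R) : mset D ->
  mu.-integrable D (EFin \o f) -> mu.-integrable D (EFin \o g) ->
  mu.-integrable D (fun x => (f x + g x)%:E).
Proof. by move=> mD hf hg; have := integrableD mD hf hg; exact. Qed.

Lemma integrable_scaler D (c : R) (f : R -> R) : mset D ->
  mu.-integrable D (EFin \o f) -> mu.-integrable D (fun x => (c * f x)%:E).
Proof. by move=> mD hf; have := integrableZl mD c hf; exact. Qed.

Section WeightedL2.
Variables (D : set R) (w : R -> R).
Hypotheses (mD : mset D) (mw : mfun D w).
Hypothesis w0 : forall x, D x -> 0 <= w x.

Lemma measurable_sqnw f : cmeasurable D f ->
  mfun D (fun x => (sqn (f x) * w x)%:E).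
Proof.
move=> mf; apply/measurable_EFinP; apply: measurable_funM => //.
exact: measurable_sqn.
Qed.

Lemma integrable_sqn f : hmem (L2 D w) f ->
  mu.-integrable D (fun x => (sqn (f x) * w x)%:E).
Proof.
move=> [mf ff]; apply/integrableP; split; first exact: measurable_sqnw.
apply: le_lt_trans ff; apply: ge0_le_integral => //.
- by apply: measurableT_comp => //; exact: measurable_sqnw.
- exact: measurable_sqnw.
- by move=> x Dx; rewrite /= ger0_norm// mulr_ge0 ?sqn_ge0 ?w0.
Qed.

Lemma hsq_L2E f : hsq (L2 D w) f = (\int[mu]_(x in D) (sqn (f x) * w x))%R.
Proof.
by apply: eq_Rintegral => x _; rewrite /sqn !partsE; ring.
Qed.

Lemma hsq_L2_EFin f : hmem (L2 D w) f ->
  (hsq (L2 D w) f)%:E = (\int[mu]_(x in D) (sqn (f x) * w x)%:E)%E.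
Proof.
move=> hf; rewrite hsq_L2E /Rintegral fineK//.
exact: integrable_fin_num (integrable_sqn hf).
Qed.

Lemma hmem_L2_le f (h : R -> R) : cmeasurable D f ->
  mu.-integrable D (fun x => (h x)%:E) ->
  (forall x, D x -> sqn (f x) * w x <= h x) -> hmem (L2 D w) f.
Proof.
move=> mf ih le; split=> //.
have /integrableP[mh] := ih; apply: le_lt_trans; apply: ge0_le_integral => //.
- by move=> x Dx; rewrite lee_fin mulr_ge0 ?sqn_ge0 ?w0.
- exact: measurable_sqnw.
- by apply: measurableT_comp => //.
- by move=> x Dx; rewrite lee_fin (le_trans (le x Dx))// ler_norm.
Qed.

Lemma integrable_comb f g (a b : R) : hmem (L2 D w) f -> hmem (L2 D w) g ->
  mu.-integrable D (fun x => (a * (sqn (f x) * w x) + b * (sqn (g x) * w x))%:E).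
Proof.
by move=> hf hg; apply: integrable_addr => //; apply: integrable_scaler => //;
  exact: integrable_sqn.
Qed.

Lemma Rintegral_comb f g (a b : R) : hmem (L2 D w) f -> hmem (L2 D w) g ->
  (\int[mu]_(x in D) (a * (sqn (f x) * w x) + b * (sqn (g x) * w x)) =
  a * hsq (L2 D w) f + b * hsq (L2 D w) g)%R.
Proof.
move=> hf hg; rewrite RintegralD//.
- by rewrite !RintegralZl ?hsq_L2E//; exact: integrable_sqn.
- by apply: integrable_scaler => //; exact: integrable_sqn.
- by apply: integrable_scaler => //; exact: integrable_sqn.
Qed.

Lemma semihilbert_L2 : semihilbert (L2 D w).
Proof.
have L (a : R[i]) f g : hmem (L2 D w) f -> hmem (L2 D w) g -> hmem (L2 D w) (a *: f + g).
  move=> hf hg.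
  apply: (hmem_L2_le _ (integrable_comb (2 * sqn a) 2 hf hg)).
    by apply: cmeasurableL; [exact: hf.1|exact: hg.1].
  move=> x Dx; rewrite -mulrA !(mulrA _ _ (w x)) -mulrDl.
  apply: ler_wpM2r; first exact: w0.
  by apply: le_trans (sqnD _ _) _; rewrite sqnM mulrA.
have M0 : hmem (L2 D w) 0.
  split; first exact: cmeasurable0.
  by rewrite integral0_eq// => x _; rewrite /= expr0n addr0 mul0r.
have MZ (a : R[i]) f : hmem (L2 D w) f -> hmem (L2 D w) (a *: f).
  by move=> Hf; rewrite -[_ *: _]addr0; exact: L.
have MD f g : hmem (L2 D w) f -> hmem (L2 D w) g -> hmem (L2 D w) (f + g).
  by move=> Hf Hg; rewrite -[f]scale1r; exact: L.
have MB f g : hmem (L2 D w) f -> hmem (L2 D w) g -> hmem (L2 D w) (f - g).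
  by move=> Hf Hg; apply: MD => //; rewrite -scaleN1r; exact: MZ.
split => //.
- by move=> f; rewrite hsq_L2E; apply: Rintegral_ge0 => x Dx; rewrite mulr_ge0 ?sqn_ge0 ?w0.
- move=> a f Hf; rewrite !hsq_L2E -RintegralZl//; last exact: integrable_sqn.
  by apply: eq_Rintegral => x _; rewrite /= sqnM mulrA.
- move=> f g Hf Hg; rewrite -(Rintegral_comb 2 2 Hf Hg) hsq_L2E.
  apply: le_Rintegral => //.
  + by apply: integrable_sqn; exact: MD.
  + exact: integrable_comb.
  + move=> x Dx; rewrite !mulrA -mulrDl; apply: ler_wpM2r; [exact: w0|exact: sqnD].
- move=> f g Hf Hg.
  rewrite -[X in X - _]mul1r -mulN1r -(Rintegral_comb 1 (-1)); [|exact/MZ/MD|exact/MZ/MB].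
  apply: eq_Rintegral => x _; by rewrite !fctE /sqn /= !partsE /=; field.
- move=> f g _ _; apply: eq_Rintegral => x _.
  cbv beta; have -> : ('i%C *: g) x = 'i%C * g x :> R[i] by [].
  have [i1 i2] : cre ('i%C : R[i]) = 0 /\ cim ('i%C : R[i]) = 1 by [].
  by rewrite !(creM, cimM, creJ, cimJ) i1 i2 /=; ring.
Qed.

Lemma hdot_L2_ae0 f g : hmem (L2 D w) f -> hmem (L2 D w) g ->
  {ae mu, forall x, D x -> f x * conjc (g x) = 0} -> hdot (L2 D w) f g = 0.
Proof.
move=> [[mf1 mf2] _] [[mg1 mg2] _] fg0.
have Z (h : R -> R) : mfun D h -> {ae mu, forall x, D x -> h x = 0} ->
    (\int[mu]_(x in D) h x)%R = 0.
  move=> mh h0; rewrite /Rintegral (@ae_eq_integral _ _ _ mu D (cst 0%E)) ?integral0//.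
    exact/measurable_EFinP.
  by apply: filterS h0 => x h0 Dx /=; rewrite h0.
rewrite /= /cintegral; apply: complexP => /=; apply: Z.
- under eq_fun do rewrite !partsE mulr0 subr0.
  apply: measurable_funM => //; apply: measurable_funB; apply: measurable_funM => //.
  exact: measurable_funN.
- by apply: filterS fg0 => x fg0 Dx; rewrite fg0// mul0r.
- under eq_fun do rewrite !partsE mulr0 add0r.
  apply: measurable_funM => //; apply: measurable_funD; apply: measurable_funM => //.
  exact: measurable_funN.
- by apply: filterS fg0 => x fg0 Dx; rewrite fg0// mul0r.
Qed.

Lemma hdot_L2_ae0l f g : hmem (L2 D w) f -> hmem (L2 D w) g ->
  aeq D f 0 -> hdot (L2 D w) f g = 0.
Proof.
move=> hf hg f0; apply: hdot_L2_ae0 => //.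
by apply: filterS f0 => x f0 Dx; rewrite f0// mul0r.
Qed.

Lemma hdot_L2_ae0r f g : hmem (L2 D w) f -> hmem (L2 D w) g ->
  aeq D g 0 -> hdot (L2 D w) f g = 0.
Proof.
move=> hf hg g0; apply: hdot_L2_ae0 => //.
by apply: filterS g0 => x g0 Dx; rewrite g0// conjc0 mulr0.
Qed.

Lemma hsq_L2_eq0 f : (forall x, D x -> 0 < w x) -> hmem (L2 D w) f ->
  hsq (L2 D w) f = 0 <-> aeq D f 0.
Proof.
move=> wp hf; split.
  move=> e0; have := congr1 (@EFin R) e0; rewrite hsq_L2_EFin// => e.
  have h : (\int[mu]_(x in D) `|(sqn (f x) * w x)%:E|)%E = 0%E.
    rewrite -[RHS]e; apply: eq_integral => x /set_mem Dx.
    by rewrite /= ger0_norm// mulr_ge0 ?sqn_ge0 ?w0.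
  have := (ae_eq_integral_abs mu mD (measurable_sqnw hf.1)).1 h.
  apply: filterS => x fx Dx; have /= [] := fx Dx => /eqP.
  by rewrite mulf_eq0 [w x == 0]gt_eqF ?wp// orbF => /eqP /sqn_eq0.
by move=> f0; rewrite /hsq hdot_L2_ae0l.
Qed.

End WeightedL2.
End L2Theory.

(** * Complex-valued integrals and almost everywhere equality *)

Section ComplexIntegral.
Context {R : realType}.
Implicit Types (D E : set R) (w : R -> R) (f g : cfun R) (a b c x : R).

Lemma measurable_itvR (i : interval R) : mset [set` i].
Proof. exact: measurable_itv. Qed.
#[local] Hint Resolve measurable_itvR : core.

Lemma cintegrable_measurable D f : cintegrable D f -> cmeasurable D f.
Proof.
by move=> [/integrableP[/measurable_EFinP fr _] /integrableP[/measurable_EFinP fi _]].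
Qed.

Lemma cmeasurableS D E f : mset E -> D `<=` E -> cmeasurable E f -> cmeasurable D f.
Proof.
by move=> mE DE [fr fi]; split; [exact: measurable_funS fr|exact: measurable_funS fi].
Qed.

Lemma cmeasurable_eq D f g : {in D, f =1 g} -> cmeasurable D f -> cmeasurable D g.
Proof.
by move=> fg [fr fi]; split; [apply: eq_measurable_fun fr|apply: eq_measurable_fun fi];
  move=> x Dx; rewrite /= fg.
Qed.

Lemma cintegrable0 D : mset D -> cintegrable D (0 : cfun R).
Proof. by move=> mD; split; have := @integrable0 _ _ R mu D; exact. Qed.

Lemma cintegrableL D (c : R[i]) f g : mset D ->
  cintegrable D f -> cintegrable D g -> cintegrable D (c *: f + g).
Proof.
move=> mD [fr fi] [gr gi].
have Z (u v w : R -> R) (p q : R) : mu.-integrable D (EFin \o u) ->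
    mu.-integrable D (EFin \o v) -> mu.-integrable D (EFin \o w) ->
    mu.-integrable D (fun x => (p * u x + q * v x + w x)%:E).
  move=> hu hv hw; apply: integrable_addr => //; apply: integrable_addr => //;
  exact: integrable_scaler.
split.
  apply: eq_integrable (Z _ _ _ (cre c) (- cim c) fr fi gr) => // x _.
  by congr EFin; rewrite /= !partsE; ring.
apply: eq_integrable (Z _ _ _ (cim c) (cre c) fr fi gi) => // x _.
by congr EFin; rewrite /= !partsE; ring.
Qed.

Lemma cintegralL D (c : R[i]) f g : mset D ->
  cintegrable D f -> cintegrable D g ->
  cintegral D (c *: f + g) = c * cintegral D f + cintegral D g.
Proof.
move=> mD [fr fi] [gr gi].
have Z (u v w : R -> R) (p q : R) : mu.-integrable D (EFin \o u) ->
    mu.-integrable D (EFin \o v) -> mu.-integrable D (EFin \o w) ->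
    (\int[mu]_(x in D) (p * u x + q * v x + w x) =
    p * \int[mu]_(x in D) u x + q * \int[mu]_(x in D) v x + \int[mu]_(x in D) w x)%R.
  move=> hu hv hw; rewrite RintegralD//; last first.
    by apply: integrable_addr => //; exact: integrable_scaler.
  by rewrite RintegralD//; [rewrite !RintegralZl|exact: integrable_scaler|exact: integrable_scaler].
apply: complexP; rewrite !partsE /=.
  rewrite -mulNr -Z//; apply: eq_Rintegral => x _; rewrite /= !partsE; ring.
rewrite -Z//; apply: eq_Rintegral => x _; rewrite /= !partsE; ring.
Qed.

Lemma cintegral0 D : cintegral D (0 : cfun R) = 0.
Proof. by apply: complexP; rewrite /= /Rintegral integral0_eq. Qed.

Lemma cintegrableS D E f : mset D -> mset E -> D `<=` E ->
  cintegrable E f -> cintegrable D f.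
Proof. by move=> mD mE DE [fr fi]; split; [exact: integrableS fr|exact: integrableS fi]. Qed.

Lemma cintegral_ae D f g : mset D -> cmeasurable D f -> cmeasurable D g ->
  aeq D f g -> cintegral D f = cintegral D g.
Proof.
move=> mD [fr fi] [gr gi] fg; apply: complexP => /=; congr fine.
  apply: ae_eq_integral => //; try exact/measurable_EFinP.
  by apply: filterS fg => x fg Dx; rewrite fg.
apply: ae_eq_integral => //; try exact/measurable_EFinP.
by apply: filterS fg => x fg Dx; rewrite fg.
Qed.

Lemma eq_cintegral D f g : {in D, f =1 g} -> cintegral D f = cintegral D g.
Proof.
by move=> fg; apply: complexP; apply: eq_Rintegral => x Dx; rewrite /= fg.
Qed.

Lemma cintegrable_ae D f g : mset D -> cmeasurable D g ->
  aeq D f g -> cintegrable D f -> cintegrable D g.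
Proof.
move=> mD [gr gi] fg [fr fi].
have Z (u v : R -> R) : mfun D v -> {ae mu, forall x, D x -> u x = v x} ->
    mu.-integrable D (EFin \o u) -> mu.-integrable D (EFin \o v).
  move=> mv uv /integrableP[mu' iu]; apply/integrableP; split; first exact/measurable_EFinP.
  apply: le_lt_trans iu; rewrite le_eqVlt; apply/orP; left; apply/eqP.
  apply: ge0_ae_eq_integral => //.
  - by apply: measurableT_comp => //; exact/measurable_EFinP.
  - exact: measurableT_comp.
  - by apply: filterS uv => x uv Dx; rewrite /= uv.
split; [apply: Z fr|apply: Z fi] => //; by apply: filterS fg => x fg Dx; rewrite fg.
Qed.

Lemma cintegral_itv1 a f : cintegral `[a, a] f = 0.
Proof. by rewrite set_itv1; apply: complexP; rewrite /= Rintegral_set1. Qed.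

Lemma cintegral_cat a c x f : a <= c -> c <= x -> cintegrable `[a, x] f ->
  cintegral `[a, x] f = cintegral `[a, c] f + cintegral `[c, x] f.
Proof.
move=> ac cx [fr fi].
have Z (u : R -> R) : mu.-integrable `[a, x] (EFin \o u) ->
   (\int[mu]_(t in `[a, x]) u t = \int[mu]_(t in `[a, c]) u t +
     \int[mu]_(t in `[c, x]) u t)%R.
  move=> iu; apply/eqP; rewrite addrC -subr_eq; apply/eqP.
  rewrite Rintegral_itvB ?bnd_simp// Rintegral_itv_obnd_cbnd//.
  by apply: integrableS iu => //; apply: subset_itvr; rewrite bnd_simp.
by apply: complexP; rewrite !partsE /=; exact: Z.
Qed.

Lemma subset_itvcc a b c x : a <= c -> x <= b -> `[c, x] `<=` `[a, b].
Proof. by move=> ac xb; apply: subset_itv; rewrite bnd_simp. Qed.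

Lemma ae_neq a : {ae (@lebesgue_measure R), forall x, x != a}.
Proof.
exists [set a]; split => //; first exact: lebesgue_measure_set1.
by move=> x /= /negP; rewrite negbK => /eqP.
Qed.

(** The end points form a null set. This mediates between the closed segments of [H2] and the
    half-open or open domains of the L2 spaces. *)
Lemma aeq_itv a b f g : aeq `]a, b[ f g -> aeq `[a, b] f g.
Proof.
move=> fg; apply: filterS3 fg (ae_neq a) (ae_neq b) => x fg xa xb.
rewrite /= in_itv/= => /andP[ax bx]; apply: fg.
by rewrite /= in_itv/= !lt_neqAle ax bx xb eq_sym xa.
Qed.

Lemma aeqS D E f g : D `<=` E -> aeq E f g -> aeq D f g.
Proof. by move=> DE; apply: filterS => x fg Dx; apply: fg; exact: DE. Qed.

Lemma aeq_sym D f g : aeq D f g -> aeq D g f.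
Proof. by apply: filterS => x fg Dx; rewrite fg. Qed.

Lemma aeq_trans D f g h : aeq D f g -> aeq D g h -> aeq D f h.
Proof. by apply: filterS2 => x fg gh Dx; rewrite fg// gh. Qed.

Lemma cmeasurable_itv a b f : cmeasurable `]a, b[ f -> cmeasurable `[a, b] f.
Proof.
by move=> [fr fi]; split; [exact: measurable_fun_itv_cc fr|exact: measurable_fun_itv_cc fi].
Qed.

End ComplexIntegral.
#[local] Hint Resolve measurable_itvR : core.

(** * Absolutely continuous functions and solution operators *)

Section AbsolutelyContinuous.
Context {R : realType}.
Implicit Types (D E : set R) (w : R -> R) (f g : cfun R) (a b c x : R).

Lemma abscont0 a b : abscont a b (0 : cfun R) 0.
Proof.
by split=> [|x _]; [exact: cintegrable0|rewrite cintegral0 addr0].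
Qed.

Lemma abscontL a b (c : R[i]) f f1 g g1 : abscont a b f f1 -> abscont a b g g1 ->
  abscont a b (c *: f + g) (c *: f1 + g1).
Proof.
move=> [if1 ef] [ig1 eg]; split=> [|x /[dup] axb /andP[ax xb]]; first exact: cintegrableL.
rewrite cintegralL//; [|apply: cintegrableS if1|apply: cintegrableS ig1] => //;
  [|exact: subset_itvcc|exact: subset_itvcc].
change (c * f x + g x = (c * f a + g a) +
  (c * cintegral `[a, x] f1 + cintegral `[a, x] g1)).
by rewrite ef// eg//; ring.
Qed.

Lemma abscontS a b c d f f1 : a <= c -> d <= b -> abscont a b f f1 -> abscont c d f f1.
Proof.
move=> ac db [if1 ef]; split; first by apply: cintegrableS if1 => //; exact: subset_itvcc.
move=> x /andP[cx xd]; have xb := le_trans xd db.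
rewrite ef ?(le_trans ac)// (ef c) ?ac ?(le_trans cx)// -addrA; congr (_ + _).
by apply: cintegral_cat => //; apply: cintegrableS if1 => //; exact: subset_itvcc.
Qed.

Lemma abscont_cat a b c f f1 : a <= c -> c <= b -> abscont a c f f1 ->
  abscont c b f f1 -> abscont a b f f1.
Proof.
move=> ac cb [if1 ef] [if2 eg].
have iab : cintegrable `[a, b] f1.
  have Z (u : R -> R) : mu.-integrable `[a, c] (EFin \o u) ->
     mu.-integrable `[c, b] (EFin \o u) -> mu.-integrable `[a, b] (EFin \o u).
    have -> : `[a, b]%classic = `[a, c] `|` `]c, b].
      by apply: itv_bndbnd_setU; rewrite bnd_simp.
    move=> /integrableP[m1 u1] iu2.
    have /integrableP[m2 u2] : mu.-integrable `]c, b] (EFin \o u).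
      by apply: integrableS iu2 => //; apply: subset_itvr; rewrite bnd_simp.
    have m12 : mfun (`[a, c] `|` `]c, b]) (EFin \o u) by apply/measurable_funU.
    apply/integrableP; split => //; rewrite ge0_integral_setU//.
    - exact: lte_add_pinfty.
    - exact: measurableT_comp.
    - apply/disj_setPS => y [/=]; rewrite !in_itv/= => /andP[_ yc] /andP[].
      by rewrite ltNge yc.
  by split; [exact: Z if1.1 if2.1|exact: Z if1.2 if2.2].
split=> // x /andP[ax xb]; have [xc|cx] := leP x c; first by rewrite ef ?ax.
rewrite eg ?(ltW cx)// ef ?ac ?lexx// -addrA; congr (_ + _); apply/esym.
apply: cintegral_cat => //; first exact: ltW.
by apply: cintegrableS iab => //; exact: subset_itvcc.
Qed.

Lemma abscont_eq a b f f1 g g1 : a <= b -> abscont a b f f1 ->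
  (forall x, a <= x <= b -> f x = g x) -> aeq `[a, b] f1 g1 ->
  cmeasurable `[a, b] g1 -> abscont a b g g1.
Proof.
move=> ab [if1 ef] fg fg1 mg1; split; first exact: cintegrable_ae if1.
move=> x /andP[ax xb]; rewrite -!fg ?lexx ?ab ?ax// ef ?ax//; congr (_ + _).
apply: cintegral_ae => //.
- by apply: cmeasurableS (cintegrable_measurable if1) => //; exact: subset_itvcc.
- by apply: cmeasurableS mg1 => //; exact: subset_itvcc.
- by apply: aeqS fg1; exact: subset_itvcc.
Qed.

Lemma abscont_continuous a b f f1 : a <= b -> abscont a b f f1 ->
  {within `[a, b], continuous (fun x => cre (f x))} /\
  {within `[a, b], continuous (fun x => cim (f x))}.
Proof.
move=> ab [[ir ii] ef].
have Z (u v : R -> R) : mu.-integrable `[a, b] (EFin \o v) ->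
   (forall x, a <= x <= b -> u x = u a + \int[mu]_(t in `[a, x]) v t)%R ->
   {within `[a, b], continuous u}.
  move=> iv uv.
  have := parameterized_integral_continuous ab iv; rewrite /parameterized_integral => cv.
  have E : {in `[a, b]%classic, (fun x => u a + \int[mu]_(t in `[a, x]) v t)%R =1 u}.
    by move=> x /set_mem xab; rewrite [RHS]uv//; move: xab; rewrite /= in_itv.
  apply: (@subspace_eq_continuous R `[a, b]%classic R _ _ E).
  by move=> x; apply: cvgD; [exact: cvg_cst|exact: cv].
split; [apply: (Z _ _ ir)|apply: (Z _ _ ii)] => x xab.
  by rewrite ef// !partsE.
by rewrite ef// !partsE.
Qed.

End AbsolutelyContinuous.

(** * Primitives and their bounds in L2 of a segment *)

Section Green.
Context {R : realType}.
Implicit Types (D E : set R) (w : R -> R) (f g : cfun R) (a b c x : R).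

Local Notation L2c a b := (L2 `[a, b] (cst 1)).

Lemma semihilbert_L2c a b : semihilbert (L2c a b : hspace (cfun R)).
Proof. by apply: semihilbert_L2 => //; exact: measurable_cst. Qed.
#[local] Hint Resolve semihilbert_L2c : core.

Lemma integrable_cst_itv a b (k : R) : mu.-integrable `[a, b] (EFin \o cst k).
Proof.
apply: continuous_compact_integrable; first exact: segment_compact.
by move=> x; exact: cvg_cst.
Qed.

(** All weights that occur are at least 1, so restriction to a segment does not increase the norm,
    and solution operators can be estimated in the unweighted L2 of a closed segment. *)
Lemma L2_restrict D w a b g : mset D -> mfun D w -> (forall x, D x -> 0 <= w x) ->
  `]a, b[ `<=` D -> (forall x, a < x < b -> 1 <= w x) -> hmem (L2 D w) g ->
  hmem (L2c a b) g /\ hsq (L2c a b) g <= hsq (L2 D w) g.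
Proof.
move=> mD mw w0 abD w1 hg.
have mg : cmeasurable `]a, b[ g by exact: cmeasurableS hg.1.
have mg' := cmeasurable_itv mg.
have le : (\int[mu]_(x in `[a, b]) (sqn (g x) * 1)%:E <=
    \int[mu]_(x in D) (sqn (g x) * w x)%:E)%E.
  rewrite -integral_itv_obnd_cbnd; last first.
    apply/measurable_EFinP; apply: measurable_funM; last exact: measurable_cst.
    apply: measurable_sqn; apply: cmeasurableS mg' => //.
    by apply: subset_itvr; rewrite bnd_simp.
  rewrite -integral_itv_bndo_bndc; last first.
    apply/measurable_EFinP; apply: measurable_funM; last exact: measurable_cst.
    exact: measurable_sqn.
  apply: (@le_trans _ _ (\int[mu]_(x in `]a, b[) (sqn (g x) * w x)%:E)%E).
    apply: ge0_le_integral => //.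
    - by move=> x _; rewrite lee_fin mulr_ge0 ?sqn_ge0.
    - apply/measurable_EFinP; apply: measurable_funM; last exact: measurable_cst.
      exact: measurable_sqn.
    - by apply: measurable_sqnw => //; exact: measurable_funS mw.
    - move=> x; rewrite /= in_itv/= => xab; rewrite lee_fin.
      by apply: ler_wpM2l; [exact: sqn_ge0|exact: w1].
  apply: ge0_subset_integral => //; first exact: measurable_sqnw hg.1.
  by move=> x Dx; rewrite lee_fin mulr_ge0 ?sqn_ge0 ?w0.
have hg' : hmem (L2c a b) g by split => //; apply: le_lt_trans le hg.2.
split=> //; rewrite -lee_fin (hsq_L2_EFin _ mw)// hsq_L2_EFin//.
Qed.

Lemma L2c_cintegrable a b g : hmem (L2c a b) g -> cintegrable `[a, b] g.
Proof.
move=> hg; have [mr mi] := hg.1.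
have i1 : mu.-integrable `[a, b] (fun x => (1 + sqn (g x) * 1)%:E).
  apply: integrable_addr => //; last by apply: integrable_sqn => //; exact: measurable_cst.
  exact: integrable_cst_itv.
have sq1 (p q : R) : `|p| <= 1 + (p ^+ 2 + q ^+ 2).
  have := sqr_ge0 (`|p| - 2^-1); have := sqr_ge0 q.
  rewrite -(real_normK (num_real p)); set n := `|p|; nra.
have pos (z : R[i]) : 0 <= 1 + sqn z by rewrite addr_ge0 ?sqn_ge0.
split; apply: le_integrable i1 => //; try exact/measurable_EFinP.
  move=> x _; rewrite lee_fin mulr1 [X in _ <= X]ger0_norm//.
  exact: sq1.
move=> x _; rewrite lee_fin mulr1 [X in _ <= X]ger0_norm//.
by rewrite /sqn [_ ^+ 2 + _]addrC; exact: sq1.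
Qed.

Lemma hmem_L2c_sub a b c d g : a <= c -> d <= b -> hmem (L2c a b) g ->
  hmem (L2c c d) g /\ hsq (L2c c d) g <= hsq (L2c a b) g.
Proof.
move=> ac db; apply: L2_restrict => //.
by apply: subset_itv; rewrite bnd_simp.
Qed.

Lemma L2c_continuous a b f : {within `[a, b], continuous (fun x => cre (f x))} ->
  {within `[a, b], continuous (fun x => cim (f x))} -> hmem (L2c a b) f.
Proof.
move=> cr ci.
have mf : cmeasurable `[a, b] f.
  by split; apply: subspace_continuous_measurable_fun.
have isq : mu.-integrable `[a, b] (EFin \o (fun x => sqn (f x))).
  apply: continuous_compact_integrable; first exact: segment_compact.
  have -> : (fun x => sqn (f x)) =
      (fun x => cre (f x) * cre (f x) + cim (f x) * cim (f x)).
    by apply/funext => x; rewrite /sqn !expr2.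
  by move=> x; apply: cvgD; apply: cvgM; by [exact: cr|exact: ci].
apply: (@hmem_L2_le _ _ (cst 1) _ _ _ _ _ mf isq) => //.
by move=> x _; rewrite mulr1.
Qed.

Lemma abscont_L2c a b f f1 : a <= b -> abscont a b f f1 -> hmem (L2c a b) f.
Proof.
by move=> ab /(abscont_continuous ab)[cr ci]; exact: L2c_continuous.
Qed.

Definition cprim a g : cfun R := fun x => cintegral `[a, x] g.

Lemma cprim0 a g : cprim a g a = 0.
Proof. exact: cintegral_itv1. Qed.

Lemma abscont_cprim a b g : cintegrable `[a, b] g -> abscont a b (cprim a g) g.
Proof. by move=> ig; split=> // x _; rewrite cprim0 add0r. Qed.

Lemma cprim_bound a b g x : hmem (L2c a b) g -> a <= x <= b ->
  sqn (cprim a g x) <= (b - a) * hsq (L2c a b) g.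
Proof.
move=> hg /andP[ax xb].
have [hgx le] := hmem_L2c_sub (lexx a) xb hg.
apply: (@le_trans _ _ ((x - a) * hsq (L2c a x) g)); last first.
  apply: (@le_trans _ _ ((b - a) * hsq (L2c a x) g)).
    by apply: ler_wpM2r; [exact: hsq_ge0|lra].
  by apply: ler_wpM2l => //; lra.
have [ir ii] := L2c_cintegrable hgx.
have [mr mi] := hgx.1.
have Z (u : R -> R) : mfun `[a, x] u -> mu.-integrable `[a, x] (EFin \o u) ->
    mu.-integrable `[a, x] (EFin \o (fun t => u t ^+ 2)) ->
    (\int[mu]_(t in `[a, x]) u t) ^+ 2 <= (x - a) * \int[mu]_(t in `[a, x]) (u t ^+ 2).
  move=> mu' iu iu2; set I := (\int[mu]_(t in `[a, x]) u t)%R.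
  (* The degenerate interval is treated apart, since the mean [I / (x - a)] is used below. *)
  have [xa|ax'] := leP x a.
    have -> : x = a by apply/eqP; rewrite eq_le xa ax.
    by rewrite subrr mul0r /I (_ : x = a) ?set_itv1 ?Rintegral_set1 ?expr0n//; lra.
  have xa0 : 0 < x - a by lra.
  have i0 : mu.-integrable `[a, x] (EFin \o cst ((I / (x - a)) ^+ 2)).
    exact: integrable_cst_itv.
  (* Cauchy-Schwarz against the constant 1: the integrand is the square of [u] minus its mean,
     written out. *)
  have : 0 <= \int[mu]_(t in `[a, x]) (u t ^+ 2 +
      (- (2 * (I / (x - a))) * u t + (I / (x - a)) ^+ 2)).
    apply: Rintegral_ge0 => t _; have := sqr_ge0 (u t - I / (x - a)); nra.
  rewrite RintegralD//; last by apply: integrable_addr => //; exact: integrable_scaler.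
  rewrite RintegralD//; last exact: integrable_scaler.
  rewrite RintegralZl// Rintegral_cst// (_ : fine _ = x - a); last first.
    by rewrite /= lebesgue_measure_itv/= lte_fin ax' -EFinB.
  rewrite -/I => h.
  rewrite mulrC -ler_pdivrMr//; move: h.
  have -> : - (2 * (I / (x - a))) * I + (I / (x - a)) ^+ 2 * (x - a) = - (I ^+ 2 / (x - a)).
    by field; rewrite gt_eqF.
  by rewrite subr_ge0.
have sqr_int (u : R -> R) : mfun `[a, x] u -> (forall t, u t ^+ 2 <= sqn (g t)) ->
    mu.-integrable `[a, x] (EFin \o (fun t => u t ^+ 2)).
  move=> mu' le_u; apply: le_integrable (integrable_sqn _ _ _ hgx) => //.
  - by apply/measurable_EFinP; exact: measurable_funX.
  - by move=> t _; rewrite lee_fin mulr1 !ger0_norm ?sqr_ge0 ?sqn_ge0.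
have ir2 : mu.-integrable `[a, x] (EFin \o (fun t => cre (g t) ^+ 2)).
  by apply: sqr_int => // t; rewrite lerDl sqr_ge0.
have ii2 : mu.-integrable `[a, x] (EFin \o (fun t => cim (g t) ^+ 2)).
  by apply: sqr_int => // t; rewrite lerDr sqr_ge0.
have -> : hsq (L2c a x) g = (\int[mu]_(t in `[a, x]) (cre (g t) ^+ 2) +
    \int[mu]_(t in `[a, x]) (cim (g t) ^+ 2))%R.
  by rewrite -RintegralD// hsq_L2E; apply: eq_Rintegral => t _; rewrite mulr1.
by rewrite mulrDr lerD//; exact: Z.
Qed.

End Green.

Section GreenOperators.
Context {R : realType}.
Implicit Types (D E P Q : set R) (w : R -> R) (f g : cfun R) (a b c x : R).

Local Notation L2c a b := (L2 `[a, b] (cst 1)).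
#[local] Hint Resolve semihilbert_L2c : core.

Lemma cintegral_cst a x (z : R[i]) : a <= x ->
  cintegral `[a, x] (cst z : cfun R) = z * (x - a)%:C.
Proof.
move=> ax; have m : fine (@lebesgue_measure R `[a, x]) = x - a.
  rewrite lebesgue_measure_itv/= lte_fin; case: ifPn => [_ //|].
  by rewrite -leNgt => xa; rewrite (_ : x = a) ?subrr//; apply/eqP; rewrite eq_le xa.
by apply: complexP; rewrite !partsE mulr0 ?subr0 ?add0r /cintegral /= -m -Rintegral_cst.
Qed.

Lemma cintegrable_cst a b (z : R[i]) : cintegrable `[a, b] (cst z : cfun R).
Proof. by split; exact: integrable_cst_itv. Qed.

Definition cprim2 a g : cfun R := cprim a (cprim a g).

Lemma cprim_L2c a b g : a <= b -> hmem (L2c a b) g -> hmem (L2c a b) (cprim a g).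
Proof.
move=> ab hg; apply: (abscont_L2c (f1 := g)) => //; apply: abscont_cprim.
exact: L2c_cintegrable.
Qed.

Lemma eq_cprim a b f g x : aeq `[a, b] f g -> cmeasurable `[a, b] f ->
  cmeasurable `[a, b] g -> x <= b -> cprim a f x = cprim a g x.
Proof.
move=> fg mf mg xb; have sub := subset_itvcc (lexx a) xb.
by apply: cintegral_ae => //; [exact: cmeasurableS mf|exact: cmeasurableS mg|exact: aeqS fg].
Qed.

Lemma cprimL a b (z : R[i]) f g x : hmem (L2c a b) f -> hmem (L2c a b) g -> x <= b ->
  cprim a (z *: f + g) x = z * cprim a f x + cprim a g x.
Proof.
move=> hf hg xb; have sub := subset_itvcc (lexx a) xb.
by apply: cintegralL => //; [apply: cintegrableS sub _|apply: cintegrableS sub _] => //;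
  exact: L2c_cintegrable.
Qed.

Lemma cprim2L a b (z : R[i]) f g x : a <= b -> hmem (L2c a b) f -> hmem (L2c a b) g ->
  x <= b -> cprim2 a (z *: f + g) x = z * cprim2 a f x + cprim2 a g x.
Proof.
move=> ab hf hg xb; rewrite /cprim2 -(cprimL (b := b))//; last 2 first.
- exact: cprim_L2c.
- exact: cprim_L2c.
apply: eq_cintegral => y /set_mem; rewrite /= in_itv/= => /andP[ay yx].
by rewrite (cprimL (b := b))// (le_trans yx).
Qed.

(* The solution of y'' = g with y(a) = al and y'(a) = be, and its derivative. *)
Definition H2sol a (al be : R[i]) g : cfun R :=
  fun x => al + be * (x - a)%:C + cprim2 a g x.
Definition H2sol1 a (be : R[i]) g : cfun R := fun x => be + cprim a g x.

Lemma abscont_H2sol a b al be g : a <= b -> hmem (L2c a b) g ->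
  abscont a b (H2sol a al be g) (H2sol1 a be g) /\ abscont a b (H2sol1 a be g) g.
Proof.
move=> ab hg; have ig := L2c_cintegrable hg.
have ig1 := L2c_cintegrable (cprim_L2c ab hg).
have c1 : cintegrable `[a, b] (H2sol1 a be g).
  have := cintegrableL 1 (measurable_itvR `[a, b]) (cintegrable_cst a b be) ig1.
  by rewrite scale1r.
split; split => // x /andP[ax xb]; last first.
  by rewrite /H2sol1 cprim0 addr0.
rewrite /H2sol subrr mulr0 /cprim2 cprim0 !addr0 -addrA; congr (_ + _).
have sub := subset_itvcc (lexx a) xb.
have := @cintegralL R `[a, x] 1 (cst be) (cprim a g) (measurable_itvR _).
rewrite scale1r mul1r cintegral_cst// => -> //.
- exact: cintegrable_cst.
- exact: cintegrableS ig1.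
Qed.

(** Integrating twice from [a] shows that an H^2 function solves the Cauchy problem with its own
    initial data, so it is determined by [F a], [F1 a] and [F2]. *)
Lemma H2_solE a b f F F1 F2 x : H2 a b f F F1 F2 -> a <= x <= b ->
  F x = H2sol a (F a) (F1 a) F2 x /\ F1 x = H2sol1 a (F1 a) F2 x.
Proof.
move=> [_ [i1 e1] [i2 e2] hF2] /[dup] axb /andP[ax xb]; split; last exact: e2.
have ab := le_trans ax xb.
have [[_ e3] _] := abscont_H2sol (F a) (F1 a) ab hF2.
rewrite e1// e3// /H2sol subrr mulr0 /cprim2 cprim0 !addr0; congr (_ + _).
apply: eq_cintegral => y /set_mem; rewrite /= in_itv/= => /andP[ay yx].
by apply: e2; rewrite ay (le_trans yx).
Qed.

(* The functionals g |-> L g x are linear and bounded on X, uniformly for x in P. *)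
Definition blin (X : hspace (cfun R)) P (L : cfun R -> R -> R[i]) :=
  (forall f g x, hmem X f -> hmem X g -> P x -> L (f - g) x = L f x - L g x) /\
  exists2 C, 0 <= C & forall g x, hmem X g -> P x -> sqn (L g x) <= C * hsq X g.

Section BoundedLinear.
Variable X : hspace (cfun R).
Hypothesis HX : semihilbert X.
Implicit Types L M : cfun R -> R -> R[i].

Lemma blinD P L M : blin X P L -> blin X P M -> blin X P (fun g x => L g x + M g x).
Proof.
move=> [l1 [C C0 b1]] [l2 [C' C'0 b2]]; split.
  by move=> f g x hf hg Px; rewrite l1// l2//; ring.
exists (2 * C + 2 * C'); first lra.
move=> g x hg Px; apply: le_trans (sqnD _ _) _.
by have := b1 g x hg Px; have := b2 g x hg Px; lra.
Qed.

Lemma blinM P (m : R -> R[i]) K L : 0 <= K -> (forall x, P x -> sqn (m x) <= K) ->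
  blin X P L -> blin X P (fun g x => m x * L g x).
Proof.
move=> K0 mK [l1 [C C0 b1]]; split; first by move=> f g x hf hg Px; rewrite l1//; ring.
exists (K * C) => [|g x hg Px]; first exact: mulr_ge0.
by rewrite sqnM -mulrA ler_pM ?sqn_ge0 ?mK ?b1.
Qed.

Lemma blinZ P (z : R[i]) L : blin X P L -> blin X P (fun g x => z * L g x).
Proof. by apply: (@blinM P (fun=> z) (sqn z)) => //; exact: sqn_ge0. Qed.

(** Initial values and slopes of solutions are functionals without a variable; they are treated as
    families constant in [x]. *)
Lemma blin_at P Q L y : blin X P L -> P y -> blin X Q (fun g _ => L g y).
Proof.
move=> [l1 [C C0 b1]] Py; split; first by move=> f g _ hf hg _; exact: l1.
by exists C => // g _ hg _; exact: b1.
Qed.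

Lemma blinS P Q L : Q `<=` P -> blin X P L -> blin X Q L.
Proof.
move=> QP [l1 [C C0 b1]]; split; first by move=> f g x hf hg /QP; exact: l1.
by exists C => // g x hg /QP; exact: b1.
Qed.

Lemma blin_if P (p : pred R) L M : blin X (P `&` [set x | p x]) L ->
  blin X (P `&` [set x | ~~ p x]) M -> blin X P (fun g x => if p x then L g x else M g x).
Proof.
move=> [l1 [C C0 b1]] [l2 [C' C'0 b2]]; split.
  by move=> f g x hf hg Px; case: ifPn => px; [exact: l1|exact: l2].
exists (C + C') => [|g x hg Px]; first exact: addr_ge0.
have h0 := hsq_ge0 HX g.
case: ifPn => px; [apply: le_trans (b1 _ _ hg _) _|apply: le_trans (b2 _ _ hg _) _] => //;
  by apply: ler_wpM2r => //; lra.
Qed.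

Variables (a b : R).
Hypothesis ab : a <= b.
Hypothesis Xab : forall g, hmem X g -> hmem (L2c a b) g /\ hsq (L2c a b) g <= hsq X g.

Lemma blin_cprim : blin X `[a, b] (cprim a).
Proof.
split.
  move=> f g x hf hg; rewrite /= in_itv/= => /andP[ax xb].
  rewrite addrC -scaleN1r (cprimL (b := b)) ?mulN1r 1?addrC//; exact: (Xab _).1.
exists (b - a) => [|g x hg]; first by rewrite subr_ge0.
rewrite /= in_itv/= => axb; have [h1 h2] := Xab hg.
apply: le_trans (cprim_bound h1 axb) _; apply: ler_wpM2l => //; by rewrite subr_ge0.
Qed.

Lemma blin_cprim2 : blin X `[a, b] (cprim2 a).
Proof.
split.
  move=> f g x hf hg; rewrite /= in_itv/= => /andP[ax xb].
  rewrite addrC -scaleN1r (cprim2L (b := b)) ?mulN1r 1?addrC//; exact: (Xab _).1.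
have [_ [C C0 bC]] := blin_cprim.
exists ((b - a) * (C * (b - a))) => [|g x hg]; first by rewrite !mulr_ge0// subr_ge0.
rewrite /= in_itv/= => axb; have [h1 h2] := Xab hg.
(* The bound for one primitive is applied to [cprim a g], whose square norm is at most its uniform
   bound times the length of the segment. *)
apply: le_trans (cprim_bound (cprim_L2c ab h1) axb) _.
rewrite -mulrA; apply: ler_wpM2l; first by rewrite subr_ge0.
have i1 := L2c_cintegrable h1.
rewrite hsq_L2E; apply: (@le_trans _ _ (\int[mu]_(y in `[a, b]) (C * hsq X g))%R).
  apply: le_Rintegral => //.
  - by apply: integrable_sqn => //; exact: cprim_L2c.
  - exact: integrable_cst_itv.
  - by move=> y yab; rewrite mulr1 bC.
rewrite Rintegral_cst// (_ : fine _ = b - a); first by rewrite -!mulrA [hsq X g * _]mulrC.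
rewrite /= lebesgue_measure_itv/= lte_fin; case: ifPn => [_ //|].
by rewrite -leNgt => ba; rewrite (_ : b = a) ?subrr//; apply/eqP; rewrite eq_le ba.
Qed.

End BoundedLinear.

End GreenOperators.

Section Closedness.
Context {R : realType}.
Implicit Types (D E P Q : set R) (w : R -> R) (f g : cfun R) (a b c x : R).

(* If f = L g on the graph of T with L bounded, then this persists on the closure. *)
Lemma closed_blin D w (T : cfun R -> cfun R -> Prop) (L : cfun R -> cfun R) :
  mset D -> mfun D w -> (forall x, D x -> 0 <= w x) -> mu.-integrable D (EFin \o w) ->
  blin (L2 D w) D L ->
  (forall g, hmem (L2 D w) g -> hmem (L2 D w) (L g)) ->
  (forall f g, T f g -> [/\ hmem (L2 D w) f, hmem (L2 D w) g & aeq D f (L g)]) ->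
  (forall x, D x -> 0 < w x) ->
  forall f g, op_closure (L2 D w) T f g -> aeq D f (L g).
Proof.
move=> mD mw w0 iw [lin [C C0 bC]] hL TL wp f g [hf hg cl].
have sh := semihilbert_L2 mD mw w0.
have hfL : hmem (L2 D w) (f - L g) by apply: hmemB => //; exact: hL.
suff /(hsq_L2_eq0 mD mw w0 wp hfL) : hsq (L2 D w) (f - L g) = 0.
  by apply: filterS => x h Dx; apply/eqP; rewrite -subr_eq0; apply/eqP; exact: h.
(* Since [w] is integrable, the uniform bound on [L] yields a bound in L2. *)
have Lb g' : hmem (L2 D w) g' -> hsq (L2 D w) (L g - L g') <=
    C * hsq (L2 D w) (g - g') * \int[mu]_(x in D) w x.
  move=> hg'; rewrite hsq_L2E -RintegralZl//; apply: le_Rintegral => //.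
  - by apply: integrable_sqn => //; apply: hmemB => //; exact: hL.
  - exact: integrable_scaler.
  - move=> x Dx; apply: ler_wpM2r; first exact: w0.
    by change (sqn (L g x - L g' x) <= C * hsq (L2 D w) (g - g')); rewrite -lin// bC//;
      exact: hmemB.
have W0 : 0 <= (\int[mu]_(x in D) w x)%R by exact: Rintegral_ge0.
(* The 2 is the cost of [f - f']; the 4 is one factor 2 for splitting off [f' - L g] and another for
   comparing it with [L g' - L g]. *)
apply: (@hsq_close0 _ _ _ sh _ (2 + 4 * (C * \int[mu]_(x in D) w x))) => // e e0.
have se : 0 < Num.sqrt e by rewrite sqrtr_gt0.
have [f' [g' [/TL[hf' hg' fg']]]] := cl _ se.
rewrite !hnorm_lt// !sqr_sqrtr ?(ltW e0)// => ff' gg'.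
have hB u v : hmem (L2 D w) u -> hmem (L2 D w) v -> hmem (L2 D w) (u - v) by exact: hmemB.
have e1 : hsq (L2 D w) (f' - L g') = 0.
  apply/(hsq_L2_eq0 mD mw w0 wp); first exact/hB/hL.
  by apply: filterS fg' => x h Dx; apply/eqP; rewrite subr_eq0; apply/eqP; exact: h.
have e2 : hsq (L2 D w) (f' - L g) <= 2 * hsq (L2 D w) (L g - L g').
  have -> : f' - L g = (f' - L g') + (L g' - L g) by rewrite addrA subrK.
  apply: le_trans (hsqD sh _ _) _; [exact/hB/hL|by apply: hB; exact: hL|].
  by rewrite e1 mulr0 add0r (hsqB sh)//; exact: hL.
have -> : f - L g = (f - f') + (f' - L g) by rewrite addrA subrK.
apply: le_trans (hsqD sh _ _) _; [exact: hB|exact/hB/hL|].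
have := Lb _ hg'; set W := (\int[mu]_(x in D) w x)%R in W0 *.
have : C * hsq (L2 D w) (g - g') * W <= C * W * e.
  by rewrite mulrAC; apply: ler_wpM2l; [exact: mulr_ge0|exact: ltW].
lra.
Qed.

End Closedness.

(** * Closedness of the edge and vertex operators *)

Section Segments.
Context {R : realType} (A : antitree R).
Implicit Types (n m : nat) (x : R).

Lemma tnS n : tn A n.+1 = tn A n + len A n.
Proof. by rewrite /tn big_ord_recr. Qed.

Lemma tn0 : tn A 0 = 0. Proof. by rewrite /tn big_ord0. Qed.

Lemma tn_lt n : tn A n < tn A n.+1.
Proof. by rewrite tnS ltrDl len_gt0. Qed.

Lemma tn_mono : {homo tn A : n m / (n <= m)%N >-> n <= m}.
Proof. by apply: homo_leq => [//|n m p|n]; [exact: le_trans|exact: ltW (tn_lt n)]. Qed.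

Lemma tn_ge0 n : 0 <= tn A n.
Proof. by rewrite -tn0 tn_mono. Qed.

Lemma IsegE n x : Iseg A n x = (tn A n <= x < tn A n.+1) :> Prop.
Proof. by rewrite /Iseg /= in_itv. Qed.

Lemma Iseg_inj n m x : Iseg A n x -> Iseg A m x -> n = m.
Proof.
suff H p q : (p < q)%N -> Iseg A p x -> Iseg A q x -> False.
  by move=> hn hm; case: (ltngtP n m) => // [/H|/H]; [move=> /(_ hn hm)|move=> /(_ hm hn)].
rewrite !IsegE => pq /andP[_ h1] /andP[h2 _].
by have := le_lt_trans (le_trans (tn_mono pq) h2) h1; rewrite ltxx.
Qed.

Lemma sn_gt0 n : (0 < sn A n)%N. Proof. exact: sphere_gt0. Qed.

Lemma weight_Iseg n x : Iseg A n x -> weight A x = (sn A n * sn A n.+1)%:R.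
Proof.
move=> hn; rewrite /weight (_ : [set _ | _] = [set n]) ?fsbig_set1//.
apply/seteqP; split=> m /=; last by move=> ->.
by move=> hm; exact: Iseg_inj hm hn.
Qed.

Lemma tn_totlen n x : x < tn A n -> (x%:E < totlen A)%E.
Proof.
move=> xn; apply: lt_le_trans (_ : ((tn A n)%:E <= _)%E); first by rewrite lte_fin.
rewrite /totlen /tn -sumEFin -(big_mkord xpredT (fun j => (len A j)%:E)).
by apply: nneseries_lim_ge => k _ _; rewrite lee_fin ltW ?len_gt0.
Qed.

Lemma totlen_tn x : (x%:E < totlen A)%E -> exists n, x < tn A n.
Proof.
move=> h; apply/not_existsP => H; move: h; apply/negP; rewrite -leNgt.
apply: lime_le.
  by apply: is_cvg_nneseries => k _ _; rewrite lee_fin ltW ?len_gt0.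
apply: nearW => n; rewrite big_mkord sumEFin lee_fin leNgt; apply/negP; exact: H.
Qed.

Lemma interval0LP x : interval0L A x <-> exists n, Iseg A n x.
Proof.
split=> [[x0 /totlen_tn[n]]|[n]]; last first.
  rewrite IsegE => /andP[h1 h2]; split; last exact: tn_totlen h2.
  exact: le_trans (tn_ge0 n) h1.
elim: n => [|n IHn]; first by rewrite tn0 ltNge x0.
move=> xn; have [/IHn//|nx] := ltP x (tn A n).
by exists n; rewrite IsegE nx.
Qed.

Lemma interval0LE : interval0L A = \bigcup_n Iseg A n.
Proof.
apply/seteqP; split=> x; first by move=> /interval0LP[n hn]; exists n.
by move=> [n _ hn]; apply/interval0LP; exists n.
Qed.

Lemma measurable_Iseg n : mset (Iseg A n).
Proof. exact: measurable_itv. Qed.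

Lemma measurable_interval0L : mset (interval0L A).
Proof. by rewrite interval0LE; apply: bigcup_measurable => n _; exact: measurable_Iseg. Qed.

Lemma weight_ge1 x : interval0L A x -> 1 <= weight A x.
Proof.
by move=> /interval0LP[n /weight_Iseg ->]; rewrite ler1n muln_gt0 !sn_gt0.
Qed.

Lemma measurable_weight : mfun (interval0L A) (weight A).
Proof.
rewrite interval0LE; apply/measurable_fun_bigcup => n; first exact: measurable_Iseg.
apply: (@eq_measurable_fun _ _ _ _ _ (cst ((sn A n * sn A n.+1)%:R : R))).
  by move=> x /set_mem /weight_Iseg ->.
exact: measurable_cst.
Qed.

Lemma I_vertexE n x : (0 < n)%N ->
  I_vertex A n x <-> (Iseg A n.-1 x \/ Iseg A n x) /\ x != tn A n.-1.
Proof.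
case: n => // n _; rewrite /I_vertex /= in_itv/= !IsegE; split.
  move=> /andP[h1 h2]; rewrite (ltW h1) gt_eqF//; split=> //.
  by case: (ltP x (tn A n.+1)) => h3; [left|right].
move=> [h h']; rewrite lt_neqAle eq_sym h' /=.
case: h => /andP[h1 h2]; rewrite ?h1 ?h2 ?(lt_trans h2 (tn_lt _))//.
by rewrite (le_trans (ltW (tn_lt n)) h1).
Qed.

Lemma I_vertex_interval0L n : (0 < n)%N -> I_vertex A n `<=` interval0L A.
Proof.
move=> n0 x /(I_vertexE _ n0)[h _]; apply/interval0LP.
by case: h => h; [exists n.-1|exists n].
Qed.

Lemma measurable_weight_vertex n : (0 < n)%N -> mfun (I_vertex A n) (weight A).
Proof.
move=> n0; apply: measurable_funS measurable_weight; first exact: measurable_interval0L.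
exact: I_vertex_interval0L.
Qed.

End Segments.

Section ClosedOperators.
Context {R : realType}.
Implicit Types (D E P Q : set R) (w : R -> R) (f g h : cfun R) (a b c x t : R).

Local Notation L2c a b := (L2 `[a, b] (cst 1)).
#[local] Hint Resolve semihilbert_L2c : core.

Lemma eq_cprim2 a b f g x : aeq `[a, b] f g -> cmeasurable `[a, b] f ->
  cmeasurable `[a, b] g -> x <= b -> cprim2 a f x = cprim2 a g x.
Proof.
move=> fg mf mg xb; apply: eq_cintegral => y /set_mem; rewrite /= in_itv/= => /andP[_ yx].
by apply: eq_cprim fg mf mg _; exact: le_trans xb.
Qed.

Lemma H2solE a (al be : R[i]) g x :
  H2sol a al be g x = al + be * (x - a)%:C + cprim2 a g x.
Proof. by []. Qed.

Lemma H2sol1E a (be : R[i]) g x : H2sol1 a be g x = be + cprim a g x.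
Proof. by []. Qed.

Lemma H2sol_left a al be h : H2sol a al be h a = al.
Proof. by rewrite /H2sol subrr mulr0 /cprim2 cprim0 !addr0. Qed.

Lemma H2sol1_left a be h : H2sol1 a be h a = be.
Proof. by rewrite /H2sol1 cprim0 addr0. Qed.

Local Opaque cprim cprim2 H2sol H2sol1.

(** Here [F2] is replaced by a function [h] equal to it almost everywhere; with [h = - g] the
    solution is expressed through its initial data and the right-hand side [g]. *)
Lemma H2_sol a b f F F1 F2 h x : H2 a b f F F1 F2 -> aeq `]a, b[ F2 h ->
  cmeasurable `[a, b] h -> a <= x <= b ->
  F x = H2sol a (F a) (F1 a) h x /\ F1 x = H2sol1 a (F1 a) h x.
Proof.
move=> H2F F2h mh /[dup] axb /andP[ax xb]; have [-> ->] := H2_solE H2F axb.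
have {}F2h := aeq_itv F2h; have [_ _ _ [mF2 _]] := H2F.
have e1 := eq_cprim F2h mF2 mh xb; have e2 := eq_cprim2 F2h mF2 mh xb.
by rewrite !H2solE !H2sol1E e1 e2; split.
Qed.

Lemma H2_H2sol a b f al be h : a <= b -> hmem (L2c a b) h ->
  aeq `]a, b[ f (H2sol a al be h) -> H2 a b f (H2sol a al be h) (H2sol1 a be h) h.
Proof.
move=> ab hh /aeq_itv fh; have [h1 h2] := abscont_H2sol al be ab hh.
by split.
Qed.

Lemma cmeasurable_H2sol a b al be h : a <= b -> hmem (L2c a b) h ->
  cmeasurable `[a, b] (H2sol a al be h).
Proof.
move=> ab hh; have [h1 _] := abscont_H2sol al be ab hh.
exact: (abscont_L2c ab h1).1.
Qed.

Lemma blin_ext (X : hspace (cfun R)) P L M : (forall g x, L g x = M g x) ->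
  blin X P L -> blin X P M.
Proof.
by move=> LM; rewrite (_ : L = M)//; apply/funext => g; apply/funext => x; exact: LM.
Qed.

Lemma blin_opp (X : hspace (cfun R)) P L : semihilbert X -> blin X P L ->
  blin X P (fun g => L (- g)).
Proof.
move=> HX [l [C C0 bC]]; split.
  by move=> f g x hf hg Px; rewrite opprD l//; exact: hmemN.
by exists C => // g x hg Px; rewrite -(hsqN HX hg); apply: bC => //; exact: hmemN.
Qed.

Lemma blin_H2sol (X : hspace (cfun R)) a b (al be : cfun R -> R[i]) :
  semihilbert X -> a <= b ->
  (forall g, hmem X g -> hmem (L2c a b) g /\ hsq (L2c a b) g <= hsq X g) ->
  blin X setT (fun g _ => al g) -> blin X setT (fun g _ => be g) ->
  blin X `[a, b] (fun g x => H2sol a (al g) (be g) g x) /\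
  blin X `[a, b] (fun g x => H2sol1 a (be g) g x).
Proof.
move=> HX ab Xab bal bbe; split; last first.
  apply: (@blin_ext _ _ (fun g x => be g + cprim a g x)); first by move=> g x; rewrite H2sol1E.
  by apply: blinD; [exact: blinS bbe|exact: blin_cprim].
apply: (@blin_ext _ _ (fun g x => al g + (x - a)%:C * be g + cprim2 a g x)).
  by move=> g x; rewrite H2solE [_ * be g]mulrC.
apply: blinD; last exact: blin_cprim2.
apply: blinD; first exact: blinS bal.
apply: (@blinM _ _ _ _ ((b - a) ^+ 2)); [exact: sqr_ge0| |exact: blinS bbe].
move=> x; rewrite /= in_itv/= => /andP[ax xb]; rewrite sqnR.
by rewrite lerXn2r ?nnegrE ?subr_ge0 ?lerD2r.
Qed.

Lemma blin_hmem D w (L : cfun R -> cfun R) g : mset D -> mfun D w ->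
  (forall x, D x -> 0 <= w x) -> mu.-integrable D (EFin \o w) -> blin (L2 D w) D L ->
  hmem (L2 D w) g -> cmeasurable D (L g) -> hmem (L2 D w) (L g).
Proof.
move=> mD mw w0 iw [_ [C C0 bC]] hg mL.
apply: (@hmem_L2_le _ D w mD mw w0 _ (fun x => C * hsq (L2 D w) g * w x)) => //.
  exact: integrable_scaler.
by move=> x Dx; apply: ler_wpM2r; [exact: w0|exact: bC].
Qed.

Section Edge.
Variables (A : antitree R) (n : nat).
Let a := tn A n.
Let b := tn A n.+1.
Let ab : a < b := tn_lt A n.
Let X := L2 (Iseg A n) (cst 1).

(** The slope at [a] for which the solution of y'' = g with y(a) = 0 also vanishes at [b]: its value
    there is [be g * (b - a) + cprim2 a g b]. The sign of -d^2/dt^2 is put into [L]. *)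
Let be g : R[i] := - (cprim2 a g b / (b - a)%:C).
Let L g : cfun R := H2sol a 0 (be (- g)) (- g).

Let HX : semihilbert X.
Proof. by apply: semihilbert_L2 => //; exact: measurable_Iseg. Qed.

Let Xab g : hmem X g -> hmem (L2c a b) g /\ hsq (L2c a b) g <= hsq X g.
Proof.
apply: L2_restrict => //; first exact: measurable_Iseg.
by apply: subset_itv; rewrite bnd_simp.
Qed.

Let sub_Iseg : Iseg A n `<=` `[a, b].
Proof. by apply: subset_itv; rewrite bnd_simp. Qed.

Let blin_L : blin X (Iseg A n) L.
Proof.
apply: (@blinS _ _ `[a, b]) => //.
apply: (@blin_opp _ _ (fun g => H2sol a 0 (be g) g)) => //.
have z : blin X setT (fun _ _ => 0).
  split; first by move=> *; rewrite subrr.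
  by exists 0 => // *; rewrite sqn0 mul0r.
have bb : blin X setT (fun g _ => be g).
  apply: (@blin_ext _ _ (fun g _ => - ((b - a)%:C)^-1 * cprim2 a g b)).
      by move=> g _; rewrite mulNr mulrC.
    apply: blinZ; apply: (@blin_at _ _ `[a, b] _ (cprim2 a)).
    exact: blin_cprim2 (ltW ab) Xab.
  by rewrite /= in_itv/= lexx ltW.
by have [] := blin_H2sol HX (ltW ab) Xab z bb.
Qed.

Let ba0 : (b - a)%:C != 0 :> R[i].
Proof. by rewrite eq_complex /= eqxx andbT subr_eq0 gt_eqF. Qed.

Let be_sol g : H2sol a 0 (be g) g b = 0.
Proof.
by rewrite H2solE add0r /be mulNr divfK// addNr.
Qed.

(** With [h_edge_solves] this identifies the graph of the operator with the relation [f = L g]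
    almost everywhere, the form that survives a closure. *)
Lemma h_edge_solved f g : hmem X f -> hmem X g -> aeq (Iseg A n) f (L g) -> h_edge A n f g.
Proof.
move=> hf hg fg; have [hg' _] := Xab (hmemN HX hg).
split=> //; exists (L g), (H2sol1 a (be (- g)) (- g)), (- g); split.
- apply: H2_H2sol => //; first exact: ltW.
  by apply: aeqS fg; apply: subset_itv; rewrite bnd_simp.
- exact: H2sol_left.
- exact: be_sol.
- by apply: nearW => x _ /=; rewrite opprK.
Qed.

Lemma h_edge_solves f g : h_edge A n f g -> aeq (Iseg A n) f (L g).
Proof.
move=> [hf hg [F [F1 [F2 [H2F Fa Fb gF]]]]].
have [hg' _] := Xab (hmemN HX hg).
have F2g : aeq `]a, b[ F2 (- g).
  apply: aeqS (_ : aeq (Iseg A n) _ _); first by apply: subset_itv; rewrite bnd_simp.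
  by apply: filterS gF => x gF Dx; rewrite fctE gF// opprK.
have sol x := H2_sol (x := x) H2F F2g hg'.1.
have F1a : F1 a = be (- g).
  have bb : a <= b <= b by rewrite lexx ltW.
  have [+ _] := sol b bb; rewrite Fb Fa.
  rewrite H2solE add0r => /esym/eqP; rewrite addr_eq0 => /eqP e.
  by rewrite /be -mulNr -e mulfK.
have [fF _ _ _] := H2F; apply: filterS fF => x fF Dx.
have xab := sub_Iseg Dx; rewrite fF//.
have xab' : a <= x <= b by move: xab; rewrite /= in_itv.
by have [-> _] := sol x xab'; rewrite Fa F1a.
Qed.

Lemma h_edge_closed f g : op_closure X (h_edge A n) f g -> h_edge A n f g.
Proof.
move=> /[dup] cl [hf hg _]; apply: h_edge_solved => //.
have i1 : mu.-integrable (Iseg A n) (EFin \o (cst 1 : R -> R)).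
  by apply: integrableS (integrable_cst_itv a b 1) => //; exact: measurable_Iseg.
apply: (closed_blin (T := h_edge A n) (L := L) (w := cst 1)) cl => //.
- exact: measurable_Iseg.
- move=> {}g {}hg; apply: blin_hmem => //; first exact: measurable_Iseg.
  apply: cmeasurableS sub_Iseg _ => //; apply: cmeasurable_H2sol; first exact: ltW.
  by have [] := Xab (hmemN HX hg).
- by move=> f' g' Tfg; have [h1 h2 _] := Tfg; split => //; exact: h_edge_solves.
Qed.

End Edge.
End ClosedOperators.

Section ClosedVertexOperator.
Context {R : realType}.
Implicit Types (D E P Q : set R) (w : R -> R) (f g h : cfun R) (x : R).

Local Notation L2c a b := (L2 `[a, b] (cst 1)).
#[local] Hint Resolve semihilbert_L2c : core.

Lemma integrable_weight_vertex (A : antitree R) m :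
  mu.-integrable (I_vertex A m.+1) (EFin \o weight A).
Proof.
pose M : R := (sn A m * sn A m.+1)%:R + (sn A m.+1 * sn A m.+2)%:R.
have i1 : mu.-integrable (I_vertex A m.+1) (EFin \o cst M).
  apply: integrableS (integrable_cst_itv (tn A m) (tn A m.+2) M) => //.
    exact: measurable_itv.
  by apply: subset_itv; rewrite bnd_simp.
apply: le_integrable i1 => //; first exact: measurable_itv.
  by apply/measurable_EFinP; exact: measurable_weight_vertex.
move=> x Dx; rewrite lee_fin [X in _ <= X]ger0_norm; last by rewrite addr_ge0.
rewrite ger0_norm; last by apply: le_trans (weight_ge1 (I_vertex_interval0L _ Dx)).
have [[] /weight_Iseg -> _] := (I_vertexE A x (ltn0Sn m)).1 Dx.
  by rewrite lerDl.
by rewrite lerDr.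
Qed.

Local Opaque cprim cprim2 H2sol H2sol1.

Section Vertex.
Variables (A : antitree R) (m : nat).
Let a := tn A m.
Let t := tn A m.+1.
Let b := tn A m.+2.
Let at_ : a < t := tn_lt A m.
Let tb : t < b := tn_lt A m.+1.
Let D := I_vertex A m.+1.
Let X := L2 D (weight A).
(** The vertex condition reads f'(t+) = r f'(t-). *)
Let r : R := (sn A m)%:R / (sn A m.+2)%:R.
Let d1 : R[i] := (t - a)%:C.
Let d2 : R[i] := (b - t)%:C.
(** The solution shot from [a] with value 0 and slope z has at [b] the value z c plus terms in the
    right-hand side. *)
Let c : R[i] := d1 + r%:C * d2.

Let mD : mset D. Proof. exact: measurable_itv. Qed.
Let mw : mfun D (weight A). Proof. exact: measurable_weight_vertex. Qed.
Let wp x : D x -> 0 < weight A x.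
Proof. by move=> Dx; apply: lt_le_trans (weight_ge1 (I_vertex_interval0L _ Dx)). Qed.
Let w0 x : D x -> 0 <= weight A x. Proof. by move=> /wp/ltW. Qed.

Let HX : semihilbert X. Proof. exact: semihilbert_L2. Qed.

Let c0 : c != 0.
Proof.
have -> : c = (t - a + r * (b - t))%:C by rewrite rmorphD rmorphM.
rewrite eq_complex /= eqxx andbT gt_eqF// ltr_pwDl ?subr_gt0//.
by rewrite mulr_ge0 ?subr_ge0 ?(ltW tb)// /r divr_ge0.
Qed.

(** The slope at [a] that brings the solution to 0 at [b]. Below, [al'] and [be'] are its value at
    [t] and its slope just after the jump there, the initial data on the second segment. *)
Let be h : R[i] := - ((cprim2 a h t + r%:C * d2 * cprim a h t + cprim2 t h b) / c).
Let al' h : R[i] := H2sol a 0 (be h) h t.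
Let be' h : R[i] := r%:C * H2sol1 a (be h) h t.
Let Lh h : cfun R := fun x =>
  if x < t then H2sol a 0 (be h) h x else H2sol t (al' h) (be' h) h x.
Let L g : cfun R := Lh (- g).

(** The equation is the vanishing of the value at [b]: [s1] and [s2] stand for the contributions of
    the right-hand side to value and slope at [t], and [s3] for its contribution on the second
    segment. *)
Let beP (z s1 s2 s3 : R[i]) : (z * d1 + s1 + r%:C * (z + s2) * d2 + s3 = 0) <->
  z = - ((s1 + r%:C * d2 * s2 + s3) / c).
Proof.
have -> : z * d1 + s1 + r%:C * (z + s2) * d2 + s3 =
    z * c + (s1 + r%:C * d2 * s2 + s3) by rewrite /c; ring.
split=> [/eqP|->]; last by rewrite mulNr divfK// addNr.
by rewrite addr_eq0 => /eqP e; rewrite -mulNr -e mulfK.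
Qed.

Let sub_at : `]a, t[ `<=` D.
Proof. by apply: subset_itv; rewrite bnd_simp// ltW. Qed.
Let sub_tb : `]t, b[ `<=` D.
Proof. by apply: subset_itv; rewrite bnd_simp// ltW. Qed.

Let Xat g : hmem X g -> hmem (L2c a t) g /\ hsq (L2c a t) g <= hsq X g.
Proof.
apply: L2_restrict => // x xat.
by apply/weight_ge1/(I_vertex_interval0L (ltn0Sn m))/sub_at; rewrite /= in_itv.
Qed.

Let Xtb g : hmem X g -> hmem (L2c t b) g /\ hsq (L2c t b) g <= hsq X g.
Proof.
apply: L2_restrict => // x xat.
by apply/weight_ge1/(I_vertex_interval0L (ltn0Sn m))/sub_tb; rewrite /= in_itv.
Qed.

Let blin_L : blin X D L.
Proof.
have z : blin X setT (fun _ _ => 0).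
  split; first by move=> *; rewrite subrr.
  by exists 0 => // *; rewrite sqn0 mul0r.
have inat : `[a, t]%classic t by rewrite /= in_itv/= lexx (ltW at_).
have intb : `[t, b]%classic b by rewrite /= in_itv/= lexx (ltW tb).
have bb : blin X setT (fun g _ => be g).
  apply: (@blin_ext _ _ _ (fun g _ => - c^-1 *
    (cprim2 a g t + r%:C * d2 * cprim a g t + cprim2 t g b))).
    by move=> g _; rewrite mulNr mulrC.
  apply: blinZ; apply: blinD; [apply: blinD|].
  - exact: blin_at (blin_cprim2 (ltW at_) Xat) inat.
  - apply: blinZ; exact: blin_at (blin_cprim (ltW at_) Xat) inat.
  - exact: blin_at (blin_cprim2 (ltW tb) Xtb) intb.
have [bl bl1] := blin_H2sol HX (ltW at_) Xat z bb.
have bal : blin X setT (fun g _ => al' g) by exact: blin_at bl inat.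
have bbe : blin X setT (fun g _ => be' g) by apply: blinZ; exact: blin_at bl1 inat.
have [br _] := blin_H2sol HX (ltW tb) Xtb bal bbe.
apply: (@blin_opp _ _ _ Lh) => //; apply: (@blin_if _ _ HX _ (fun x => x < t)).
- apply: blinS bl => x [+ /=]; rewrite /D /I_vertex /= !in_itv/=.
  by move=> /andP[h1 _] h2; rewrite !ltW.
- apply: blinS br => x [+ /=]; rewrite /D /I_vertex /= !in_itv/= -leNgt.
  by move=> /andP[_ h1] h2; rewrite h2 ltW.
Qed.

Let Lh_at h x : x < t -> Lh h x = H2sol a 0 (be h) h x.
Proof. by rewrite /Lh => ->. Qed.
Let Lh_tb h x : t <= x -> Lh h x = H2sol t (al' h) (be' h) h x.
Proof. by rewrite /Lh leNgt => /negbTE ->. Qed.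

Let Lh_b h : H2sol t (al' h) (be' h) h b = 0.
Proof.
by have /beP := erefl (be h); rewrite [H2sol t _ _ _ _]H2solE /al' H2solE /be' H2sol1E add0r.
Qed.

Lemma h_vertex_solved f g : hmem X f -> hmem X g -> aeq D f (L g) -> h_vertex A m.+1 f g.
Proof.
move=> hf hg fg.
have [hg1 _] := Xat (hmemN HX hg); have [hg2 _] := Xtb (hmemN HX hg).
split=> //; exists (H2sol a 0 (be (- g)) (- g)), (H2sol1 a (be (- g)) (- g)), (- g),
  (H2sol t (al' (- g)) (be' (- g)) (- g)), (H2sol1 t (be' (- g)) (- g)), (- g); split.
- split; [apply: H2_H2sol (ltW at_) hg1 _|apply: H2_H2sol (ltW tb) hg2 _].
    apply: filterS fg => x fg xat; rewrite fg; last exact: sub_at.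
    by apply: Lh_at; move: xat; rewrite /= in_itv/= => /andP[].
  apply: filterS fg => x fg xtb; rewrite fg; last exact: sub_tb.
  by apply: Lh_tb; move: xtb; rewrite /= in_itv/= => /andP[/ltW].
- by split; [exact: H2sol_left|exact: Lh_b].
- by rewrite H2sol_left.
- rewrite H2sol1_left /be' mulrA; congr (_ * _).
  rewrite /r fmorph_div /= !rmorph_nat mulrC divfK// pnatr_eq0 -lt0n; exact: sn_gt0.
- by split; apply: nearW => x _ /=; rewrite opprK.
Qed.

Lemma h_vertex_solves f g : h_vertex A m.+1 f g -> aeq D f (L g).
Proof.
move=> [hf hg [F [F1 [F2 [G [G1 [G2 [[HF HG] [Fa Gb] Ft F1t [gF gG]]]]]]]]].
have [hg1 _] := Xat (hmemN HX hg); have [hg2 _] := Xtb (hmemN HX hg).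
change (F a = 0) in Fa; change (G b = 0) in Gb; change (F t = G t) in Ft.
change ((sn A m)%:R * F1 t = (sn A m.+2)%:R * G1 t) in F1t.
have F2g : aeq `]a, t[ F2 (- g).
  apply: aeqS (_ : aeq (Iseg A m) _ _); first by apply: subset_itv; rewrite bnd_simp.
  by apply: filterS gF => x gF Dx; rewrite fctE gF// opprK.
have G2g : aeq `]t, b[ G2 (- g).
  apply: aeqS (_ : aeq (Iseg A m.+1) _ _); first by apply: subset_itv; rewrite bnd_simp.
  by apply: filterS gG => x gG Dx; rewrite fctE gG// opprK.
have solF x := H2_sol (x := x) HF F2g hg1.1.
have solG x := H2_sol (x := x) HG G2g hg2.1.
have tt : a <= t <= t by rewrite lexx ltW.
have bb : t <= b <= b by rewrite lexx ltW.
have [Ft' F1t'] := solF t tt; have [Gb' _] := solG b bb.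
have G1t : G1 t = r%:C * F1 t.
  have s0 : (sn A m.+2)%:R != 0 :> R[i] by rewrite pnatr_eq0 -lt0n sn_gt0.
  apply: (mulfI s0); rewrite -F1t mulrA; congr (_ * _).
  by rewrite /r fmorph_div /= !rmorph_nat mulrC divfK.
have F1a : F1 a = be (- g).
  apply/beP; move: Gb'; rewrite Gb H2solE -Ft G1t Ft' F1t' Fa H2solE H2sol1E add0r.
  by move=> /esym.
have alG : G t = al' (- g) by rewrite /al' -F1a -Ft Ft' Fa.
have beG : G1 t = be' (- g) by rewrite /be' -F1a G1t F1t'.
have [fF _ _ _] := HF; have [fG _ _ _] := HG.
apply: filterS2 fF fG => x fF fG; rewrite /D /I_vertex /= in_itv/= => /andP[ax xb].
rewrite /L; have [xt|tx] := ltP x t.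
  have xat : a <= x <= t by rewrite !ltW.
  have [e _] := solF x xat; rewrite Fa F1a in e.
  by rewrite (Lh_at _ xt) -e; apply: fF; rewrite /= in_itv.
have xtb : t <= x <= b by rewrite tx ltW.
have [e _] := solG x xtb; rewrite alG beG in e.
by rewrite (Lh_tb _ tx) -e; apply: fG; rewrite /= in_itv.
Qed.

Lemma h_vertex_closed f g : op_closure X (h_vertex A m.+1) f g -> h_vertex A m.+1 f g.
Proof.
move=> /[dup] cl [hf hg _]; apply: h_vertex_solved => //.
have i1 := integrable_weight_vertex A m.
apply: (closed_blin (T := h_vertex A m.+1) (L := L) (w := weight A)) cl => //.
- move=> {}g {}hg; apply: blin_hmem => //.
  have [hg1 _] := Xat (hmemN HX hg); have [hg2 _] := Xtb (hmemN HX hg).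
  have M1 : cmeasurable `]a, t[ (L g).
    apply: (@cmeasurable_eq _ _ (H2sol a 0 (be (- g)) (- g))).
      by move=> x /set_mem; rewrite /= in_itv/= => /andP[_ xt]; rewrite /L Lh_at.
    apply: cmeasurableS (measurable_itvR _) _ (cmeasurable_H2sol _ _ (ltW at_) hg1).
    by apply: subset_itv; rewrite bnd_simp.
  have M2 : cmeasurable `[t, b[ (L g).
    apply: (@cmeasurable_eq _ _ (H2sol t (al' (- g)) (be' (- g)) (- g))).
      by move=> x /set_mem; rewrite /= in_itv/= => /andP[tx _]; rewrite /L Lh_tb.
    apply: cmeasurableS (measurable_itvR _) _ (cmeasurable_H2sol _ _ (ltW tb) hg2).
    by apply: subset_itv; rewrite bnd_simp.
  have -> : D = `]a, t[ `|` `[t, b[.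
    by apply: itv_bndbnd_setU; rewrite bnd_simp// ltW.
  by split; apply/measurable_funU => //; split; [exact: M1.1|exact: M2.1|exact: M1.2|exact: M2.2].
- by move=> f' g' Tfg; have [h1 h2 _] := Tfg; split => //; exact: h_vertex_solves.
Qed.

End Vertex.
End ClosedVertexOperator.

(** * The unitary transform *)

Section SphereBasis.
Context {R : realType}.

(* The columns of 2 w w^T / |w|^2 - 1, where w is the sum of a coordinate vector and the unit
   constant vector, scaled by sqrt #|T|: this orthogonal involution exchanges the two vectors. *)
Lemma sphere_basis (T : finType) : (0 < #|T|)%N ->
  exists be : option 'I_(#|T| - 1) -> T -> R,
  [/\ forall v, be None v = 1,
      forall j k, \sum_v be j v * be k v = #|T|%:R * (j == k)%:R &
      forall v u, \sum_j be j v * be j u = #|T|%:R * (v == u)%:R].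
Proof.
move=> T0; set s : R := #|T|%:R.
have s0 : 0 < s by rewrite ltr0n.
have cardE : #|{: option 'I_(#|T| - 1)}| = #|T|.
  by rewrite card_option card_ord subn1 prednK.
pose th (j : option 'I_(#|T| - 1)) : T := enum_val (cast_ord cardE (enum_rank j)).
pose th' (v : T) : option 'I_(#|T| - 1) := enum_val (cast_ord (esym cardE) (enum_rank v)).
have thK : cancel th th' by move=> j; rewrite /th' /th enum_valK cast_ordK enum_rankK.
have th'K : cancel th' th by move=> j; rewrite /th' /th enum_valK cast_ordKV enum_rankK.
(* [v0] is the coordinate exchanged with the unit constant vector, all of whose entries are [u0]. *)
pose v0 := th None; pose d (v u : T) : R := (v == u)%:R.
pose u0 : R := (Num.sqrt s)^-1.
have u0s : u0 ^+ 2 * s = 1 by rewrite exprVn sqr_sqrtr ?mulVf ?gt_eqF// ltW.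
have u00 : 0 < u0 by rewrite invr_gt0 sqrtr_gt0.
have c0 : 1 + u0 != 0 by rewrite gt_eqF// addr_gt0.
(* As |w|^2 = 2 (1 + u0), [q] is the matrix 2 w w^T / |w|^2 - 1. *)
pose w v := d v v0 + u0; pose q v a := w v * w a / (1 + u0) - d v a.
have sumd (F : T -> R) a : \sum_v d v a * F v = F a.
  rewrite (bigD1 a)//= /d eqxx mul1r big1 ?addr0// => v /negbTE ->; exact: mul0r.
have dC v u : d v u = d u v by rewrite /d eq_sym.
have qC v u : q v u = q u v by rewrite /q [w v * w u]mulrC dC.
have sumw2 : \sum_v w v * w v = 2 * (1 + u0).
  rewrite (eq_bigr (fun v => d v v0 * (d v v0 + 2 * u0) + u0 ^+ 2)); last first.
    by move=> v _; rewrite /w; ring.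
  rewrite big_split /= sumd sumr_const -[u0 ^+ 2 *+ _]mulr_natr -/s u0s /d eqxx mulr1n; ring.
have qq a b : \sum_v q v a * q v b = d a b.
  rewrite (eq_bigr (fun v => w a * w b / (1 + u0) ^+ 2 * (w v * w v) +
      (d v a * (- (w v * w b / (1 + u0)) + d v b) + d v b * - (w v * w a / (1 + u0))))).
    rewrite big_split /= -mulr_sumr sumw2 big_split /= !sumd; by field.
  move=> v _; rewrite /q; by field.
have ss : Num.sqrt s * Num.sqrt s = s by rewrite -expr2 sqr_sqrtr// ltW.
exists (fun j v => Num.sqrt s * q v (th j)); split.
(* As w(v0) = 1 + u0, column [v0] of [q] is [w] minus the coordinate vector, hence constantly
   [u0]. *)
- move=> v; rewrite /q -/v0 /w {2}/d eqxx mulfK//.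
  by rewrite [_ + u0]addrC addrK /u0 mulfV// gt_eqF// sqrtr_gt0.
- move=> j k.
  rewrite (eq_bigr (fun v => s * (q v (th j) * q v (th k)))); last first.
    by move=> v _; rewrite mulrACA ss.
  by rewrite -mulr_sumr qq /d (can_eq thK).
- move=> v u.
  rewrite (reindex th') /=; last by exists th => x _.
  rewrite (eq_bigr (fun a => s * (q a v * q a u))); last first.
    by move=> a _; rewrite th'K (qC a v) (qC a u) mulrACA ss.
  by rewrite -mulr_sumr qq.
Qed.

End SphereBasis.

Section Modes.
Context {R : realType} (A : antitree R).
Implicit Types (n : nat) (x : R) (f : edge A -> cfun R) (h : sl_index A -> cfun R).

(* (j, k) stands for the product b_j (x) b_k; [None] is the index of the constant function. *)
Definition mode n : finType :=
  (option 'I_(sn A n - 1) * option 'I_(sn A n.+1 - 1))%type.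

Definition sbasis n : option 'I_(sn A n - 1) -> sphere A n -> R :=
  projT1 (cid (@sphere_basis R (sphere A n) (sphere_gt0 A n))).

Lemma basisP n : [/\ forall v, sbasis (n := n) None v = 1,
  forall j k, \sum_v sbasis (n := n) j v * sbasis k v = (sn A n)%:R * (j == k)%:R &
  forall v u, \sum_j sbasis (n := n) j v * sbasis j u = (sn A n)%:R * (v == u)%:R].
Proof. exact: projT2 (cid (@sphere_basis R (sphere A n) (sphere_gt0 A n))). Qed.

Definition ssize n : R := (sn A n * sn A n.+1)%:R.

Lemma ssize_gt0 n : 0 < ssize n.
Proof. by rewrite ltr0n muln_gt0 !sn_gt0. Qed.

(* Normalizations making the coefficient of b_j (x) b_k live in the prescribed space: the weight
   is mu = s_n s_(n+1) unless both factors are nonconstant, in which case it is 1. *)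
Definition mode_scale n (p : mode n) : R :=
  if p is (Some _, Some _) then (Num.sqrt (ssize n))^-1 else 1.

Definition mode_wt n (p : mode n) : R := if p is (Some _, Some _) then 1 else ssize n.

Lemma mode_scale_gt0 n (p : mode n) : 0 < mode_scale p.
Proof. by case: p => -[j|] [k|] //=; rewrite invr_gt0 sqrtr_gt0 ssize_gt0. Qed.

Lemma mode_wtE n (p : mode n) : mode_wt p = ssize n * mode_scale p ^+ 2.
Proof.
case: p => -[j|] [k|] //=; rewrite ?expr1n ?mulr1//.
by rewrite exprVn sqr_sqrtr ?ltW ?ssize_gt0// mulfV// gt_eqF// ssize_gt0.
Qed.

Lemma mode_wt_gt0 n (p : mode n) : 0 < mode_wt p.
Proof. by rewrite mode_wtE mulr_gt0 ?ssize_gt0 ?exprn_gt0 ?mode_scale_gt0. Qed.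

Definition espot n : finType := (sphere A n * sphere A n.+1)%type.

(* [scoef] are the synthesis and [acoef] the analysis coefficients. *)
Definition scoef n (p : mode n) (e : espot n) : R :=
  sbasis p.1 e.1 * sbasis p.2 e.2 * mode_scale p.

Definition acoef n (p : mode n) (e : espot n) : R :=
  sbasis p.1 e.1 * sbasis p.2 e.2 / (ssize n * mode_scale p).

Lemma acoef_scoef n (p q : mode n) : \sum_e acoef p e * scoef q e = (p == q)%:R.
Proof.
have [_ b1 _] := basisP n; have [_ c1 _] := basisP n.+1.
rewrite (eq_bigr (fun e => (sbasis p.1 e.1 * sbasis q.1 e.1) *
    (sbasis p.2 e.2 * sbasis q.2 e.2) * (mode_scale q / (ssize n * mode_scale p)))); last first.
  by move=> e _; rewrite /acoef /scoef; ring.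
rewrite -mulr_suml -(pair_bigA _ (fun v u => sbasis p.1 v * sbasis q.1 v *
    (sbasis p.2 u * sbasis q.2 u))) /=.
under eq_bigr do rewrite -mulr_sumr c1.
rewrite -mulr_suml b1 -pair_eqE /=.
have [e1|] := eqVneq p.1 q.1; last by rewrite /= mulr0 !mul0r.
have [e2|] := eqVneq p.2 q.2; last by rewrite /= !mulr0 mul0r.
have -> : p = q by move: e1 e2; case: p => ? ?; case: q => ? ? /= -> ->.
rewrite /= !mulr1 /ssize natrM; field.
by rewrite !gt_eqF ?mode_scale_gt0 ?ltr0n ?sn_gt0.
Qed.

Lemma scoef_acoef n (e e' : espot n) : \sum_p scoef p e * acoef p e' = (e == e')%:R.
Proof.
have [_ _ b1] := basisP n; have [_ _ c1] := basisP n.+1.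
have z := ssize_gt0 n.
rewrite (eq_bigr (fun p => (sbasis p.1 e.1 * sbasis p.1 e'.1) *
    (sbasis p.2 e.2 * sbasis p.2 e'.2) * (ssize n)^-1)); last first.
  by move=> p _; rewrite /acoef /scoef; field; rewrite !gt_eqF ?mode_scale_gt0 ?ltr0n ?sn_gt0.
rewrite -mulr_suml -(pair_bigA _ (fun j k => sbasis j e.1 * sbasis j e'.1 *
    (sbasis k e.2 * sbasis k e'.2))) /=.
under eq_bigr do rewrite -mulr_sumr c1.
rewrite -mulr_suml b1 -[in RHS]pair_eqE /=.
have [e1|] := eqVneq e.1 e'.1; last by rewrite /= mulr0 !mul0r.
have [e2|] := eqVneq e.2 e'.2; last by rewrite /= !mulr0 mul0r.
by rewrite /= !mulr1 -natrM -/(ssize n) mulfV// gt_eqF.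
Qed.

Lemma mode_wt_acoef n (p : mode n) e : mode_wt p * acoef p e = scoef p e.
Proof.
rewrite mode_wtE /acoef /scoef; field.
by rewrite !gt_eqF ?mode_scale_gt0 ?ltr0n ?sn_gt0.
Qed.

(** Multiplying by [mode_wt p] turns one of the two analysis coefficients into a synthesis
    coefficient, so the sum becomes the pairing of [z] with its resynthesis, which is [z]. It is
    applied to real and imaginary parts separately. *)
Lemma parseval n (z : espot n -> R) :
  \sum_p mode_wt p * (\sum_e acoef p e * z e) ^+ 2 = \sum_e z e ^+ 2.
Proof.
transitivity (\sum_p \sum_e z e * (scoef p e * \sum_e' acoef p e' * z e')).
  apply: eq_bigr => p _; rewrite expr2 mulrA.
  have -> : mode_wt p * \sum_e acoef p e * z e = \sum_e scoef p e * z e.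
    by rewrite mulr_sumr; apply: eq_bigr => e _; rewrite mulrA mode_wt_acoef.
  by rewrite mulr_suml; apply: eq_bigr => e _; ring.
rewrite exchange_big /=; apply: eq_bigr => e _; rewrite -mulr_sumr expr2; congr (_ * _).
under eq_bigr do rewrite mulr_sumr.
rewrite exchange_big /= (bigD1 e)//= [X in _ + X]big1 ?addr0.
  under eq_bigr do rewrite mulrA.
  by rewrite -mulr_suml scoef_acoef eqxx mul1r.
move=> e' /negbTE ne; under eq_bigr do rewrite mulrA.
by rewrite -mulr_suml scoef_acoef eq_sym ne mul0r.
Qed.

End Modes.

(** * Analysis and synthesis of functions on the antitree *)

Section Transform.
Context {R : realType} (A : antitree R).
Implicit Types (n m : nat) (x : R) (f : edge A -> cfun R) (h : sl_index A -> cfun R)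
  (i : sl_index A).

(* The Sturm-Liouville component to which a mode of level n contributes on I_n. Level 0 is special
   only because S_0 is a point, so that no mode (Some _, _) exists there. *)
Definition midx n : mode A n -> sl_index A :=
  match n return mode A n -> sl_index A with
  | 0 => fun p => if p.2 is Some k then SLanti k else @SLsym R A
  | m.+1 => fun p => match p with
    | (None, None) => @SLsym R A
    | (None, Some k) => SLanti k
    | (Some j, None) => SLanti j
    | (Some j, Some k) => SLzero (mxvec_index j k)
    end
  end.

Lemma mode0 (p : mode A 0) : p.1 = None.
Proof. by case: p => -[j|] k //=; move: (j); rewrite /sn sphere0 => -[]. Qed.

Lemma SLanti_inj n : injective (@SLanti R A n).
Proof. by move=> k k' [] /eqP; rewrite eq_Tagged => /eqP. Qed.

Lemma SLzero_inj n : injective (@SLzero R A n).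
Proof. by move=> k k' [] /eqP; rewrite eq_Tagged => /eqP. Qed.

(** Tells apart [SLanti] indices of different levels, whose arguments have different types. *)
Definition anti_level i : nat := if i is SLanti n _ then n else 0%N.

Lemma midx_inj n : injective (@midx n).
Proof.
case: n => [|n] p q.
  have := mode0 p; have := mode0 q; case: p => p1 [k|]; case: q => q1 [k'|] //= -> -> //.
  by move=> /SLanti_inj ->.
have ne (j : 'I_(sn A n.+2 - 1)) (k : 'I_(sn A n.+1 - 1)) : SLanti j <> SLanti k.
  by move=> /(congr1 anti_level) /= /eqP; rewrite eqn_leq ltnn.
case: p => -[j|] [k|]; case: q => -[j'|] [k'|] //=.
- move=> /SLzero_inj e.
  (* The inverse of [mxvec_index] recovers the pair of basis indices. *)
  have [g gK _] := curry_mxvec_bij (sn A n.+1 - 1) (sn A n.+2 - 1).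
  have := congr1 g e; rewrite (gK (j, k))// (gK (j', k'))// => -[-> ->] //.
- by move=> /SLanti_inj ->.
- by move=> /esym/ne.
- by move=> /ne.
- by move=> /SLanti_inj ->.
Qed.

Definition sl_dom i : set R :=
  match i with
  | SLsym => interval0L A
  | SLzero n _ => Iseg A n.+1
  | SLanti n _ => I_vertex A n.+1
  end.

Definition sl_wt i : R -> R :=
  match i with
  | SLzero n _ => cst 1
  | _ => weight A
  end.

Lemma sl_spaceE i : sl_space i = L2 (sl_dom i) (sl_wt i).
Proof. by case: i. Qed.

Lemma measurable_sl_dom i : mset (sl_dom i).
Proof.
case: i => [|n _|n _] /=; [exact: measurable_interval0L|exact: measurable_Iseg|].
exact: measurable_itv.
Qed.

Lemma measurable_sl_wt i : mfun (sl_dom i) (sl_wt i).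
Proof.
by case: i => [|n _|n _] /=; [exact: measurable_weight| |exact: measurable_weight_vertex].
Qed.

Lemma sl_wt_ge1 i x : sl_dom i x -> 1 <= sl_wt i x.
Proof.
case: i => [|n _|n _] //=; first exact: weight_ge1.
by move=> /(I_vertex_interval0L (ltn0Sn n)); exact: weight_ge1.
Qed.

Lemma sl_wt_gt0 i x : sl_dom i x -> 0 < sl_wt i x.
Proof. by move=> /sl_wt_ge1; exact: lt_le_trans. Qed.

Lemma sl_wt_ge0 i x : sl_dom i x -> 0 <= sl_wt i x.
Proof. by move=> /sl_wt_gt0/ltW. Qed.

Lemma semihilbert_sl i : semihilbert (sl_space i).
Proof.
rewrite sl_spaceE; apply: semihilbert_L2;
  [exact: measurable_sl_dom|exact: measurable_sl_wt|exact: sl_wt_ge0].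
Qed.

Lemma sl_domP i x : sl_dom i x -> exists n (p : mode A n), midx p = i /\ Iseg A n x.
Proof.
case: i => [|n k|n k] /=.
- move=> /interval0LP[n hn]; exists n, (None, None); split=> //.
  by case: n hn.
- by move=> hx; case: (mxvec_indexP k) => j l; exists n.+1, (Some j, Some l).
- move=> /(I_vertexE A x (ltn0Sn n))[[hx|hx] _]; last by exists n.+1, (Some k, None).
  by exists n, (None, Some k); split => //; case: n k hx.
Qed.

(** The component of a mode [(None, Some k)] lives on an open interval starting at [tn A n], whence
    the exclusion of this point. *)
Lemma midx_dom n (p : mode A n) x : Iseg A n x -> x != tn A n -> sl_dom (midx p) x.
Proof.
case: n p => [|n] p hx xt.
  case: p => p1 [k|] /=; last by apply/interval0LP; exists 0%N.
  by apply/(I_vertexE A x (ltn0Sn 0)); split => //; left.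
case: p => -[j|] [k|] //=.
- apply/(I_vertexE A x (ltn0Sn n)); split; first by right.
  move: hx; rewrite IsegE => /andP[h _] /=.
  by rewrite gt_eqF// (lt_le_trans (tn_lt A n)).
- by apply/(I_vertexE A x (ltn0Sn n.+1)); split => //; left.
- by apply/interval0LP; exists n.+1.
Qed.

Lemma midx_wt n (p : mode A n) x : Iseg A n x -> sl_wt (midx p) x = mode_wt p.
Proof.
case: n p => [|n] p hx.
  by have := mode0 p; case: p => p1 [k|] /= -> /=; rewrite (weight_Iseg hx).
by case: p => -[j|] [k|] //=; rewrite (weight_Iseg hx).
Qed.

Definition ed n (e : espot A n) : edge A :=
  Tagged (fun n => (sphere A n * sphere A n.+1)%type) e.

Definition uhat f n (p : mode A n) : cfun R :=
  fun x => \sum_(e : espot A n) (acoef p e)%:C * f (ed e) x.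

(* The sum has at most one term. Values outside the interval of the component i are zero, except
   possibly at the left endpoint of I_vertex, which is excluded from that open interval. *)
Definition Ut f : sl_index A -> cfun R := fun i x =>
  \sum_(m \in [set m : {n & mode A n} | midx (tagged m) = i /\ Iseg A (tag m) x])
    uhat f (tagged m) x.

Definition Vt h : edge A -> cfun R := fun e x =>
  \sum_(p : mode A (lvl e)) (scoef p (tagged e : espot A (lvl e)))%:C * h (midx p) x.

Lemma Ut_Iseg f n (p : mode A n) x : Iseg A n x -> Ut f (midx p) x = uhat f p x.
Proof.
move=> hx; rewrite /Ut.
rewrite (_ : [set _ | _] = [set (Tagged (mode A) p : {n & mode A n})]) ?fsbig_set1//.
apply/seteqP; split => [[m q]/= [e hm]|_ ->] //=.
have emn := Iseg_inj hm hx; move: q e hm; rewrite emn => q e _.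
by rewrite (midx_inj e).
Qed.

Lemma Ut_out f i x : (forall n (p : mode A n), Iseg A n x -> midx p <> i) -> Ut f i x = 0.
Proof. by move=> no; apply: fsbig1 => -[n p] /= [e hx]; case: (no n p hx e). Qed.

Lemma VtE h n (e : espot A n) x :
  Vt h (ed e) x = \sum_(p : mode A n) (scoef p e)%:C * h (midx p) x.
Proof. by []. Qed.

Lemma Ut_Vt_Iseg h n (p : mode A n) x : Iseg A n x -> Ut (Vt h) (midx p) x = h (midx p) x.
Proof.
move=> hx; rewrite Ut_Iseg// /uhat.
under eq_bigr do rewrite VtE mulr_sumr.
rewrite exchange_big /= (bigD1 p)//= [X in _ + X]big1 ?addr0.
  under eq_bigr do rewrite mulrA -rmorphM.
  by rewrite -mulr_suml -rmorph_sum /= acoef_scoef eqxx mul1r.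
move=> q /negbTE ne; under eq_bigr do rewrite mulrA -rmorphM.
by rewrite -mulr_suml -rmorph_sum /= acoef_scoef eq_sym ne mul0r.
Qed.

Lemma Ut_Vt_dom h i x : sl_dom i x -> Ut (Vt h) i x = h i x.
Proof. by move=> /sl_domP[n [p [<- hx]]]; exact: Ut_Vt_Iseg. Qed.

(** An equality of functions and not only of vectors: a cut-off of the coordinates of [Ut f] is
    literally the transform of its synthesis, so projections can be computed on the coefficient
    side. *)
Lemma Ut_Vt h : (forall i x, (forall n (p : mode A n), Iseg A n x -> midx p <> i) -> h i x = 0) ->
  Ut (Vt h) = h.
Proof.
move=> h0; apply/funext => i; apply/funext => x.
have [[n [p [e hx]]]|no] := pselect (exists n (p : mode A n), midx p = i /\ Iseg A n x).
  by rewrite -e Ut_Vt_Iseg.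
have no' n (p : mode A n) : Iseg A n x -> midx p <> i.
  by move=> hx e; apply: no; exists n, p.
by rewrite Ut_out// h0.
Qed.

Lemma UtL (a : R[i]) f g : Ut (a *: f + g) = a *: Ut f + Ut g.
Proof.
apply/funext => i; apply/funext => x; rewrite !fctE.
have [[n [p [e hx]]]|no] := pselect (exists n (p : mode A n), midx p = i /\ Iseg A n x).
  rewrite -e !Ut_Iseg// /uhat.
  transitivity (\sum_(e0 : espot A n) (a * ((acoef p e0)%:C * f (ed e0) x) +
     (acoef p e0)%:C * g (ed e0) x)).
    by apply: eq_bigr => e0 _; rewrite mulrDr; congr (_ + _); rewrite mulrCA.
  by rewrite big_split /= -mulr_sumr.
have no' n (p : mode A n) : Iseg A n x -> midx p <> i.
  by move=> hx e; apply: no; exists n, p.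
by rewrite !Ut_out// scaler0 addr0.
Qed.

Lemma UtD f g : Ut (f + g) = Ut f + Ut g.
Proof. by rewrite -[f]scale1r UtL !scale1r. Qed.

Lemma Ut0 : Ut 0 = 0.
Proof. by have := UtL (-1) 0 0; rewrite scaler0 addr0 scaleN1r addNr. Qed.

Lemma UtZ (a : R[i]) f : Ut (a *: f) = a *: Ut f.
Proof. by have := UtL a f 0; rewrite Ut0 !addr0. Qed.

Lemma UtB f g : Ut (f - g) = Ut f - Ut g.
Proof. by rewrite -scaleN1r UtD UtZ scaleN1r. Qed.

End Transform.

Lemma setT_enum (T : finType) : [set: T] = [set` enum T].
Proof. by apply/seteqP; split => x //= _; rewrite mem_enum. Qed.

Lemma finite_finType (T : finType) : finite_set [set: T].
Proof. by rewrite setT_enum; exact: finite_seq. Qed.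

Lemma fsbig_finType (S : Type) (idx : S) (op : Monoid.com_law idx) (T : finType)
    (F : T -> S) :
  \big[op/idx]_(p \in [set: T]) F p = \big[op/idx]_(p : T) F p.
Proof.
rewrite -[RHS]big_enum [RHS]fsbig_seq ?enum_uniq//; apply: eq_fsbigl.
exact: setT_enum.
Qed.

(** * Rearranging sums by levels *)

Section LevelSums.
Context {R : realType}.
Local Open Scope ereal_scope.

Lemma exchange_esum (I J : choiceType) (a : I -> J -> \bar R) :
  (forall i j, 0 <= a i j) ->
  \esum_(i in [set: I]) \esum_(j in [set: J]) a i j =
  \esum_(j in [set: J]) \esum_(i in [set: I]) a i j.
Proof.
move=> a0; rewrite !esum_esum//.
rewrite (reindex_esum [set: J * I] _ (fun p => (p.2, p.1)))//=.
  by congr esum; apply/seteqP; split.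
split => [[x y] _//|[x y] [x' y'] _ _ /= [-> ->]//|[x y] _].
by exists (y, x).
Qed.

Lemma esum_image_finType (I : choiceType) (T : finType) (ph : T -> I) (a : I -> \bar R) :
  injective ph -> (forall i, 0 <= a i) -> (forall i, (forall p, ph p <> i) -> a i = 0) ->
  \esum_(i in [set: I]) a i = \sum_(p : T) a (ph p).
Proof.
move=> inj a0 out.
rewrite (esumID (range ph))// setTI [X in _ + X]esum1 ?adde0; last first.
  by move=> i [_ /= no]; apply: out => p e; apply: no; exists p.
rewrite (reindex_esum [set: T] _ ph); last first.
  by split=> [p _|p q _ _ /inj//|i [p _ <-]]; exists p.
by rewrite esum_fset//; [exact: fsbig_finType|exact: finite_finType].
Qed.

(** The energy identity uses this twice, with modes and with edges: an index may meet many levels,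
    but each level carries only finitely many indices. *)
Lemma esum_levels (I : choiceType) (T : nat -> finType) (ph : forall n, T n -> I)
    (a : nat -> I -> \bar R) :
  (forall n, injective (ph n)) -> (forall n i, 0 <= a n i) ->
  (forall n i, (forall p, ph n p <> i) -> a n i = 0) ->
  \esum_(i in [set: I]) \esum_(n in [set: nat]) a n i =
  \esum_(n in [set: nat]) \sum_(p : T n) a n (ph n p).
Proof.
move=> inj a0 out; rewrite exchange_esum//; apply: eq_esum => n _.
by apply: esum_image_finType => //; exact: out.
Qed.

Lemma esum_nat1 (n : nat) (a : nat -> \bar R) : (forall m, 0 <= a m) ->
  (forall m, m <> n -> a m = 0) -> \esum_(m in [set: nat]) a m = a n.
Proof.
move=> a0 out; rewrite (esumID [set n])// setTI [X in _ + X]esum1 ?adde0 ?esum_set1//.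
by move=> m [_ /= no]; exact: out.
Qed.

End LevelSums.

Section NormIdentity.
Context {R : realType} (A : antitree R).
Implicit Types (n m : nat) (x : R) (f : edge A -> cfun R) (h : sl_index A -> cfun R)
  (i : sl_index A).

Lemma cmeasurable_lincomb (T : finType) D (c : T -> R[i]) (F : T -> cfun R) :
  (forall e, cmeasurable D (F e)) -> cmeasurable D (fun x => \sum_e c e * F e x).
Proof.
move=> mF.
have -> : (fun x => \sum_e c e * F e x) = \sum_e c e *: F e :> cfun R.
  by apply/funext => x; rewrite fct_sumE.
apply: (big_ind (cmeasurable D)); first exact: cmeasurable0.
  by move=> u v mu mv; rewrite -[u]scale1r; exact: cmeasurableL.
by move=> e _; rewrite -[_ *: _]addr0; apply: cmeasurableL => //; exact: cmeasurable0.
Qed.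

Lemma cmeasurable_uhat f n (p : mode A n) :
  (forall e, cmeasurable (Iseg A (lvl e)) (f e)) -> cmeasurable (Iseg A n) (uhat f p).
Proof. by move=> mf; apply: cmeasurable_lincomb => e; exact: (mf (ed e)). Qed.

Definition piece n i : set R := Iseg A n `&` sl_dom i.

Lemma measurable_piece n i : mset (piece n i).
Proof. by apply: measurableI; [exact: measurable_Iseg|exact: measurable_sl_dom]. Qed.

Lemma piece_out n i : (forall p : mode A n, midx p <> i) -> piece n i = set0.
Proof.
move=> no; apply/seteqP; split => // x [hx /sl_domP[m [p [e hm]]]].
by move: p e; rewrite (Iseg_inj hm hx) => p /no.
Qed.

Lemma sl_dom_bigcup i : sl_dom i = \bigcup_n piece n i.
Proof.
apply/seteqP; split => [x /[dup] dx /sl_domP[n [p [_ hx]]]|x [n _ []]//].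
by exists n.
Qed.

Lemma trivIset_piece i : trivIset setT (fun n => piece n i).
Proof.
by apply/trivIsetP => n m _ _ /eqP nm; apply/seteqP; split => // x [[/Iseg_inj h _] [/h]].
Qed.

Lemma piece_midx n (p : mode A n) : piece n (midx p) = Iseg A n \/
  piece n (midx p) = `]tn A n, tn A n.+1[%classic.
Proof.
have sub x : piece n (midx p) x -> Iseg A n x by case.
have op x : `]tn A n, tn A n.+1[%classic x -> piece n (midx p) x.
  rewrite /= in_itv/= => /andP[h1 h2].
  have hx : Iseg A n x by rewrite IsegE (ltW h1).
  by split => //; apply: midx_dom => //; rewrite gt_eqF.
have [ht|ht] := pselect (piece n (midx p) (tn A n)); [left|right]; apply/seteqP; split=> // x.
  move=> hx; move: (hx); rewrite IsegE le_eqVlt => /andP[/predU1P[<-//|h1] h2].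
  by apply: op; rewrite /= in_itv/= h1.
move=> /[dup] /sub; rewrite IsegE le_eqVlt /= in_itv/= => /andP[/predU1P[<-//|-> ->//]].
Qed.

Lemma integral_piece n (p : mode A n) (u : R -> \bar R) : mfun (Iseg A n) u ->
  (\int[mu]_(x in piece n (midx p)) u x = \int[mu]_(x in Iseg A n) u x)%E.
Proof.
move=> mu'; have [->//|->] := piece_midx p.
rewrite integral_itv_obnd_cbnd//; apply: measurable_funS mu'; first exact: measurable_Iseg.
by apply: subset_itv; rewrite bnd_simp.
Qed.

Lemma cmeasurable_Ut f i : (forall e, cmeasurable (Iseg A (lvl e)) (f e)) ->
  cmeasurable (sl_dom i) (Ut f i).
Proof.
move=> mf; have mp n : cmeasurable (piece n i) (Ut f i).
  have [[p <-]|no] := pselect (exists p : mode A n, midx p = i).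
    apply: (@cmeasurable_eq _ _ (uhat f p)); first by move=> x /set_mem [hx _]; rewrite Ut_Iseg.
    apply: cmeasurableS (cmeasurable_uhat _ mf); first exact: measurable_Iseg.
    by move=> x [].
  rewrite piece_out; last by move=> p e; apply: no; exists p.
  by split; exact: measurable_fun_set0.
rewrite sl_dom_bigcup; split; apply/measurable_fun_bigcup => n; try exact: measurable_piece.
  by have [] := mp n.
by have [] := mp n.
Qed.

(** Each domain is cut into levels, the nonnegative sums are exchanged, and Parseval is applied
    under the integral at every point. Both sides may be infinite, so that the identity also yields
    membership, for [Ut f] as well as for [Vt h]. *)
Lemma Ut_energy f : (forall e, cmeasurable (Iseg A (lvl e)) (f e)) ->
  (\esum_(i in [set: sl_index A]) \int[mu]_(x in sl_dom i) (sqn (Ut f i x) * sl_wt i x)%:E =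
   \esum_(e in [set: edge A]) \int[mu]_(x in Iseg A (lvl e)) (sqn (f e x) * 1)%:E)%E.
Proof.
move=> mf.
pose a n i := (\int[mu]_(x in piece n i) (sqn (Ut f i x) * sl_wt i x)%:E)%E.
have a0 n i : (0 <= a n i)%E.
  by apply: integral_ge0 => x [_ Dx]; rewrite lee_fin mulr_ge0 ?sqn_ge0 ?sl_wt_ge0.
have aout n i : (forall p : mode A n, midx p <> i) -> a n i = 0%E.
  by move=> no; rewrite /a piece_out// integral_set0.
transitivity (\esum_(i in [set: sl_index A]) \esum_(n in [set: nat]) a n i)%E.
  apply: eq_esum => i _; rewrite {1}sl_dom_bigcup ge0_integral_bigcup.
  - by rewrite nneseries_esumT// => n; exact: a0.
  - by move=> n; exact: measurable_piece.
  - rewrite -sl_dom_bigcup; apply: measurable_sqnw; first exact: measurable_sl_wt.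
    exact: cmeasurable_Ut.
  - by move=> x [n _ [_ Dx]]; rewrite lee_fin mulr_ge0 ?sqn_ge0 ?sl_wt_ge0.
  - exact: trivIset_piece.
rewrite (esum_levels (ph := @midx R A))//; last exact: midx_inj.
(* The integral of an edge is placed on its own level and 0 on all others, to match the bookkeeping
   of the modes. *)
pose b n e := if lvl e == n then (\int[mu]_(x in Iseg A n) (sqn (f e x) * 1)%:E)%E else 0%E.
have b0 n e : (0 <= b n e)%E.
  rewrite /b; case: ifP => // _; apply: integral_ge0 => x _.
  by rewrite lee_fin mulr_ge0 ?sqn_ge0.
transitivity (\esum_(e in [set: edge A]) \esum_(n in [set: nat]) b n e)%E; last first.
  apply: eq_esum => e _; rewrite (@esum_nat1 _ (lvl e))//; first by rewrite /b eqxx.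
  by move=> n /eqP; rewrite eq_sym /b => /negbTE ->.
rewrite (esum_levels (ph := @ed R A))//; last 2 first.
- by move=> n e e' /eqP; rewrite eq_Tagged => /eqP.
- move=> n [m e] no; rewrite /b; case: eqP => //= emn; subst n.
  by case: (no e).
apply: eq_esum => n _.
have ms e : mfun (Iseg A n) (fun x => (sqn (f (ed (n := n) e) x) * 1)%:E).
  apply: measurable_sqnw; first exact: measurable_cst.
  exact: (mf (ed e)).
have mu' (p : mode A n) : mfun (Iseg A n) (fun x => (sqn (uhat f p x) * mode_wt p)%:E).
  apply: (@measurable_sqnw _ _ (cst (mode_wt p))); first exact: measurable_cst.
  exact: cmeasurable_uhat.
rewrite (eq_bigr (fun p =>
  \int[mu]_(x in Iseg A n) (sqn (uhat f p x) * mode_wt p)%:E)%E); last first.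
  move=> p _; rewrite /a -(integral_piece p)//.
  by apply: eq_integral => x /set_mem[hx _]; rewrite Ut_Iseg// midx_wt.
rewrite -ge0_integral_sum//; last 2 first.
- exact: measurable_Iseg.
- by move=> p x _; rewrite lee_fin mulr_ge0 ?sqn_ge0// ltW// mode_wt_gt0.
rewrite [RHS](eq_bigr (fun e => \int[mu]_(x in Iseg A n) (sqn (f (ed e) x) * 1)%:E)%E);
  last by move=> e _; rewrite /b eqxx.
rewrite -ge0_integral_sum//; last 2 first.
- exact: measurable_Iseg.
- by move=> e x _; rewrite lee_fin mulr_ge0 ?sqn_ge0.
apply: eq_integral => x _; rewrite !sumEFin; congr EFin.
transitivity (\sum_(e : espot A n) (cre (f (ed e) x) ^+ 2 + cim (f (ed e) x) ^+ 2)); last first.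
  by apply: eq_bigr => e _; rewrite mulr1.
rewrite big_split /= -!parseval -big_split /=; apply: eq_bigr => p _.
rewrite /uhat /sqn mulrDl !(mulrC _ (mode_wt p)) cre_sum cim_sum.
congr (_ * _ ^+ 2 + _ * _ ^+ 2); apply: eq_bigr => e _.
  by rewrite creM creR cimR mul0r subr0.
by rewrite cimM creR cimR mul0r addr0.
Qed.

End NormIdentity.

(** * Unitarity of the transform *)

Section UnitaryTransform.
Context {R : realType}.

Lemma hsum_L2P (I : choiceType) (D : I -> set R) (w : I -> R -> R) (f : I -> cfun R) :
  (forall i, mset (D i)) -> (forall i, mfun (D i) (w i)) ->
  (forall i x, D i x -> 0 <= w i x) ->
  hmem (hsum (fun i => L2 (D i) (w i))) f <->
  (forall i, cmeasurable (D i) (f i)) /\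
  (\esum_(i in [set: I]) \int[mu]_(x in D i) (sqn (f i x) * w i x)%:E < +oo)%E.
Proof.
move=> mD mw w0.
have E : (forall i, hmem (L2 (D i) (w i)) (f i)) ->
    (\esum_(i in [set: I]) \int[mu]_(x in D i) (sqn (f i x) * w i x)%:E =
     \esum_(i in [set: I]) (hsq (L2 (D i) (w i)) (f i))%:E)%E.
  by move=> hf; apply: eq_esum => i _; rewrite (hsq_L2_EFin (mD i) (mw i))//; exact: w0.
split=> [[hf ef]|[mf ef]].
  by split; [move=> i; exact: (hf i).1|rewrite E].
have hf i : hmem (L2 (D i) (w i)) (f i).
  split=> //; apply: le_lt_trans ef; apply: esum_ge; exists [set i].
    by split => //; exact: finite_set1.
  by rewrite fsbig_set1.
by split => //; rewrite -E.
Qed.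

(** Serves as truncation to finitely many coordinates, both for the convergence of the orthogonal
    decomposition and for approximation in the domain of the sum operator. *)
Lemma esum_tail (I : choiceType) (a : I -> R) (eps : R) : (forall i, 0 <= a i) ->
  (\esum_(i in [set: I]) (a i)%:E < +oo)%E -> 0 < eps ->
  exists r : seq I,
    (\esum_(i in [set: I]) (if i \in r then 0 else a i)%:E < eps%:E)%E.
Proof.
move=> a0 fa e0; have fin := esum_fin_num a0 fa.
have [_ [B [fB _] <-] hB] := ub_ereal_sup_adherent e0 fin.
have B0 : (0 <= \esum_(i in B) (a i)%:E)%E by apply: esum_ge0 => i _; rewrite lee_fin.
exists (finmap.enum_fset (fset_set B)).
have memB i : (i \in finmap.enum_fset (fset_set B)) = (i \in B) by exact: in_fset_set.
rewrite (eq_esum (b := fun i => if i \in ~` B then (a i)%:E else 0%E)); last first.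
  by move=> i _; rewrite memB in_setC; case: ifP.
rewrite -esum_mkcond.
have {}hB : (\esum_(i in [set: I]) (a i)%:E - eps%:E < \esum_(i in B) (a i)%:E)%E.
  by rewrite [ltRHS]esum_fset// => i _; rewrite lee_fin.
move: hB fin; rewrite (esumID B)//; last by move=> i _; rewrite lee_fin.
rewrite !setTI; case: (esum B _) => [r1| |]; case: (esum (~` B) _) => [r2| |]//.
by rewrite -EFinD -EFinB !lte_fin => h _; lra.
Qed.

Variable A : antitree R.
Implicit Types (f g : edge A -> cfun R) (h : sl_index A -> cfun R) (i : sl_index A).

Local Notation X := (L2A A).
Local Notation Y := (sl_sum_space A).

Lemma semihilbert_L2A : semihilbert X.
Proof.
apply: semihilbert_hsum => e; apply: semihilbert_L2 => //; first exact: measurable_Iseg.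
Qed.

Lemma semihilbert_sl_sum : semihilbert Y.
Proof. by apply: semihilbert_hsum => i; exact: semihilbert_sl. Qed.

Lemma hmem_L2AP f : hmem X f <-> (forall e, cmeasurable (Iseg A (lvl e)) (f e)) /\
  (\esum_(e in [set: edge A]) \int[mu]_(x in Iseg A (lvl e)) (sqn (f e x) * 1)%:E < +oo)%E.
Proof.
by apply: (hsum_L2P (w := fun _ => cst 1)) => // e; exact: measurable_Iseg.
Qed.

Lemma sl_sum_spaceE : Y = hsum (fun i => L2 (sl_dom i) (sl_wt i)).
Proof. by rewrite /sl_sum_space; congr hsum; apply/funext => i; exact: sl_spaceE. Qed.

Lemma hmem_sl_sumP h : hmem Y h <-> (forall i, cmeasurable (sl_dom i) (h i)) /\
  (\esum_(i in [set: sl_index A]) \int[mu]_(x in sl_dom i) (sqn (h i x) * sl_wt i x)%:E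
    < +oo)%E.
Proof.
rewrite sl_sum_spaceE; apply: hsum_L2P;
  [exact: measurable_sl_dom|exact: measurable_sl_wt|exact: sl_wt_ge0].
Qed.

Lemma hsq_L2A_EFin f : hmem X f -> (hsq X f)%:E =
  (\esum_(e in [set: edge A]) \int[mu]_(x in Iseg A (lvl e)) (sqn (f e x) * 1)%:E)%E.
Proof.
move=> hf; rewrite hsq_hsum_EFin//; last first.
  by move=> e; apply: semihilbert_L2 => //; exact: measurable_Iseg.
apply: eq_esum => e _; rewrite hsq_L2_EFin//; first exact: measurable_Iseg.
exact: hf.1.
Qed.

Lemma hsq_sl_sum_EFin h : hmem Y h -> (hsq Y h)%:E =
  (\esum_(i in [set: sl_index A]) \int[mu]_(x in sl_dom i) (sqn (h i x) * sl_wt i x)%:E)%E.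
Proof.
move=> hh; rewrite hsq_hsum_EFin//; last by move=> i; exact: semihilbert_sl.
apply: eq_esum => i _; rewrite sl_spaceE hsq_L2_EFin//;
  [exact: measurable_sl_dom|exact: measurable_sl_wt|exact: sl_wt_ge0|].
by rewrite -sl_spaceE; exact: hh.1.
Qed.

Lemma hmem_Ut f : hmem X f -> hmem Y (Ut f).
Proof.
move=> /hmem_L2AP[mf ef]; apply/hmem_sl_sumP; split; first by move=> i; exact: cmeasurable_Ut.
by rewrite Ut_energy.
Qed.

Lemma hsq_Ut f : hmem X f -> hsq Y (Ut f) = hsq X f.
Proof.
move=> hf; apply: EFin_inj; rewrite hsq_sl_sum_EFin; last exact: hmem_Ut.
by rewrite hsq_L2A_EFin// Ut_energy//; have [] := (hmem_L2AP f).1 hf.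
Qed.

Lemma cmeasurable_Vt h : (forall i, cmeasurable (sl_dom i) (h i)) ->
  forall e, cmeasurable (Iseg A (lvl e)) (Vt h e).
Proof.
move=> mh [n e]; apply: cmeasurable_lincomb => p.
(* The domain of a component may omit the left end point of the segment, so measurability is
   obtained on the open segment and then extended. *)
apply: (@cmeasurableS _ _ `[tn A n, tn A n.+1]).
- exact: measurable_itvR.
- by apply: subset_itv; rewrite bnd_simp.
- apply: cmeasurable_itv; apply: cmeasurableS (mh (midx p)); first exact: measurable_sl_dom.
  move=> x; rewrite /= in_itv/= => /andP[h1 h2].
  by apply: midx_dom; rewrite ?gt_eqF// IsegE (ltW h1).
Qed.

Lemma hmem_Vt h : hmem Y h -> hmem X (Vt h).
Proof.
move=> /hmem_sl_sumP[mh eh]; have mv := cmeasurable_Vt mh.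
apply/hmem_L2AP; split => //; rewrite -Ut_energy//.
apply: le_lt_trans eh; rewrite le_eqVlt; apply/orP; left; apply/eqP.
apply: eq_esum => i _; apply: eq_integral => x /set_mem Dx.
by rewrite Ut_Vt_dom.
Qed.

Lemma hsq_null h : (forall i x, sl_dom i x -> h i x = 0) -> hsq Y h = 0.
Proof.
move=> h0; rewrite hsq_hsumE; last by move=> i; exact: semihilbert_sl.
rewrite esum1// => i _; rewrite sl_spaceE hsq_L2E.
rewrite (_ : (\int[mu]_(x in _) _)%R = 0)//.
by rewrite /Rintegral integral0_eq// => x Dx; rewrite h0// sqn0 mul0r.
Qed.

Lemma unitary_Ut : unitary X Y (@Ut R A).
Proof.
have HX := semihilbert_L2A; have HY := semihilbert_sl_sum.
(* Preservation of the square norm is polarized; the imaginary part is the real part with [g]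
   multiplied by i. *)
have re f g : hmem X f -> hmem X g -> cre (hdot Y (Ut f) (Ut g)) = cre (hdot X f g).
  move=> hf hg; rewrite (hdot_re HX)// (hdot_re HY); [|exact: hmem_Ut..].
  have zD := hmemZ HX (2^-1)%:C (hmemD HX hf hg).
  have zB := hmemZ HX (2^-1)%:C (hmemB HX hf hg).
  have := hsq_Ut zD; have := hsq_Ut zB.
  by rewrite !UtZ UtB UtD => -> ->.
split.
- exact: hmem_Ut.
- by move=> a f g hf hg; apply/(hnorm_eq0 HY); rewrite UtL subrr hsq0.
- move=> f g hf hg; apply: complexP; first exact: re.
  rewrite (hdot_im HX)// (hdot_im HY); [|exact: hmem_Ut..].
  by have := re _ _ hf (hmemZ HX 'i%C hg); rewrite UtZ.
- move=> h hh; exists (Vt h); first exact: hmem_Vt.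
  apply/(hnorm_eq0 HY); apply: hsq_null => i x Dx.
  by rewrite !fctE Ut_Vt_dom// subrr.
Qed.

Lemma sl_null i (u : cfun R) : hmem (sl_space i) u ->
  hnorm (sl_space i) u = 0 <-> aeq (sl_dom i) u 0.
Proof.
move=> hu; rewrite (hnorm_eq0 (semihilbert_sl i)); move: hu; rewrite sl_spaceE => hu.
apply: hsq_L2_eq0 => //; [exact: measurable_sl_dom|exact: measurable_sl_wt| |].
  exact: sl_wt_ge0.
exact: sl_wt_gt0.
Qed.

Lemma hdot_sl0 i (u v : cfun R) : hmem (sl_space i) u -> hmem (sl_space i) v ->
  hnorm (sl_space i) u = 0 \/ hnorm (sl_space i) v = 0 -> hdot (sl_space i) u v = 0.
Proof.
move=> hu hv; rewrite !sl_null// => uv; move: hu hv; rewrite sl_spaceE => hu hv.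
have mD := measurable_sl_dom i; have mw := measurable_sl_wt (i := i).
have w0 := sl_wt_ge0 (i := i).
case: uv => z; [exact: hdot_L2_ae0l|exact: hdot_L2_ae0r].
Qed.

End UnitaryTransform.

(** * The summands of the decomposition *)

Section LevelAlgebra.
Context {R : realType} (A : antitree R) (n : nat).
Implicit Types (z : espot A n -> R[i]) (p : mode A n) (v : sphere A n) (u : sphere A n.+1).

(** Pointwise version of [uhat]: at a fixed parameter the transform is linear algebra on the values
    of one level. *)
Definition hat z p : R[i] := \sum_(e : espot A n) (acoef p e)%:C * z e.

Lemma hatK z e : z e = \sum_p (scoef p e)%:C * hat z p.
Proof.
under eq_bigr do rewrite /hat mulr_sumr.
rewrite exchange_big /= (bigD1 e)//= [X in _ + X]big1 ?addr0.
  under eq_bigr do rewrite mulrA -rmorphM.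
  by rewrite -mulr_suml -rmorph_sum /= scoef_acoef eqxx mul1r.
move=> e' /negbTE ne; under eq_bigr do rewrite mulrA -rmorphM.
by rewrite -mulr_suml -rmorph_sum /= scoef_acoef eq_sym ne mul0r.
Qed.

Lemma hat0 z : (forall e, z e = 0) <-> (forall p, hat z p = 0).
Proof.
split=> [z0 p|h0 e]; first by rewrite /hat big1// => e _; rewrite z0 mulr0.
by rewrite hatK big1// => p _; rewrite h0 mulr0.
Qed.

Lemma basis_sumC m (k : option 'I_(sn A m - 1)) :
  \sum_v (sbasis k v)%:C = (sn A m)%:R * (k == None)%:R :> R[i].
Proof.
rewrite -rmorph_sum /=; have [b0 b1 _] := basisP A m.
have -> : \sum_v sbasis k v = (sn A m)%:R * (k == None)%:R :> R.
  by rewrite -b1; apply: eq_bigr => v _; rewrite b0 mulr1.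
by rewrite rmorphM /= !rmorph_nat.
Qed.

Lemma basis0C m (v : sphere A m) : (sbasis None v)%:C = 1 :> R[i].
Proof. by have [-> _ _] := basisP A m. Qed.

Lemma hat_pair z p : hat z p = (ssize A n * mode_scale p)^-1%:C *
  \sum_v \sum_u (sbasis p.1 v)%:C * (sbasis p.2 u)%:C * z (v, u).
Proof.
rewrite pair_bigA mulr_sumr; apply: eq_bigr => -[v u] _ /=.
by rewrite /acoef !rmorphM /=; ring.
Qed.

Lemma hatK_pair z v u : z (v, u) =
  \sum_j \sum_k (sbasis j v)%:C * (sbasis k u)%:C * (mode_scale (j, k) : R)%:C * hat z (j, k).
Proof.
rewrite hatK pair_bigA; apply: eq_bigr => -[j k] _ /=.
by rewrite /scoef !rmorphM.
Qed.

Lemma mode_scale_None (j : option 'I_(sn A n - 1)) :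
  mode_scale ((j, None) : mode A n) = 1.
Proof. by case: j. Qed.

(** Summation over the upper ends annihilates the nonconstant second factors, so sums over the edges
    leaving a vertex of [S_n] see only the modes [(j, None)]. *)
Lemma hat_out z v : \sum_u z (v, u) =
  (sn A n.+1)%:R * \sum_j (sbasis j v)%:C * hat z (j, None).
Proof.
under eq_bigr do rewrite hatK_pair.
rewrite exchange_big mulr_sumr; apply: eq_bigr => j _ /=.
rewrite exchange_big (bigD1 None)//= [X in _ + X]big1 ?addr0.
  under eq_bigr do rewrite basis0C mulr1.
  by rewrite sumr_const -[LHS]mulr_natl; congr (_ * _); case: j => [j|] /=; rewrite rmorph1 mulr1.
move=> k k0; rewrite (eq_bigr (fun u => (sbasis k u)%:C *
    ((sbasis j v)%:C * (mode_scale (j, k) : R)%:C * hat z (j, k)))).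
  by rewrite -mulr_suml basis_sumC (negbTE k0) mulr0 mul0r.
by move=> u _; ring.
Qed.

Lemma hat_in z u : \sum_v z (v, u) =
  (sn A n)%:R * \sum_k (sbasis k u)%:C * hat z (None, k).
Proof.
under eq_bigr do rewrite hatK_pair exchange_big.
rewrite exchange_big mulr_sumr; apply: eq_bigr => k _ /=.
rewrite exchange_big (bigD1 None)//= [X in _ + X]big1 ?addr0.
  under eq_bigr do rewrite basis0C mul1r mulr1.
  by rewrite sumr_const -[LHS]mulr_natl.
move=> j j0; rewrite (eq_bigr (fun v => (sbasis j v)%:C *
    ((sbasis k u)%:C * (mode_scale (j, k) : R)%:C * hat z (j, k)))).
  by rewrite -mulr_suml basis_sumC (negbTE j0) mulr0 mul0r.
by move=> v _; ring.
Qed.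

Lemma hat_total z : \sum_e z e = (ssize A n)%:C * hat z (None, None).
Proof.
rewrite hat_pair /= mulr1 mulrA -rmorphM /= mulfV ?gt_eqF ?ssize_gt0// mul1r pair_bigA /=.
by apply: eq_bigr => -[v u] _; rewrite !basis0C !mul1r.
Qed.

(** The formula for the remaining coefficients has the same form as in [hat_const_in] on the level
    below. Applied to the common vertex values on a sphere, the two lemmas turn continuity into
    equality of coefficients. *)
Lemma hat_const_out z (c : sphere A n -> R[i]) : (forall v u, z (v, u) = c v) ->
  (forall j k, hat z (j, Some k) = 0) /\
  forall j, hat z (j, None) = ((sn A n)%:R)^-1 * \sum_v (sbasis j v)%:C * c v.
Proof.
move=> zc; have E p : hat z p = (ssize A n * mode_scale p)^-1%:C *
    ((sn A n.+1)%:R * (p.2 == None)%:R * \sum_v (sbasis p.1 v)%:C * c v).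
  rewrite hat_pair; congr (_ * _); rewrite mulr_sumr; apply: eq_bigr => v _.
  under eq_bigr do rewrite zc mulrAC mulrC.
  by rewrite -mulr_suml basis_sumC.
split=> [j k|j]; first by rewrite E /= mulr0 mul0r mulr0.
rewrite E mode_scale_None eqxx !mulr1 mulrA; congr (_ * _).
have s0 : (sn A n)%:R != 0 :> R[i] by rewrite pnatr_eq0 -lt0n sn_gt0.
have s1 : (sn A n.+1)%:R != 0 :> R[i] by rewrite pnatr_eq0 -lt0n sn_gt0.
rewrite /ssize natrM fmorphV rmorphM /= !rmorph_nat; field.
by rewrite s0 s1.
Qed.

Lemma hat_const_in z (c : sphere A n.+1 -> R[i]) : (forall v u, z (v, u) = c u) ->
  (forall j k, hat z (Some j, k) = 0) /\
  forall k, hat z (None, k) = ((sn A n.+1)%:R)^-1 * \sum_u (sbasis k u)%:C * c u.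
Proof.
move=> zc; have E p : hat z p = (ssize A n * mode_scale p)^-1%:C *
    ((sn A n)%:R * (p.1 == None)%:R * \sum_u (sbasis p.2 u)%:C * c u).
  rewrite hat_pair; congr (_ * _); rewrite exchange_big mulr_sumr; apply: eq_bigr => u _ /=.
  under eq_bigr do rewrite zc -mulrA.
  by rewrite -mulr_suml basis_sumC.
split=> [j k|k]; first by rewrite E /= mulr0 mul0r mulr0.
rewrite E /= mulr1 mulrA; congr (_ * _).
have s0 : (sn A n)%:R != 0 :> R[i] by rewrite pnatr_eq0 -lt0n sn_gt0.
have s1 : (sn A n.+1)%:R != 0 :> R[i] by rewrite pnatr_eq0 -lt0n sn_gt0.
rewrite mulr1 /ssize natrM fmorphV rmorphM /= !rmorph_nat; field.
by rewrite s0 s1.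
Qed.

Lemma const_outP z : (forall j k, hat z (j, Some k) = 0) ->
  forall v u, z (v, u) = \sum_j (sbasis j v)%:C * hat z (j, None).
Proof.
move=> h0 v u; rewrite hatK_pair; apply: eq_bigr => j _.
rewrite (bigD1 None)//= [X in _ + X]big1 ?addr0; last by case=> // k _; rewrite h0 mulr0.
by rewrite basis0C mulr1; case: j => [j|] /=; rewrite rmorph1 mulr1.
Qed.

Lemma const_inP z : (forall j k, hat z (Some j, k) = 0) ->
  forall v u, z (v, u) = \sum_k (sbasis k u)%:C * hat z (None, k).
Proof.
move=> h0 v u; rewrite hatK_pair exchange_big; apply: eq_bigr => k _ /=.
rewrite (bigD1 None)//= [X in _ + X]big1 ?addr0; last by case=> // j _; rewrite h0 mulr0.
by rewrite basis0C mul1r mulr1.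
Qed.

End LevelAlgebra.

Section EdgeSums.
Context {R : realType} (A : antitree R).

Lemma vtx_inj n (v w : sphere A n) : vtx v = vtx w -> v = w.
Proof. by move=> /eqP; rewrite eq_Tagged => /eqP. Qed.

Lemma ed_inj n : injective (@ed R A n).
Proof. by move=> e e' /eqP; rewrite eq_Tagged => /eqP. Qed.

Lemma Eplus_ed n (v : sphere A n) e : Eplus (vtx v) e -> exists u, e = ed (v, u).
Proof.
case: e => m [w u]; rewrite /Eplus /lower /= => h.
have e : m = n := congr1 tag h; subst m.
by have <- := vtx_inj h; exists u.
Qed.

Lemma Eminus_ed n (u : sphere A n.+1) e : Eminus (vtx u) e ->
  exists v : sphere A n, e = ed (v, u).
Proof.
case: e => m [v w]; rewrite /Eminus /upper /= => h.
have /eqP := congr1 tag h; rewrite /= eqSS => /eqP e; subst m.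
by have <- := vtx_inj h; exists v.
Qed.

Lemma Eminus_root (v : sphere A 0) e : ~ Eminus (vtx v) e.
Proof. by case: e => m [w u]; rewrite /Eminus /upper /= => /(congr1 tag). Qed.

Lemma Eplus_lvl n (v : sphere A n) e : Eplus (vtx v) e -> lvl e = n.
Proof. by move=> /Eplus_ed[u ->]. Qed.

Lemma Eminus_lvl n (u : sphere A n.+1) e : Eminus (vtx u) e -> lvl e = n.
Proof. by move=> /Eminus_ed[v ->]. Qed.

Variable V : nmodType.

Lemma fsbig_Eplus n (v : sphere A n) (F : edge A -> V) :
  \sum_(e \in Eplus (vtx v)) F e = \sum_u F (ed (v, u)).
Proof.
rewrite (@reindex_fsbig _ _ _ _ _ (fun u : sphere A n.+1 => ed (v, u)) [set: _]).
  exact: fsbig_finType.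
split => [u _ //|u u' _ _ /ed_inj[]//|e /Eplus_ed[u ->]].
by exists u.
Qed.

Lemma fsbig_Eminus n (u : sphere A n.+1) (F : edge A -> V) :
  \sum_(e \in Eminus (vtx u)) F e = \sum_v F (ed ((v, u) : espot A n)).
Proof.
rewrite (@reindex_fsbig _ _ _ _ _ (fun v : sphere A n => ed (v, u)) [set: _]).
  exact: fsbig_finType.
split => [v _ //|v v' _ _ /ed_inj[]//|e /Eminus_ed[v ->]].
by exists v.
Qed.

Lemma fsbig_Eminus_root (v : sphere A 0) (F : edge A -> V) :
  \sum_(e \in Eminus (vtx v)) F e = 0.
Proof. by apply: fsbig1 => e /Eminus_root. Qed.

Lemma fsbig_Elevel n (F : edge A -> V) :
  \sum_(e \in Elevel n) F e = \sum_(e : espot A n) F (ed e).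
Proof.
rewrite (@reindex_fsbig _ _ _ _ _ (@ed R A n) [set: _]); first exact: fsbig_finType.
split => [e _ //|e e' _ _ /ed_inj//|[m e] /= h].
by rewrite /Elevel /= in h; subst m; exists e.
Qed.

End EdgeSums.

Section Summands.
Context {R : realType} (A : antitree R).
Implicit Types (n : nat) (x : R) (f : edge A -> cfun R) (h : sl_index A -> cfun R)
  (i : sl_index A) (k : component).

Lemma ae_finType (T : finType) (P : T -> R -> Prop) :
  (forall e, {ae (@lebesgue_measure R), forall x, P e x}) ->
  {ae (@lebesgue_measure R), forall x, forall e, P e x}.
Proof. by move=> h; apply: filter_forall. Qed.

Definition lev f n x : espot A n -> R[i] := fun e => f (ed e) x.

Lemma uhat_hat f n (p : mode A n) x : uhat f p x = hat (lev f x) p.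
Proof. by []. Qed.

(** Reduces membership in a summand to the vanishing of finitely many coefficients at almost every
    point of each level, a form comparable with the defining conditions of the three kinds of
    subspaces. *)
Lemma null_level f k : hmem (L2A A) f ->
  (forall i, sl_component i <> k -> hnorm (sl_space i) (Ut f i) = 0) <->
  forall n, {ae (@lebesgue_measure R), forall x, Iseg A n x ->
    forall p : mode A n, sl_component (midx p) <> k -> hat (lev f x) p = 0}.
Proof.
move=> hf; have hU := hmem_Ut hf; split=> [null n|null i ik].
  have H (p : mode A n) : {ae (@lebesgue_measure R), forall x, Iseg A n x ->
      sl_component (midx p) <> k -> hat (lev f x) p = 0}.
    have [pk|pk] := pselect (sl_component (midx p) = k).
      by apply: nearW => x _ /(_ pk).
    have /(sl_null (hU.1 _)) := null _ pk; apply: filterS2 (ae_neq (tn A n)) => x xt h hx _.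
    by rewrite -uhat_hat -Ut_Iseg// h//; exact: midx_dom.
  by apply: filterS (ae_finType H) => x h hx p; exact: h.
apply/(sl_null (hU.1 _)).
have H : {ae (@lebesgue_measure R), forall x, forall n, Iseg A n x ->
    forall p : mode A n, sl_component (midx p) <> k -> hat (lev f x) p = 0}.
  exact/ae_foralln.
apply: filterS H => x H /sl_domP[n [p [e hx]]].
rewrite -e in ik *; rewrite Ut_Iseg// uhat_hat; exact: H.
Qed.

Lemma lev_eq f n x (e : espot A n) : Iseg A n x ->
  f (ed e) x = \sum_p (scoef p e)%:C * hat (lev f x) p.
Proof. by move=> hx; exact: (hatK (lev f x)). Qed.

Lemma ae_all_edges n (P : R -> espot A n -> Prop) :
  {ae (@lebesgue_measure R), forall x, Iseg A n x -> forall e, P x e} <->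
  forall e, {ae (@lebesgue_measure R), forall x, Iseg A n x -> P x e}.
Proof.
split=> [h e|h]; first by apply: filterS h => x h hx; exact: h.
by apply: filterS (ae_finType h) => x H hx e; exact: H.
Qed.

Lemma sl_component_mode n (p : mode A n) : sl_component (midx p) =
  match p with
  | (None, None) => CSym
  | (None, Some _) => CAnti n
  | (Some _, None) => CAnti n.-1
  | (Some _, Some _) => CZero n.-1
  end.
Proof.
case: n p => [|n]; last by case=> -[j|] [k|].
by move=> p; have := mode0 p; case: p => p1 [k|] /= ->.
Qed.

(** A function that is the same on all edges of a level depends on neither end of the edge, which by
    [hat_const_out] and [hat_const_in] leaves only the mode [(None, None)]. *)
Lemma Fsym_level f : hmem (L2A A) f -> Fsym f <->
  forall n, {ae (@lebesgue_measure R), forall x, Iseg A n x ->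
    forall p : mode A n, sl_component (midx p) <> CSym -> hat (lev f x) p = 0}.
Proof.
move=> hf; split=> [[_ sym] n|null].
  have H : {ae (@lebesgue_measure R), forall x, Iseg A n x ->
      forall e e' : espot A n, lev f x e = lev f x e'}.
    apply/ae_all_edges => e; apply/ae_all_edges => e'.
    exact: (sym (ed e) (ed e') erefl).
  apply: filterS H => x H /H{}H -[j [k|]].
    have /card_gt0P[u0 _] := sphere_gt0 A n.+1.
    by have [-> _] := @hat_const_out R A n (lev f x) (fun v => lev f x (v, u0))
      (fun v u => H _ _).
  case: j => [j _|]; last by rewrite sl_component_mode => /(_ erefl).
  have /card_gt0P[v0 _] := sphere_gt0 A n.
  by have [-> _] := @hat_const_in R A n (lev f x) (fun u => lev f x (v0, u))
    (fun v u => H _ _).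
split=> // -[n e] [m e'] /= emn; subst m.
apply: filterS (null n) => x H hx.
rewrite (lev_eq f e hx) (lev_eq f e' hx).
rewrite (bigD1 ((None, None) : mode A n))//= big1 ?addr0; last first.
  by move=> p pn; rewrite H ?mulr0// sl_component_mode; case: p pn => -[j|] [k|].
rewrite (bigD1 ((None, None) : mode A n))//= big1 ?addr0; last first.
  by move=> p pn; rewrite H ?mulr0// sl_component_mode; case: p pn => -[j|] [k|].
by rewrite /scoef /= !rmorphM /= !basis0C.
Qed.

End Summands.

Section SummandLevels.
Context {R : realType} (A : antitree R).
Implicit Types (n m : nat) (x : R) (f : edge A -> cfun R) (h : sl_index A -> cfun R)
  (i : sl_index A) (k : component).

Lemma lvl_ed n (e : espot A n) : lvl (ed e) = n. Proof. by []. Qed.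

Lemma all_modes0 f m : (forall e : edge A, lvl e = m -> aeq (Iseg A m) (f e) (cst 0)) ->
  {ae (@lebesgue_measure R), forall x, Iseg A m x -> forall p : mode A m, hat (lev f x) p = 0}.
Proof.
move=> f0; have H : {ae (@lebesgue_measure R), forall x, Iseg A m x ->
    forall e : espot A m, lev f x e = 0}.
  by apply/ae_all_edges => e; exact: (f0 (ed e) erefl).
by apply: filterS H => x H hx; apply/hat0; exact: H.
Qed.

Lemma all_edges0 f m : {ae (@lebesgue_measure R), forall x, Iseg A m x ->
    forall p : mode A m, hat (lev f x) p = 0} ->
  forall e : edge A, lvl e = m -> aeq (Iseg A m) (f e) (cst 0).
Proof.
move=> H [n e] /= em; subst m.
by apply: filterS H => x H hx; have /hat0 := H hx; exact.
Qed.

Lemma component_zero n m (p : mode A m) : sl_component (midx p) = CZero n -> m = n.+1.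
Proof.
rewrite sl_component_mode; case: m p => [|m] p; last by case: p => -[j|] [l|] //= [->].
by have := mode0 p; case: p => p1 [l|] /= ->.
Qed.

Lemma component_anti n m (p : mode A m) : sl_component (midx p) = CAnti n ->
  (m = n /\ p.1 = None) \/ (m = n.+1 /\ p.2 = None).
Proof.
rewrite sl_component_mode; case: m p => [|m] p; last first.
  by case: p => -[j|] [l|] //= -[e]; [right; rewrite e|left].
by have := mode0 p; case: p => p1 [l|] /= -> // -[e]; left.
Qed.

(** By [hat_out] and [hat_in], the sums at all vertices vanish exactly when the coefficients with a
    constant factor do. *)
Lemma Fzero_level n f : hmem (L2A A) f -> Fzero n.+1 f <->
  forall m, {ae (@lebesgue_measure R), forall x, Iseg A m x ->
    forall p : mode A m, sl_component (midx p) <> CZero n -> hat (lev f x) p = 0}.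
Proof.
move=> hf; split=> [[_ off s1 s2] m|null].
  have [->|mn] := eqVneq m n.+1; last first.
    have H := @all_modes0 f m; apply: filterS (H _) => [x {}H hx p _|e em]; first exact: H.
    by rewrite -em; apply: off => en; move: mn; rewrite -em en eqxx.
  have H1 : {ae (@lebesgue_measure R), forall x, forall v : sphere A n.+1,
      Iseg A n.+1 x -> \sum_u lev f x (v, u) = 0}.
    by apply: ae_finType => v; apply: filterS (s1 v) => x; rewrite fsbig_Eplus.
  have H2 : {ae (@lebesgue_measure R), forall x, forall u : sphere A n.+2,
      Iseg A n.+1 x -> \sum_v lev f x (v, u) = 0}.
    by apply: ae_finType => u; apply: filterS (s2 u) => x; rewrite fsbig_Eminus.
  apply: filterS2 H1 H2 => x H1 H2 hx [j [l|]]; last first.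
    move=> _; rewrite hat_pair big1 ?mulr0// => v _ /=.
    by under eq_bigr do rewrite basis0C mulr1; rewrite -mulr_sumr H1// mulr0.
  case: j => [j|] ; first by rewrite sl_component_mode => /(_ erefl).
  move=> _; rewrite hat_pair exchange_big big1 ?mulr0// => u _ /=.
  by under eq_bigr do rewrite basis0C mul1r; rewrite -mulr_sumr H2// mulr0.
split=> //.
- move=> e en; apply: all_edges0 => //.
  apply: filterS (null (lvl e)) => x H hx p; apply: H => // /component_zero; exact: en.
- move=> v; apply: filterS (null n.+1) => x H hx; rewrite fsbig_Eplus.
  rewrite (hat_out (lev f x)) big1 ?mulr0// => j _; rewrite H ?mulr0//.
  by rewrite sl_component_mode; case: j.
- move=> u; apply: filterS (null n.+1) => x H hx; rewrite fsbig_Eminus.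
  rewrite (hat_in (lev f x)) big1 ?mulr0// => l _; rewrite H ?mulr0//.
  by rewrite sl_component_mode; case: l.
Qed.

Lemma hmem_restrict f (P : edge A -> Prop) : hmem (L2A A) f ->
  hmem (L2A A) (fun e => if `[< P e >] then f e else 0).
Proof.
move=> /hmem_L2AP[mf ef]; apply/hmem_L2AP; split.
  by move=> e; case: asboolP => _; [exact: mf|exact: cmeasurable0].
apply: le_lt_trans ef; apply: le_esum => e _.
case: asboolP => _ //; rewrite integral0_eq.
  by apply: integral_ge0 => x _; rewrite lee_fin mulr_ge0 ?sqn_ge0.
by move=> x _; rewrite sqn0 mul0r.
Qed.

(** An edge on level [n] or [n.+1] belongs to exactly one star with centre in S_(n+1), centred at
    its upper or lower end respectively. Hence the functions [h v] are forced to be the restrictions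
    of [f] to the stars, and the existential turns into conditions on [f] itself. *)
Lemma Ftilde_level n f : hmem (L2A A) f -> Ftilde n.+1 f <->
  [/\ forall e : edge A, lvl e <> n -> lvl e <> n.+1 -> aeq (Iseg A (lvl e)) (f e) (cst 0),
      {ae (@lebesgue_measure R), forall x, Iseg A n.+1 x ->
        forall (v : sphere A n.+1) u u', lev f x (v, u) = lev f x (v, u')} &
      {ae (@lebesgue_measure R), forall x, Iseg A n x ->
        forall v v' (u : sphere A n.+1), lev f x (v, u) = lev f x (v', u)}].
Proof.
move=> hf; split=> [[_ [h [hv fh]]]|[off c1 c2]].
  have hoff (v : sphere A n.+1) e : ~ (Eplus (vtx v) `|` Eminus (vtx v)) e ->
      aeq (Iseg A (lvl e)) (h v e) (cst 0) by have [_ + _] := hv v; exact.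
  have heq (v : sphere A n.+1) := let: And3 _ _ H := hv v in H.
  have fhE e x : (\sum_v h v) e x = \sum_v h v e x by rewrite !fct_sumE.
  (* If no star other than that of [v0] contains [e], all other terms of the sum vanish on [e]
     almost everywhere. *)
  have one e (v0 : sphere A n.+1) : (forall v, (Eplus (vtx v) `|` Eminus (vtx v)) e -> v = v0) ->
      aeq (Iseg A (lvl e)) (f e) (h v0 e).
    move=> only; have H : {ae (@lebesgue_measure R), forall x, forall v,
        v != v0 -> Iseg A (lvl e) x -> h v e x = 0}.
      apply: ae_finType => v; have [->|vv0] := eqVneq v v0; first exact: nearW.
      have no : ~ (Eplus (vtx v) `|` Eminus (vtx v)) e by move=> /only e0; rewrite e0 eqxx in vv0.
      by apply: filterS (hoff v e no) => x H _.
    apply: filterS2 H (fh e) => x H fx hx; rewrite fx// fhE (bigD1 v0)//= big1 ?addr0//.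
    by move=> v vv0; exact: H.
  have oneP (v : sphere A n.+1) u : aeq (Iseg A n.+1) (f (ed (v, u))) (h v (ed (v, u))).
    apply: (one (ed (v, u)) v) => v' [/vtx_inj//|/Eminus_lvl /eqP].
    by rewrite lvl_ed eqn_leq ltnn.
  have oneM v (u : sphere A n.+1) : aeq (Iseg A n) (f (ed (v, u))) (h u (ed (v, u))).
    apply: (one (ed (v, u)) u) => v' [/Eplus_lvl /eqP|/vtx_inj//].
    by rewrite lvl_ed eqn_leq ltnn andbF.
  split.
  - move=> e en en1.
    have H : {ae (@lebesgue_measure R), forall x, forall v,
        Iseg A (lvl e) x -> h v e x = 0}.
      apply: ae_finType => v; apply: hoff => -[/Eplus_lvl|/Eminus_lvl] //.
    apply: filterS2 H (fh e) => x H fx hx; rewrite fx// fhE big1// => v _; exact: H.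
  - have H : {ae (@lebesgue_measure R), forall x, forall (v : sphere A n.+1) u u',
        Iseg A n.+1 x -> lev f x (v, u) = lev f x (v, u')}.
      apply: ae_finType => v; apply: ae_finType => u; apply: ae_finType => u'.
      have := heq v (ed (v, u)) (ed (v, u')) (or_introl erefl) (or_introl erefl) erefl.
      move=> h12; apply: filterS3 (oneP v u) (oneP v u') h12 => x e1 e2 e3 hx.
      by rewrite /lev e1// e2// e3.
    by apply: filterS H => x H hx v u u'; exact: H.
  - have H : {ae (@lebesgue_measure R), forall x, forall v v' (u : sphere A n.+1),
        Iseg A n x -> lev f x (v, u) = lev f x (v', u)}.
      apply: ae_finType => v; apply: ae_finType => v'; apply: ae_finType => u.
      have := heq u (ed (v, u)) (ed (v', u)) (or_intror erefl) (or_intror erefl) erefl.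
      move=> h12; apply: filterS3 (oneM v u) (oneM v' u) h12 => x e1 e2 e3 hx.
      by rewrite /lev e1// e2// e3.
    by apply: filterS H => x H hx v v' u; exact: H.
split=> //.
pose E (v : sphere A n.+1) := Eplus (vtx v) `|` Eminus (vtx v).
exists (fun v e => if `[< E v e >] then f e else 0); split.
  move=> v; split.
  - exact: hmem_restrict.
  - by move=> e ne; rewrite asboolF//; exact: nearW.
  - move=> e e' Ee Ee'; rewrite !asboolT//.
    case: Ee => [/Eplus_ed|/Eminus_ed] [u ->]; case: Ee' => [/Eplus_ed|/Eminus_ed] [u' ->];
      rewrite !lvl_ed => l.
    + by apply: filterS c1 => x c1 hx; exact: c1.
    + by move/eqP: l; rewrite eqn_leq ltnn.
    + by move/eqP: l; rewrite eqn_leq ltnn andbF.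
    + by apply: filterS c2 => x c2 hx; exact: c2.
move=> e.
have fhE x : (\sum_v (fun e => if `[< E v e >] then f e else 0)) e x =
    \sum_v (if `[< E v e >] then f e x else 0).
  by rewrite !fct_sumE; apply: eq_bigr => v _; case: ifP.
have [[v0 [Ev0 only]]|no] := pselect (exists v0, E v0 e /\ forall v, E v e -> v = v0).
  apply: nearW => x _; rewrite fhE (bigD1 v0)//= asboolT// big1 ?addr0// => v vv0.
  by rewrite asboolF// => /only e0; rewrite e0 eqxx in vv0.
have en : lvl e <> n.
  case: e fhE no => m [a b] fhE no /= mn; subst m; apply: no; exists b; split; first by right.
  move=> v [/Eplus_lvl /eqP|/vtx_inj//].
  by rewrite eqn_leq ltnn andbF.
have en1 : lvl e <> n.+1.
  case: e fhE no en => m [a b] fhE no en /= mn; subst m; apply: no; exists a; split; first by left.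
  move=> v [/vtx_inj//|/Eminus_lvl /eqP].
  by rewrite eqn_leq ltnn.
apply: filterS (off e en en1) => x fx hx; rewrite fx// fhE big1// => v _.
by rewrite asboolF// => -[/Eplus_lvl|/Eminus_lvl].
Qed.

(** Independence of one end point leaves the modes [(None, k)] on level [n] and [(j, None)] on level
    [n.+1]; the vanishing level sums remove [(None, None)], which belongs to the radial part. *)
Lemma Fanti_level n f : hmem (L2A A) f -> Fanti n.+1 f <->
  forall m, {ae (@lebesgue_measure R), forall x, Iseg A m x ->
    forall p : mode A m, sl_component (midx p) <> CAnti n -> hat (lev f x) p = 0}.
Proof.
move=> hf; split=> [[/(Ftilde_level n hf)[off c1 c2] tot] m|null].
  have T : {ae (@lebesgue_measure R), forall x, Iseg A m x ->
      hat (lev f x) ((None, None) : mode A m) = 0}.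
    apply: filterS (tot m) => x; rewrite fsbig_Elevel => H hx.
    have := H hx; rewrite (hat_total (lev f x)) => /eqP; rewrite mulf_eq0.
    by rewrite eq_complex /= eqxx andbT gt_eqF ?ssize_gt0//= => /eqP.
  have [mn|mn] := eqVneq m n.
    subst m; apply: filterS2 c2 T => x c2 T hx [[j|] [l|]].
    - by move=> _; have [-> _] := @hat_const_in R A n (lev f x)
        (fun u => lev f x (xchoose (card_gt0P (sphere_gt0 A n)), u)) (fun v u => c2 hx v _ u).
    - by move=> _; have [-> _] := @hat_const_in R A n (lev f x)
        (fun u => lev f x (xchoose (card_gt0P (sphere_gt0 A n)), u)) (fun v u => c2 hx v _ u).
    - by rewrite sl_component_mode => /(_ erefl).
    - by move=> _; exact: T.
  have [mn1|mn1] := eqVneq m n.+1.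
    subst m; apply: filterS2 c1 T => x c1 T hx [[j|] [l|]].
    - by move=> _; have [-> _] := @hat_const_out R A n.+1 (lev f x)
        (fun v => lev f x (v, xchoose (card_gt0P (sphere_gt0 A n.+2)))) (fun v u => c1 hx v u _).
    - by rewrite sl_component_mode => /(_ erefl).
    - by move=> _; have [-> _] := @hat_const_out R A n.+1 (lev f x)
        (fun v => lev f x (v, xchoose (card_gt0P (sphere_gt0 A n.+2)))) (fun v u => c1 hx v u _).
    - by move=> _; exact: T.
  have H := @all_modes0 f m; apply: filterS (H _) => [x {}H hx p _|e em]; first exact: H.
  by rewrite -em; apply: off => e0; move: mn mn1; rewrite -em e0 eqxx.
split; last first.
  move=> m; apply: filterS (null m) => x H hx; rewrite fsbig_Elevel (hat_total (lev f x)).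
  by rewrite H ?mulr0// sl_component_mode.
apply/(Ftilde_level n hf); split.
- move=> e en en1; apply: all_edges0 => //.
  by apply: filterS (null (lvl e)) => x H hx p; apply: H => // /component_anti[[]|[]].
- apply: filterS (null n.+1) => x H hx v u u'.
  have h0 j l : hat (lev f x) ((j, Some l) : mode A n.+1) = 0.
    apply: H => //; rewrite sl_component_mode; case: j => // -[] /eqP.
    by rewrite eqn_leq ltnn.
  by rewrite !const_outP.
- apply: filterS (null n) => x H hx v v' u.
  have h0 j l : hat (lev f x) ((Some j, l) : mode A n) = 0.
    apply: H => // /component_anti[[]//|[/eqP]]; by rewrite eqn_leq ltnn andbF.
  by rewrite !const_inP.
Qed.

Theorem summand_null k f : hmem (L2A A) f ->
  summand A k f <-> forall i, sl_component i <> k -> hnorm (sl_space i) (Ut f i) = 0.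
Proof.
move=> hf; rewrite null_level//; case: k => [|n|n].
- exact: Fsym_level.
- exact: Fanti_level.
- exact: Fzero_level.
Qed.

Lemma summand_hmem k f : summand A k f -> hmem (L2A A) f.
Proof. by case: k => [[]|n [[]]|n []]. Qed.

End SummandLevels.

(** * Projections and the orthogonal decomposition *)

Section Decomposition.
Context {R : realType} (A : antitree R).
Implicit Types (f g : edge A -> cfun R) (h : sl_index A -> cfun R)
  (i : sl_index A) (k : component).

Local Notation X := (L2A A).
Local Notation Y := (sl_sum_space A).

Definition sl_restrict (P : pred (sl_index A)) h : sl_index A -> cfun R :=
  fun i => if P i then h i else 0.

Lemma hmem_sl_restrict P h : hmem Y h -> hmem Y (sl_restrict P h).
Proof.
move=> [hh eh]; split.
  by move=> i; rewrite /sl_restrict; case: ifP => _; [exact: hh|exact: hmem0 (semihilbert_sl i)].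
apply: le_lt_trans eh; apply: le_esum => i _; rewrite lee_fin /sl_restrict.
case: ifP => _ //; rewrite -!/(hsq _ _) (hsq0 (semihilbert_sl i)).
exact: hsq_ge0 (semihilbert_sl i) _.
Qed.

Lemma Ut_Vt_restrict P f : Ut (Vt (sl_restrict P (Ut f))) = sl_restrict P (Ut f).
Proof.
apply: Ut_Vt => i x no; rewrite /sl_restrict; case: ifP => // _.
exact: Ut_out.
Qed.

Definition summand_proj k f : edge A -> cfun R :=
  Vt (sl_restrict (fun i => sl_component i == k) (Ut f)).

Lemma Ut_summand_proj k f :
  Ut (summand_proj k f) = sl_restrict (fun i => sl_component i == k) (Ut f).
Proof. exact: Ut_Vt_restrict. Qed.

Lemma hmem_summand_proj k f : hmem X f -> hmem X (summand_proj k f).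
Proof. by move=> hf; apply: hmem_Vt; apply: hmem_sl_restrict; exact: hmem_Ut. Qed.

Lemma hnorm_sl0 i : hnorm (sl_space i) 0 = 0.
Proof. by apply/(hnorm_eq0 (semihilbert_sl i)); exact: hsq0 (semihilbert_sl i). Qed.

Lemma summand_summand_proj k f : hmem X f -> summand A k (summand_proj k f).
Proof.
move=> hf; apply/summand_null; first exact: hmem_summand_proj.
move=> i ik; rewrite Ut_summand_proj /sl_restrict; case: eqP => // _.
exact: hnorm_sl0.
Qed.

Lemma hdot_Ut f g : hmem X f -> hmem X g -> hdot X f g = hdot Y (Ut f) (Ut g).
Proof. by have [_ _ dotU _] := unitary_Ut A => hf hg; rewrite dotU. Qed.

Lemma hdot_disjoint f g : hmem X f -> hmem X g ->
  (forall i, hnorm (sl_space i) (Ut f i) = 0 \/ hnorm (sl_space i) (Ut g i) = 0) ->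
  hdot X f g = 0.
Proof.
move=> hf hg fg; rewrite hdot_Ut//; apply: hdot_hsum0 => i.
by apply: hdot_sl0 => //; [exact: (hmem_Ut hf).1|exact: (hmem_Ut hg).1].
Qed.

Lemma summand_orthproj k f : hmem X f -> is_orthproj X (summand A k) f (summand_proj k f).
Proof.
move=> hf; split; first exact: summand_summand_proj.
move=> g gk; have hg := summand_hmem gk.
have hp := hmem_summand_proj k hf.
apply: (hdot_disjoint (hmemB (semihilbert_L2A A) hf hp) hg).
move=> i; rewrite UtB Ut_summand_proj.
have [ik|ik] := eqVneq (sl_component i) k; last first.
  by right; move/(summand_null k hg): gk; apply; apply/eqP.
left; rewrite (_ : (_ - _) i = 0) ?hnorm_sl0//.
change (Ut f i - sl_restrict (fun i => sl_component i == k) (Ut f) i = 0).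
by rewrite /sl_restrict ik eqxx subrr.
Qed.

Lemma summand_closed k : closed_subspace X (summand A k).
Proof.
have HX := semihilbert_L2A A; have HY := semihilbert_sl_sum A.
split.
- exact: summand_hmem.
- apply/summand_null; first exact: hmem0.
  by move=> i _; rewrite Ut0; exact: hnorm_sl0.
- move=> a f g fk gk; have hf := summand_hmem fk; have hg := summand_hmem gk.
  apply/summand_null; first exact: hmemL.
  move=> i ik; have Hi := semihilbert_sl i.
  have /(hnorm_eq0 Hi) f0 := (summand_null k hf).1 fk i ik.
  have /(hnorm_eq0 Hi) g0 := (summand_null k hg).1 gk i ik.
  have hfi := (hmem_Ut hf).1 i; have hgi := (hmem_Ut hg).1 i.
  apply/(hnorm_eq0 Hi); rewrite UtL.
  change (hsq (sl_space i) (a *: Ut f i + Ut g i) = 0).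
  apply/eqP; rewrite eq_le (hsq_ge0 Hi) andbT.
  apply: le_trans (hsqD Hi (hmemZ Hi a hfi) hgi) _.
  by rewrite (hsqZ Hi)// f0 g0 !mulr0 addr0.
- move=> f hf cl; apply/summand_null => // i ik; have Hi := semihilbert_sl i.
  have hfi := (hmem_Ut hf).1 i.
  apply/(hnorm_eq0 Hi); apply: (hsq_close0 Hi (C := 2)) => // e e0.
  have se : 0 < Num.sqrt e by rewrite sqrtr_gt0.
  have [g gk] := cl _ se; rewrite hnorm_lt// sqr_sqrtr ?(ltW e0)// => fg.
  have hg := summand_hmem gk; have hgi := (hmem_Ut hg).1 i.
  have /(hnorm_eq0 Hi) g0 := (summand_null k hg).1 gk i ik.
  have hB := hmemB HX hf hg.
  have le : hsq (sl_space i) (Ut f i - Ut g i) <= e.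
    apply: ltW; apply: le_lt_trans fg; rewrite -lee_fin -(hsq_Ut hB).
    rewrite hsq_hsum_EFin; last 2 first.
    + by move=> j; exact: semihilbert_sl.
    + exact: hmem_Ut.
    apply: esum_ge; exists [set i]; first by split => //; exact: finite_set1.
    by rewrite fsbig_set1 UtB.
  rewrite -[Ut f i](subrK (Ut g i)).
  apply: le_trans (hsqD Hi (hmemB Hi hfi hgi) hgi) _.
  by rewrite g0 mulr0 addr0; apply: ler_wpM2l.
Qed.

Theorem summand_decomposition : orthogonal_decomposition X (summand A).
Proof.
have HX := semihilbert_L2A A.
split; first exact: summand_closed.
- move=> k l f g kl fk gl; have hf := summand_hmem fk; have hg := summand_hmem gl.
  apply: hdot_disjoint => // i; have [ik|ik] := eqVneq (sl_component i) k.
    right; apply: (summand_null l hg).1 => // il; move: kl; rewrite -ik il eqxx//.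
  by left; apply: (summand_null k hf).1 => //; apply/eqP.
move=> f hf; exists (fun k => summand_proj k f); split.
  by move=> k; exact: summand_summand_proj.
move=> eps e0; have hUf := hmem_Ut hf.
have [r hr] := esum_tail (fun i => hsq_ge0 (semihilbert_sl i) (Ut f i)) hUf.2
  (exprn_gt0 2 e0).
(* Once [s] contains the components of all indices in [r], the remainder has nonzero coordinates
   only outside [r]. *)
exists (map (@sl_component R A) r) => s us rs.
rewrite hnorm_lt//.
have hP k := hmem_summand_proj k hf.
have hS : hmem X (f - \sum_(k <- s) summand_proj k f).
  by apply: (hmemB HX hf); apply: (hmem_sum HX) => k _; exact: hP.
rewrite -lte_fin -(hsq_Ut hS) hsq_hsum_EFin; last 2 first.
- by move=> j; exact: semihilbert_sl.
- exact: hmem_Ut.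
apply: le_lt_trans hr; apply: le_esum => i _; rewrite lee_fin.
have Hi := semihilbert_sl i.
have US : Ut (\sum_(k <- s) summand_proj k f) i =
    if sl_component i \in s then Ut f i else 0.
  have -> : Ut (\sum_(k <- s) summand_proj k f) = \sum_(k <- s) Ut (summand_proj k f).
    by apply: (big_morph _ (@UtD R A)); exact: Ut0.
  rewrite fct_sumE; under eq_bigr do rewrite Ut_summand_proj /sl_restrict.
  case: ifPn => [ins|nins]; last first.
    by rewrite big1_seq// => k /= ks; case: eqP => // e; move: nins; rewrite e ks.
  rewrite (bigD1_seq (sl_component i))//= eqxx big1 ?addr0// => k.
  by rewrite eq_sym => /negbTE ->.
rewrite UtB; change (hsq (sl_space i) (Ut f i - Ut (\sum_(k <- s) summand_proj k f) i) <=
  if i \in r then 0 else hsq (sl_space i) (Ut f i)).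
rewrite US; case: ifPn => ins.
  by rewrite subrr (hsq0 Hi); case: ifP => // _; exact: hsq_ge0.
rewrite subr0 ifN//; apply: contra ins => ir; apply: rs; exact: map_f.
Qed.

End Decomposition.

(** * Kirchhoff conditions in terms of modes *)

Section FiniteCombinations.
Context {R : realType}.
Implicit Types (D : set R) (f g : cfun R) (a b x : R).

Lemma lincombE (T : finType) (c : T -> R[i]) (F : T -> cfun R) :
  (fun x => \sum_e c e * F e x) = \sum_e c e *: F e :> cfun R.
Proof. by apply/funext => x; rewrite fct_sumE. Qed.

Lemma abscont_lincomb (T : finType) a b (c : T -> R[i]) (F F1 : T -> cfun R) :
  (forall e, abscont a b (F e) (F1 e)) ->
  abscont a b (fun x => \sum_e c e * F e x) (fun x => \sum_e c e * F1 e x).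
Proof.
move=> h; rewrite !lincombE; elim/big_rec2: _ => [|e y1 y2 _ IH]; first exact: abscont0.
exact: abscontL.
Qed.

Lemma H2_lincomb (T : finType) a b (c : T -> R[i]) (f F F1 F2 : T -> cfun R) :
  (forall e, H2 a b (f e) (F e) (F1 e) (F2 e)) ->
  H2 a b (fun x => \sum_e c e * f e x) (fun x => \sum_e c e * F e x)
    (fun x => \sum_e c e * F1 e x) (fun x => \sum_e c e * F2 e x).
Proof.
move=> h; split.
- have H : {ae (@lebesgue_measure R), forall x, forall e, `[a, b]%classic x -> f e x = F e x}.
    by apply: filter_forall => e; have [] := h e.
  by apply: filterS H => x H xab; apply: eq_bigr => e _; rewrite H.
- by apply: abscont_lincomb => e; have [] := h e.
- by apply: abscont_lincomb => e; have [] := h e.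
- rewrite lincombE; apply: (hmem_sum (semihilbert_L2c a b)) => e _.
  by apply: (hmemZ (semihilbert_L2c a b)); have [] := h e.
Qed.

Lemma H2_eq a b f g F F1 F2 : aeq `]a, b[ f g -> H2 a b f F F1 F2 -> H2 a b g F F1 F2.
Proof.
move=> /aeq_itv fg [fF h1 h2 h3]; split => //.
exact: aeq_trans (aeq_sym fg) fF.
Qed.

Lemma hmem_L2c_ae a b f g : cmeasurable `[a, b] g -> aeq `[a, b] f g ->
  hmem (L2 `[a, b] (cst 1)) f -> hmem (L2 `[a, b] (cst 1)) g.
Proof.
move=> mg fg [mf ef]; split => //; apply: le_lt_trans ef; rewrite le_eqVlt; apply/orP; left.
apply/eqP; apply: ge0_ae_eq_integral => //.
- exact: (measurable_sqnw (w := cst 1) (measurable_cst _) mg).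
- exact: (measurable_sqnw (w := cst 1) (measurable_cst _) mf).
- by move=> x _; rewrite lee_fin mulr_ge0 ?addr_ge0 ?sqr_ge0.
- by move=> x _; rewrite lee_fin mulr_ge0 ?addr_ge0 ?sqr_ge0.
- by apply: filterS fg => x fg xab; rewrite fg.
Qed.

Lemma ae_point (P : R -> Prop) a b : a < b -> {ae (@lebesgue_measure R), forall x, P x} ->
  exists2 x, a < x < b & P x.
Proof.
move=> ab [N [mN N0 PN]]; apply: contrapT => no.
have sub : `]a, b[ `<=` N.
  move=> x; rewrite /= in_itv/= => xab; apply: PN => /= Px; apply: no; by exists x.
have : (@lebesgue_measure R `]a, b[ <= @lebesgue_measure R N)%E.
  by apply: le_measure; rewrite ?inE//; exact: measurable_itv.
by rewrite N0 lebesgue_measure_itv/= lte_fin ab -EFinB lee_fin leNgt subr_gt0 ab.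
Qed.

Lemma continuous_ae0 a b (u : R -> R) : a < b -> {within `[a, b], continuous u} ->
  {ae (@lebesgue_measure R), forall x, `[a, b]%classic x -> u x = 0} ->
  forall x, a <= x <= b -> u x = 0.
Proof.
move=> ab cu u0 x /andP[ax xb].
apply/eqP; rewrite -normr_eq0 eq_le normr_ge0 andbT; apply/ler_addgt0Pr => e e0; rewrite add0r.
have xA : `[a, b]%classic x by rewrite /= in_itv/= ax.
have cx := cu x; have /cvgrPdist_lt /(_ e e0) := cx.
rewrite /prop_near1 /nbhs /= -nbhs_subspace_in// => /nbhs_ballP[d /= d0 hd].
have cd : Num.max a (x - d) < Num.min b (x + d).
  by rewrite lt_min !gt_max ab /=; apply/and3P; split; lra.
have [y] := ae_point cd u0; rewrite gt_max lt_min => /andP[/andP[ay xy] /andP[yb yx]] uy.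
have yA : `[a, b]%classic y by rewrite /= in_itv/= !ltW.
have yd : ball x d y by rewrite /ball /= ltr_norml; apply/andP; split; lra.
have h : `|u x - u y| < e := hd y yd yA.
by move: h; rewrite uy// subr0 => /ltW.
Qed.

(** Finite support on the antitree is an almost everywhere condition, while the pre-minimal line
    operator asks its representative to vanish pointwise; continuity bridges the two. *)
Lemma abscont_ae0 a b f f1 : a < b -> abscont a b f f1 -> aeq `[a, b] f 0 ->
  forall x, a <= x <= b -> f x = 0.
Proof.
move=> ab af f0 x xab; have [cr ci] := abscont_continuous (ltW ab) af.
apply: complexP.
  apply: (continuous_ae0 ab cr) xab.
  by apply: filterS f0 => y f0 yab; rewrite f0.
apply: (continuous_ae0 ab ci) xab.
by apply: filterS f0 => y f0 yab; rewrite f0.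
Qed.

End FiniteCombinations.

(** * Gluing functions across levels *)

Section Gluing.
Context {R : realType} (A : antitree R).
Implicit Types (H K : nat -> cfun R) (n : nat) (x b : R).

Definition level_glue H : cfun R := fun x => \sum_(n \in [set n | Iseg A n x]) H n x.

Lemma level_glueE H n x : Iseg A n x -> level_glue H x = H n x.
Proof.
move=> hx; rewrite /level_glue (_ : [set _ | _] = [set n]) ?fsbig_set1//.
by apply/seteqP; split=> m /= => [hm|-> //]; exact: Iseg_inj hm hx.
Qed.

Lemma Iseg_left n : Iseg A n (tn A n).
Proof. by rewrite IsegE lexx tn_lt. Qed.

Lemma cmeasurable_glue H n : cmeasurable `[tn A n, tn A n.+1] (H n) ->
  cmeasurable `[tn A n, tn A n.+1] (level_glue H).
Proof.
move=> mH; apply: cmeasurable_itv; apply: (@cmeasurable_eq _ _ (H n)).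
  move=> x /set_mem; rewrite /= in_itv/= => /andP[h1 h2].
  by rewrite (@level_glueE _ n)// IsegE (ltW h1).
apply: cmeasurableS mH; first exact: measurable_itvR.
by apply: subset_itv; rewrite bnd_simp.
Qed.

(** Matching at the nodes is asked of the primitives [H]. The lemma is applied to F and to mu F',
    the two functions whose absolute continuity the line operator requires. *)
Lemma abscont_glue H K : (forall n, abscont (tn A n) (tn A n.+1) (H n) (K n)) ->
  (forall n, H n (tn A n.+1) = H n.+1 (tn A n.+1)) ->
  forall b, interval0L A b -> abscont 0 b (level_glue H) (level_glue K).
Proof.
move=> aH cH b /interval0LP[N hN].
have piece n : abscont (tn A n) (tn A n.+1) (level_glue H) (level_glue K).
  apply: (abscont_eq (ltW (tn_lt A n)) (aH n)).
  - move=> x /andP[h1]; rewrite le_eqVlt => /predU1P[->|h2].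
      by rewrite (level_glueE _ (Iseg_left n.+1)) cH.
    by rewrite (@level_glueE _ n)// IsegE h1.
  - apply: aeq_itv; apply: nearW => x; rewrite /= in_itv/= => /andP[h1 h2].
    by rewrite (@level_glueE _ n)// IsegE (ltW h1).
  - by apply: cmeasurable_glue; exact: cintegrable_measurable (aH n).1.
have aN n : abscont 0 (tn A n.+1) (level_glue H) (level_glue K).
  elim: n => [|n IH]; first by rewrite -[X in abscont X](tn0 A); exact: piece.
  apply: (abscont_cat (c := tn A n.+1)) IH (piece n.+1); first exact: tn_ge0.
  exact: ltW (tn_lt A n.+1).
apply: abscontS (aN N) => //.
by move: hN; rewrite IsegE => /andP[_ /ltW].
Qed.

End Gluing.

(** * From Kirchhoff conditions to mode solutions *)

Section ModeSolutions.
Context {R : realType} (A : antitree R).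
Implicit Types (n m : nat) (x : R) (i : sl_index A).

(** Linear independence of the basis: an identity at all vertices of a sphere becomes one for each
    coefficient. *)
Lemma sbasis_coords n (a b : option 'I_(sn A n - 1) -> R[i]) :
  (forall v, \sum_j (sbasis j v)%:C * a j = \sum_j (sbasis j v)%:C * b j) -> a =1 b.
Proof.
move=> ab k; have [_ b1 _] := basisP A n.
have s0 : (sn A n)%:R != 0 :> R[i] by rewrite pnatr_eq0 -lt0n sn_gt0.
have E (d : option 'I_(sn A n - 1) -> R[i]) :
    \sum_v (sbasis k v)%:C * \sum_j (sbasis j v)%:C * d j = (sn A n)%:R * d k.
  under eq_bigr do rewrite mulr_sumr.
  rewrite exchange_big (bigD1 k)//= [X in _ + X]big1 ?addr0.
    under eq_bigr do rewrite mulrA -rmorphM.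
    by rewrite -mulr_suml -rmorph_sum /= b1 eqxx mulr1 rmorph_nat.
  move=> j /negbTE jk; under eq_bigr do rewrite mulrA -rmorphM.
  by rewrite -mulr_suml -rmorph_sum /= b1 eq_sym jk mulr0 mul0r.
apply: (mulfI s0); rewrite -!E; apply: eq_bigr => v _; by rewrite ab.
Qed.

(* A solution of the component i written levelwise: F n, F1 n, F2 n are the data of F, F', F'' on
   I_n, for those levels n at which i has a mode. *)
Record mode_solution i (f g : cfun R) (F F1 F2 : nat -> cfun R) : Prop := ModeSolution {
  mode_H2 : forall n (p : mode A n), midx p = i ->
    H2 (tn A n) (tn A n.+1) f (F n) (F1 n) (F2 n) ;
  mode_eq : forall n (p : mode A n), midx p = i ->
    aeq (Iseg A n) g (fun x => - F2 n x) ;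
  mode_cont : forall n k, midx ((None, k) : mode A n) = i ->
    F n (tn A n.+1) = F n.+1 (tn A n.+1) ;
  mode_flux : forall n k, midx ((None, k) : mode A n) = i ->
    (sn A n)%:R * F1 n (tn A n.+1) = (sn A n.+2)%:R * F1 n.+1 (tn A n.+1) ;
  mode_right : forall n j k, midx ((Some j, k) : mode A n) = i -> F n (tn A n.+1) = 0 ;
  mode_left : forall n k l, midx ((k, Some l) : mode A n) = i -> F n (tn A n) = 0 ;
  mode_root : i = SLsym A -> F1 0%N (tn A 0) = 0
}.

(** The two modes coupled at S_(n+1) belong to the same component, so [mode_cont] and [mode_flux]
    are conditions inside one component. *)
Lemma midx_shift n k : midx ((None, k) : mode A n) = midx ((k, None) : mode A n.+1).
Proof. by case: n k => [|n] [k|]. Qed.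

Lemma midx_anti n k : midx ((None, Some k) : mode A n) = SLanti k.
Proof. by case: n k. Qed.

Lemma midx_sym n : midx ((None, None) : mode A n) = SLsym A.
Proof. by case: n. Qed.

Section FromAntitree.
Variables (f g : edge A -> cfun R).
Hypothesis fg : H0_antitree f g.

(** The sum has at most one term: it gives the data of the mode of index [i] on level [n], or 0 if
    there is none, without choosing a mode. *)
Definition mode_family i (F : edge A -> cfun R) n : cfun R :=
  fun x => \sum_(p : mode A n | midx p == i) uhat F p x.

Lemma mode_familyE F n (p : mode A n) : mode_family (midx p) F n = uhat F p.
Proof.
apply/funext => x; rewrite /mode_family (big_pred1 p)// => q.
by apply/eqP/eqP => [/midx_inj|->].
Qed.

Lemma mode_familyP i F n (p : mode A n) : midx p = i -> mode_family i F n = uhat F p.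
Proof. by move=> <-; exact: mode_familyE. Qed.

Lemma H2_uhat (F F1 F2 : edge A -> cfun R) n (p : mode A n) :
  (forall e, H2 (tn A (lvl e)) (tn A (lvl e).+1) (f e) (F e) (F1 e) (F2 e)) ->
  H2 (tn A n) (tn A n.+1) (Ut f (midx p)) (uhat F p) (uhat F1 p) (uhat F2 p).
Proof.
move=> h; have := @H2_lincomb R (espot A n) (tn A n) (tn A n.+1)
  (fun e => (acoef p e)%:C) _ _ _ _ (fun e => h (ed e)).
apply: H2_eq; apply: nearW => x; rewrite /= in_itv/= => /andP[h1 h2].
by rewrite Ut_Iseg// IsegE (ltW h1).
Qed.

Lemma H0_antitree_mode i : exists F F1 F2,
  mode_solution i (Ut f i) (Ut g i) F F1 F2 /\
  exists M, forall m, (M <= m)%N -> forall p : mode A m, midx p = i ->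
    forall x, tn A m <= x <= tn A m.+1 -> F m x = 0.
Proof.
case: fg => hf hg fin [F [F1 [F2 [HF cont flux gF]]]].
have contP n (v : sphere A n) : exists c, (forall u, F (ed (v, u)) (tn A n) = c) /\
    forall e, Eminus (vtx v) e -> F e (tn A n) = c.
  by have [c hc] := cont (vtx v); exists c; split=> [u|e he]; apply: hc; [left|right].
(* With common vertex values, the values on a level at [tn A n] depend only on the lower end of the
   edge, and those at [tn A n.+1] only on the upper end. *)
have [c hc] := choice (fun v : {n & sphere A n} => contP _ (tagged v)).
have outc n (v : sphere A n) u : lev F (tn A n) (v, u) = c (vtx v).
  by have [h _] := hc (vtx v); exact: (h u).
have inc n (v : sphere A n) (u : sphere A n.+1) : lev F (tn A n.+1) (v, u) = c (vtx u).
  by have [_ h] := hc (vtx u); exact: (h (ed (v, u))).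
have out n := hat_const_out (@outc n).
have in_ n := hat_const_in (@inc n).
have s0 n : (sn A n)%:R != 0 :> R[i] by rewrite pnatr_eq0 -lt0n sn_gt0.
exists (mode_family i F), (mode_family i F1), (mode_family i F2); split.
  split.
  - by move=> n p <-; rewrite !mode_familyE; exact: H2_uhat.
  - move=> n p <-; rewrite mode_familyE.
    have H : {ae (@lebesgue_measure R), forall x, Iseg A n x -> forall e : espot A n,
        g (ed e) x = - F2 (ed e) x}.
      by apply/ae_all_edges => e; exact: (gF (ed e)).
    apply: filterS H => x H hx; rewrite Ut_Iseg// /uhat -sumrN; apply: eq_bigr => e _.
    by rewrite H// mulrN.
  - move=> n k e; have e' := e; rewrite midx_shift in e'.
    rewrite (mode_familyP F e) (mode_familyP F e') !uhat_hat.
    have [_ ->] := in_ n; have [_ ->] := out n.+1; by [].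
  - move=> n k e; have e' := e; rewrite midx_shift in e'.
    rewrite (mode_familyP F1 e) (mode_familyP F1 e') !uhat_hat.
    pose z := lev F1 (tn A n.+1) : espot A n -> R[i].
    pose z' := lev F1 (tn A n.+1) : espot A n.+1 -> R[i].
    (* Kirchhoff condition at [v] in S_(n+1), with all derivatives taken in the direction of
       increasing t; expanding the outgoing and the incoming sum yields the factors s_(n+2) and
       s_n. *)
    have key v : \sum_u z' (v, u) = \sum_w z (w, v).
      have := flux (vtx v); rewrite fsbig_Eplus fsbig_Eminus sumrN => /eqP.
      by rewrite subr_eq0 => /eqP.
    have key2 v : (sn A n.+2)%:R * \sum_j (sbasis j v)%:C * hat z' (j, None) =
        (sn A n)%:R * \sum_j (sbasis j v)%:C * hat z (None, j).
      by rewrite -hat_out -hat_in key.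
    have := sbasis_coords (a := fun j => (sn A n.+2)%:R * hat z' (j, None))
      (b := fun j => (sn A n)%:R * hat z (None, j)); move=> -> // v.
    transitivity ((sn A n.+2)%:R * \sum_j (sbasis j v)%:C * hat z' (j, None)).
      by rewrite mulr_sumr; apply: eq_bigr => j _; rewrite mulrCA.
    by rewrite key2 mulr_sumr; apply: eq_bigr => j _; rewrite mulrCA.
  - move=> n j k <-; rewrite mode_familyE uhat_hat; have [-> //] := in_ n.
  - move=> n k l <-; rewrite mode_familyE uhat_hat; have [-> //] := out n.
  - move=> ->; rewrite -(midx_sym 0) mode_familyE uhat_hat.
    (* The root has no incoming edges, so its condition makes the total over level 0 vanish, and
       this total is a nonzero multiple of the radial coefficient. *)
    have := hat_total (lev F1 (tn A 0) : espot A 0 -> R[i]).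
    have -> : \sum_e (lev F1 (tn A 0) : espot A 0 -> R[i]) e =
        \sum_v \sum_u lev F1 (tn A 0) ((v, u) : espot A 0).
      by rewrite pair_bigA; apply: eq_bigr => -[].
    rewrite big1; last first.
      by move=> v _; have := flux (vtx v); rewrite fsbig_Eplus fsbig_Eminus_root addr0.
    by move=> /esym/eqP; rewrite mulf_eq0 eq_complex /= eqxx andbT gt_eqF ?ssize_gt0//= => /eqP.
have [s Es] : exists s : seq (edge A),
    [set e | ~ aeq (Iseg A (lvl e)) (f e) (cst 0)] = [set` s] by apply/finite_seqP.
(* Above the levels of the finitely many edges on which [f] is not null, [F] is 0 at every point of
   the closed segments. *)
exists (\max_(e <- s) (lvl e).+1)%N => m Mm p <- x xm; rewrite mode_familyE /uhat.
rewrite big1// => e _; rewrite (_ : F _ _ = 0) ?mulr0//.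
have [fF aF _ _] := HF (ed e).
apply: (abscont_ae0 (tn_lt A m) aF) xm.
apply: aeq_trans (aeq_sym fF) _; apply: aeq_itv.
apply: aeqS (_ : aeq (Iseg A m) _ _); first by apply: subset_itv; rewrite bnd_simp.
apply: contrapT => ne; have : [set` s] (ed e) by rewrite -Es.
move=> /= es; move: Mm; rewrite leqNgt => /negP; apply.
exact: (@leq_bigmax_seq _ s xpredT (fun e => (lvl e).+1) (ed e) es isT).
Qed.

End FromAntitree.
End ModeSolutions.

(** * From mode solutions back to the antitree *)

Section AntitreeFromModes.
Context {R : realType} (A : antitree R).
Implicit Types (n m : nat) (x : R) (i : sl_index A).

Lemma hat_scoef n (y : mode A n -> R[i]) p :
  hat (fun e => \sum_q (scoef q e)%:C * y q) p = y p.
Proof.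
rewrite /hat; under eq_bigr do rewrite mulr_sumr.
rewrite exchange_big /= (bigD1 p)//= [X in _ + X]big1 ?addr0.
  under eq_bigr do rewrite mulrA -rmorphM.
  by rewrite -mulr_suml -rmorph_sum /= acoef_scoef eqxx mul1r.
move=> q /negbTE ne; under eq_bigr do rewrite mulrA -rmorphM.
by rewrite -mulr_suml -rmorph_sum /= acoef_scoef eq_sym ne mul0r.
Qed.

Lemma finite_levels M : finite_set [set e : edge A | (lvl e < M)%N].
Proof.
have -> : [set e : edge A | (lvl e < M)%N] =
    \bigcup_(n in [set n | (n < M)%N]) (@ed R A n @` [set: espot A n]).
  apply/seteqP; split => [[n e] /= nM|e [n /= nM [e' _ <-]]//].
  by exists n => //; exists e.
apply: bigcup_finite; first exact: finite_II.
by move=> n _; apply: finite_image; exact: finite_finType.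
Qed.

Lemma H0_antitree_of_modes (h k : sl_index A -> cfun R) (F F1 F2 : sl_index A -> nat -> cfun R)
    (M : nat) :
  hmem (L2A A) (Vt h) -> hmem (L2A A) (Vt k) ->
  (forall i, mode_solution i (h i) (k i) (F i) (F1 i) (F2 i)) ->
  (forall m, (M <= m)%N -> forall p : mode A m, aeq (Iseg A m) (h (midx p)) (cst 0)) ->
  H0_antitree (Vt h) (Vt k).
Proof.
move=> hh hk sol van.
pose syn (G : sl_index A -> nat -> cfun R) : edge A -> cfun R := fun e x =>
  \sum_(p : mode A (lvl e)) (scoef p (tagged e : espot A (lvl e)))%:C * G (midx p) (lvl e) x.
have hatG G n x (p : mode A n) : hat (lev (syn G) x) p = G (midx p) n x.
  exact: (hat_scoef (fun q : mode A n => G (midx q) n x)).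
(* [mode_left] removes the nonconstant second factors at the lower ends; [mode_right] does the same
   for the first factors at the upper ends. *)
have out n v u : lev (syn F) (tn A n) ((v, u) : espot A n) =
    \sum_j (sbasis j v)%:C * F (midx ((j, None) : mode A n)) n (tn A n).
  rewrite const_outP => [|j l]; last by rewrite hatG; exact: (mode_left (sol _) erefl).
  by apply: eq_bigr => j _; rewrite hatG.
have inn n v u : lev (syn F) (tn A n.+1) ((v, u) : espot A n) =
    \sum_j (sbasis j u)%:C * F (midx ((j, None) : mode A n.+1)) n.+1 (tn A n.+1).
  rewrite const_inP => [|j l]; last by rewrite hatG; exact: (mode_right (sol _) erefl).
  (* By [mode_cont] the value from below takes the form that [out] gives from above, which is
     continuity at the vertex. *)
  apply: eq_bigr => j _; rewrite hatG -midx_shift.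
  by rewrite (mode_cont (sol _) (n := n) (k := j) erefl).
split => //.
- apply: sub_finite_set (finite_levels M) => e /= ne; rewrite ltnNge; apply/negP => Me.
  apply: ne; rewrite /aeq; have H : {ae (@lebesgue_measure R), forall x, Iseg A (lvl e) x ->
      forall p : mode A (lvl e), h (midx p) x = 0}.
    apply: filterS (ae_finType (fun p : mode A (lvl e) => van _ Me p)) => x H hx p.
    exact: H.
  by apply: filterS H => x H hx; rewrite /Vt big1// => p _; rewrite H ?mulr0.
exists (syn F), (syn F1), (syn F2); split.
- move=> [n e]; apply: (@H2_lincomb R (mode A n) _ _ (fun p => (scoef p e)%:C)) => p.
  exact: (mode_H2 (sol _) erefl).
- move=> [n v]; exists (\sum_j (sbasis j v)%:C * F (midx ((j, None) : mode A n)) n (tn A n)).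
  move=> e [/Eplus_ed[u ->]|]; first exact: (out n v u).
  case: n v => [|n] v; first by move=> /Eminus_root.
  by move=> /Eminus_ed[w ->]; exact: (inn n w v).
- move=> [n v]; rewrite fsbig_Eplus.
  have -> : \sum_u syn F1 (ed (v, u)) (tn A n) =
      (sn A n.+1)%:R * \sum_j (sbasis j v)%:C * F1 (midx ((j, None) : mode A n)) n (tn A n).
    have := hat_out (lev (syn F1) (tn A n) : espot A n -> R[i]) v.
    by under [X in _ = _ * X -> _]eq_bigr do rewrite hatG.
  case: n v => [|n] v.
    rewrite fsbig_Eminus_root addr0 big1 ?mulr0// => j _.
    have /= -> := mode0 ((j, None) : mode A 0).
    by rewrite (mode_root (sol (SLsym A)))// mulr0.
  rewrite fsbig_Eminus sumrN.
  have -> : \sum_w syn F1 (ed ((w, v) : espot A n)) (tn A n.+1) =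
      (sn A n)%:R * \sum_j (sbasis j v)%:C * F1 (midx ((None, j) : mode A n)) n (tn A n.+1).
    have := hat_in (lev (syn F1) (tn A n.+1) : espot A n -> R[i]) v.
    by under [X in _ = _ * X -> _]eq_bigr do rewrite hatG.
  apply/eqP; rewrite subr_eq0 !mulr_sumr; apply/eqP/eq_bigr => j _.
  rewrite mulrCA [RHS]mulrCA; congr (_ * _).
  by rewrite (mode_flux (sol _) (n := n) (k := j) erefl) midx_shift.
- move=> [n e].
  have H : {ae (@lebesgue_measure R), forall x, forall p : mode A n, Iseg A n x ->
      k (midx p) x = - F2 (midx p) n x}.
    by apply: ae_finType => p; exact: (mode_eq (sol _) erefl).
  apply: filterS H => x H hx; rewrite /Vt /syn -sumrN; apply: eq_bigr => p _.
  by rewrite H// mulrN.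
Qed.

End AntitreeFromModes.

(** * Mode solutions and the Sturm-Liouville operators *)

Section ComponentOperators.
Context {R : realType} (A : antitree R).
Implicit Types (n m : nat) (x : R) (i : sl_index A) (f g : cfun R).

Lemma neq_succ n : n.+1 <> n. Proof. by move=> /eqP; rewrite eqn_leq ltnn. Qed.

Definition vanishes_far i f := exists M, forall m, (M <= m)%N ->
  forall p : mode A m, midx p = i -> aeq (Iseg A m) f (cst 0).

Lemma abscontZ a b (c : R[i]) f f1 : abscont a b f f1 -> abscont a b (c *: f) (c *: f1).
Proof. by move=> h; have := abscontL c h (abscont0 a b); rewrite !addr0. Qed.

Lemma h_edge_of_mode n q f g F F1 F2 : mode_solution (@SLzero R A n q) f g F F1 F2 ->
  hmem (L2 (Iseg A n.+1) (cst 1)) f -> hmem (L2 (Iseg A n.+1) (cst 1)) g ->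
  h_edge A n.+1 f g.
Proof.
move=> sol hf hg; split=> //; exists (F n.+1), (F1 n.+1), (F2 n.+1).
case/mxvec_indexP: q sol => j l sol; have e : midx ((Some j, Some l) : mode A n.+1) =
  SLzero (mxvec_index j l) by [].
split; [exact: (mode_H2 sol e)|exact: (mode_left sol e)|exact: (mode_right sol e)|].
exact: (mode_eq sol e).
Qed.

Lemma mode_of_h_edge n q f g : h_edge A n.+1 f g -> exists F F1 F2,
  mode_solution (@SLzero R A n q) f g F F1 F2.
Proof.
move=> [hf hg [F [F1 [F2 [HF Fa Fb gF]]]]].
(* This component has a mode on level [n.+1] only, so the same data can be given on every level. *)
exists (fun=> F), (fun=> F1), (fun=> F2).
have lv m (p : mode A m) : midx p = SLzero q -> m = n.+1.
  by move=> /(congr1 (@sl_component R A)); exact: component_zero.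
have no m k : midx ((None, k) : mode A m) <> SLzero q.
  by move=> /(congr1 (@sl_component R A)); rewrite sl_component_mode; case: k.
split.
- by move=> m p /lv ->.
- by move=> m p /lv ->.
- by move=> m k /no.
- by move=> m k /no.
- by move=> m j k /lv ->.
- by move=> m k l /lv ->.
- by [].
Qed.

Lemma h_vertex_of_mode n k f g F F1 F2 : mode_solution (@SLanti R A n k) f g F F1 F2 ->
  hmem (L2 (I_vertex A n.+1) (weight A)) f -> hmem (L2 (I_vertex A n.+1) (weight A)) g ->
  h_vertex A n.+1 f g.
Proof.
move=> sol hf hg; split=> //.
have e1 := midx_anti k; have e2 : midx ((Some k, None) : mode A n.+1) = SLanti k by [].
exists (F n), (F1 n), (F2 n), (F n.+1), (F1 n.+1), (F2 n.+1); split.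
- by split; [exact: (mode_H2 sol e1)|exact: (mode_H2 sol e2)].
- by split; [exact: (mode_left sol e1)|exact: (mode_right sol e2)].
- exact: (mode_cont sol e1).
- exact: (mode_flux sol e1).
- by split; [exact: (mode_eq sol e1)|exact: (mode_eq sol e2)].
Qed.

Lemma mode_of_h_vertex n k f g : h_vertex A n.+1 f g -> exists F F1 F2,
  mode_solution (@SLanti R A n k) f g F F1 F2.
Proof.
move=> [hf hg [F [F1 [F2 [G [G1 [G2 [[HF HG] [Fa Gb] Ft F1t [gF gG]]]]]]]]].
(* Only the levels [n] and [n.+1] carry a mode of this index; elsewhere the value of [sel] is a
   default. *)
pose sel (u v : cfun R) m := if m == n then u else v.
have seln u v : sel u v n = u by rewrite /sel eqxx.
have selS u v : sel u v n.+1 = v by rewrite /sel; case: eqP => // /neq_succ.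
exists (sel F G), (sel F1 G1), (sel F2 G2).
have lv m (p : mode A m) : midx p = SLanti k ->
    (m = n /\ p.1 = None) \/ (m = n.+1 /\ p.2 = None).
  by move=> /(congr1 (@sl_component R A)); exact: component_anti.
have noN m : midx ((None, None) : mode A m) <> SLanti k by rewrite midx_sym.
split.
- move=> m p /lv[[e _]|[e _]]; subst m; first by rewrite !seln.
  by rewrite !selS.
- move=> m p /lv[[e _]|[e _]]; subst m; first by rewrite !seln.
  by rewrite !selS.
- move=> m [l|/noN//] /lv[[e _]|[e //]]; subst m; by rewrite seln selS.
- move=> m [l|/noN//] /lv[[e _]|[e //]]; subst m; by rewrite seln selS.
- by move=> m j l /lv[[e //]|[e _]]; subst m; rewrite selS.
- by move=> m l j /lv[[e _]|[e //]]; subst m; rewrite seln.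
- by [].
Qed.

Lemma vanishes_far_zero n q f : vanishes_far (@SLzero R A n q) f.
Proof.
exists n.+2 => m nm p /(congr1 (@sl_component R A)) /component_zero e.
by move: nm; rewrite e ltnn.
Qed.

Lemma vanishes_far_anti n k f : vanishes_far (@SLanti R A n k) f.
Proof.
exists n.+2 => m nm p /(congr1 (@sl_component R A)) /component_anti[[e _]|[e _]].
  by move: nm; rewrite e ltnNge leqnSn.
by move: nm; rewrite e ltnn.
Qed.

Lemma mode_sym_inv m (p : mode A m) : midx p = SLsym A -> p = (None, None).
Proof. by rewrite -(midx_sym A m) => /midx_inj. Qed.

Lemma sub_interval0L n : `[tn A n, tn A n.+1] `<=` interval0L A.
Proof.
move=> x; rewrite /= in_itv/= => /andP[h1 h2].
split; first exact: le_trans (tn_ge0 A n) h1.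
by apply: (@tn_totlen _ _ n.+2); exact: le_lt_trans h2 (tn_lt A n.+1).
Qed.

Lemma H0_line_of_mode f g F F1 F2 : mode_solution (SLsym A) f g F F1 F2 ->
  hmem (L2 (interval0L A) (weight A)) f -> hmem (L2 (interval0L A) (weight A)) g ->
  (exists M, forall m, (M <= m)%N -> forall x, tn A m <= x <= tn A m.+1 -> F m x = 0) ->
  H0_line A f g.
Proof.
move=> sol hf hg [M FM]; split => //.
have e n := midx_sym A n.
have H2n n := mode_H2 sol (e n).
(* On level [n] the weight is the constant [ssize A n], so [P] and [Q] represent mu F' and its
   derivative. *)
pose Q n : cfun R := (ssize A n)%:C *: F2 n.
pose P n : cfun R := (ssize A n)%:C *: F1 n.
have aF := abscont_glue (fun n => let: And4 _ h _ _ := H2n n in h)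
  (fun n => mode_cont sol (e n)).
have aP : forall b, interval0L A b -> abscont 0 b (level_glue A P) (level_glue A Q).
  apply: abscont_glue => n; first by apply: abscontZ; have [] := H2n n.
  (* Multiplied by s_(n+1), the flux condition is the continuity of mu F' at t_(n+1). *)
  have h := mode_flux sol (e n).
  change ((ssize A n)%:C * F1 n (tn A n.+1) = (ssize A n.+1)%:C * F1 n.+1 (tn A n.+1)).
  rewrite /ssize !rmorph_nat [in LHS]natrM mulrAC h [in RHS]natrM; ring.
exists (level_glue A F), (level_glue A F1), (level_glue A Q); split.
- have H : {ae (@lebesgue_measure R), forall x, forall n, Iseg A n x -> f x = F n x}.
    apply/ae_foralln => n; have [fF _ _ _] := H2n n.
    by apply: aeqS fF; apply: subset_itv; rewrite bnd_simp.
  by apply: filterS H => x H /interval0LP[n hx]; rewrite (level_glueE _ hx) (H n).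
- exists (tn A M); first by apply/interval0LP; exists M; exact: Iseg_left.
  move=> x /interval0LP[m hx] Mx; rewrite (level_glueE _ hx).
  move: hx; rewrite IsegE => /andP[h1 h2]; apply: FM; last by rewrite h1 ltW.
  rewrite leqNgt; apply/negP => mM.
  have := lt_le_trans (lt_trans Mx h2) (tn_mono A mM); by rewrite ltxx.
- move=> b b0L; split; first exact: aF.
  have [b0 bL] := b0L.
  apply: (abscont_eq b0 (aP b b0L)).
  + move=> x /andP[x0 xb].
    have /interval0LP[n hx] : interval0L A x.
      by split => //; apply: le_lt_trans bL; rewrite lee_fin.
    by rewrite !(level_glueE _ hx) (weight_Iseg hx).
  + exact: nearW.
  + exact: cintegrable_measurable (aP b b0L).1.
- have h0 : Iseg A 0 0 by rewrite -[X in Iseg _ _ X](tn0 A); exact: Iseg_left.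
  by rewrite (level_glueE _ h0) -[X in F1 _ X](tn0 A) (mode_root sol).
- have H : {ae (@lebesgue_measure R), forall x, forall n, Iseg A n x -> g x = - F2 n x}.
    by apply/ae_foralln => n; exact: (mode_eq sol (e n)).
  apply: filterS H => x H /interval0LP[n hx].
  rewrite (level_glueE _ hx) (H n)// (weight_Iseg hx) -/(ssize A n).
  change (- F2 n x = - ((ssize A n)^-1)%:C * ((ssize A n)%:C * F2 n x)).
  by rewrite mulNr mulrA -rmorphM mulVf ?gt_eqF ?ssize_gt0// rmorph1 mul1r.
Qed.

Lemma mode_of_H0_line f g : H0_line A f g -> (exists F F1 F2,
  mode_solution (SLsym A) f g F F1 F2) /\ vanishes_far (SLsym A) f.
Proof.
move=> [hf hg [F [F1 [Q [fF [b bL Fb] aF F10 gQ]]]]].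
have ml := measurable_interval0L A; have mw := @measurable_weight R A.
have w1 := @weight_ge1 R A.
pose P : cfun R := fun x => (weight A x)%:C * F1 x.
(* At t_(n+1) the value of [F1] belongs to the next level, where the weight may have jumped.
   Dividing the continuous mu F' by the weight of level [n] gives the derivative on the whole closed
   segment, including its right end. *)
pose Fn n : cfun R := ((ssize A n)^-1)%:C *: P.
pose Qn n : cfun R := ((ssize A n)^-1)%:C *: Q.
have bn n : interval0L A (tn A n) by apply/interval0LP; exists n; exact: Iseg_left.
have s0 n : (ssize A n)%:C != 0 :> R[i].
  by rewrite eq_complex /= eqxx andbT gt_eqF ?ssize_gt0.
have Fn1 n x : Iseg A n x -> Fn n x = F1 x.
  move=> hx; change (((ssize A n)^-1)%:C * ((weight A x)%:C * F1 x) = F1 x).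
  by rewrite (weight_Iseg hx) mulrA -rmorphM mulVf ?rmorph1 ?mul1r// gt_eqF ?ssize_gt0.
have aFn n : abscont (tn A n) (tn A n.+1) (Fn n) (Qn n).
  by apply: abscontZ; apply: abscontS (aF _ (bn n.+1)).2 => //; exact: tn_ge0.
have gQn n : aeq (Iseg A n) g (fun x => - Qn n x).
  apply: filterS gQ => x gQ hx; rewrite gQ; last by apply/interval0LP; exists n.
  by rewrite (weight_Iseg hx) mulNr.
split; last first.
  have /interval0LP[N hN] := bL; exists N.+1 => m Nm p _.
  apply: filterS fF => x fF hx; rewrite fF; last by apply/interval0LP; exists m.
  apply: Fb; first by apply/interval0LP; exists m.
  move: hN hx; rewrite !IsegE => /andP[_ h1] /andP[h2 _].
  exact: lt_le_trans h1 (le_trans (tn_mono A Nm) h2).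
exists (fun=> F), Fn, Qn; split.
- move=> n p _; split.
  + by apply: aeqS fF; exact: sub_interval0L.
  + have a0 : abscont (tn A n) (tn A n.+1) F F1.
      by apply: abscontS (aF _ (bn n.+1)).1 => //; exact: tn_ge0.
    apply: (abscont_eq (ltW (tn_lt A n)) a0) => //.
      apply: aeq_itv; apply: nearW => x; rewrite /= in_itv/= => /andP[h1 h2].
      by rewrite Fn1// IsegE (ltW h1).
    exact: (abscont_L2c (ltW (tn_lt A n)) (aFn n)).1.
  + exact: aFn.
  + have [hg' _] : hmem (L2 `[tn A n, tn A n.+1] (cst 1)) g /\
        hsq (L2 `[tn A n, tn A n.+1] (cst 1)) g <= hsq (L2 (interval0L A) (weight A)) g.
      apply: L2_restrict => //.
      - by move=> x /w1; exact: le_trans.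
      - apply: subset_trans (@sub_interval0L n); by apply: subset_itv; rewrite bnd_simp.
      - move=> x /andP[h1 h2]; apply: w1; apply/interval0LP; exists n.
        by rewrite IsegE (ltW h1).
    apply: (hmem_L2c_ae _ _ (hmemN (semihilbert_L2c _ _) hg')).
      exact: cintegrable_measurable (aFn n).1.
    apply: aeq_itv; apply: filterS (gQn n) => x gx xo.
    rewrite fctE gx ?opprK//; move: xo; rewrite /= in_itv/= => /andP[h1 h2].
    by rewrite IsegE (ltW h1).
- by move=> n p _; exact: gQn.
- by [].
- move=> n k _.
  change ((sn A n)%:R * (((ssize A n)^-1)%:C * P (tn A n.+1)) =
    (sn A n.+2)%:R * (((ssize A n.+1)^-1)%:C * P (tn A n.+1))).
  rewrite !fmorphV /ssize !rmorph_nat !natrM; field.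
  by rewrite !pnatr_eq0 -!lt0n !sn_gt0.
- by move=> n j k /mode_sym_inv.
- by move=> n k l /mode_sym_inv.
- move=> _; change (((ssize A 0)^-1)%:C * ((weight A (tn A 0))%:C * F1 (tn A 0)) = 0).
  by rewrite tn0 F10 !mulr0.
Qed.

End ComponentOperators.

(** * Equivalence of the closures *)

Section Equivalence.
Context {R : realType} (A : antitree R).
Implicit Types (f g : edge A -> cfun R) (h : sl_index A -> cfun R) (i : sl_index A).

Local Notation X := (L2A A).
Local Notation Y := (sl_sum_space A).

Lemma hsq_sl_sumE h : hsq Y h = fine (\esum_(i in [set: sl_index A])
  (hsq (sl_space i) (h i))%:E)%E.
Proof. by apply: hsq_hsumE => i; exact: semihilbert_sl. Qed.

Lemma hsq_component_le h i : hmem Y h -> hsq (sl_space i) (h i) <= hsq Y h.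
Proof.
move=> hh; rewrite -lee_fin hsq_hsum_EFin//; last by move=> j; exact: semihilbert_sl.
by apply: esum_ge; exists [set i]; [split => //; exact: finite_set1|rewrite fsbig_set1].
Qed.

Lemma hsq_sl_dom h h' : (forall i x, sl_dom i x -> h i x = h' i x) -> hsq Y h = hsq Y h'.
Proof.
move=> hh'; rewrite !hsq_sl_sumE; congr fine; apply: eq_esum => i _; congr EFin.
rewrite sl_spaceE !hsq_L2E; apply: eq_Rintegral => x /set_mem Dx; by rewrite hh'.
Qed.

(** The radial coordinate is placed in the pre-minimal operator and not just in its closure, so that
    closing once in [kirchhoff_sl] gives [H_line]. *)
Lemma H0_antitree_sl f g i : H0_antitree f g ->
  if i is SLsym then H0_line A (Ut f i) (Ut g i) else sl_op i (Ut f i) (Ut g i).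
Proof.
move=> fg; have [F [F1 [F2 [sol van]]]] := H0_antitree_mode fg i.
have [hf hg _ _] := fg; have hUf := (hmem_Ut hf).1 i; have hUg := (hmem_Ut hg).1 i.
case: i sol van hUf hUg => [|n q|n k] sol van hUf hUg.
- apply: (H0_line_of_mode sol) => //; have [M hM] := van; exists M => m Mm.
  exact: (hM m Mm _ (midx_sym A m)).
- exact: h_edge_of_mode sol hUf hUg.
- exact: h_vertex_of_mode sol hUf hUg.
Qed.

Lemma kirchhoff_sl f g : kirchhoff A f g -> sl_sum_op A (Ut f) (Ut g).
Proof.
move=> [hf hg cl]; have HX := semihilbert_L2A A.
split; [exact: hmem_Ut|exact: hmem_Ut|move=> i].
have hUf := (hmem_Ut hf).1 i; have hUg := (hmem_Ut hg).1 i.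
have close u u' eps : hmem X u -> hmem X u' -> 0 < eps -> hnorm X (u - u') < eps ->
    hnorm (sl_space i) (Ut u i - Ut u' i) < eps.
  move=> hu hu' e0; rewrite !hnorm_lt//; apply: le_lt_trans.
  have hB := hmemB HX hu hu'; rewrite -(hsq_Ut hB) UtB.
  have := hsq_component_le i (hmem_Ut hB); rewrite UtB; exact.
(* Each coordinate of [Ut] is norm-nonincreasing, so approximating pairs are carried to
   approximating pairs. *)
have cl' : op_closure (sl_space i)
    (fun u v => if i is SLsym then H0_line A u v else sl_op i u v) (Ut f i) (Ut g i).
  split=> // eps e0; have [f' [g' [fg' ff gg]]] := cl eps e0.
  have [hf' hg' _ _] := fg'.
  exists (Ut f' i), (Ut g' i); split.
  - exact: (H0_antitree_sl i fg').
  - exact: (close f f' eps hf hf' e0 ff).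
  - exact: (close g g' eps hg hg' e0 gg).
case: i cl' {hUf hUg close} => [|n q|n k] cl'.
- exact: cl'.
- exact: h_edge_closed cl'.
- exact: h_vertex_closed cl'.
Qed.

(** The approximant in the domain of the sum: [r] is a truncation set, and [p] will be a pre-minimal
    element close to the radial coordinate. *)
Definition replace_sym (r : seq (sl_index A)) (p : cfun R) h : sl_index A -> cfun R :=
  fun i => if i == SLsym A then p else if i \in r then h i else 0.

Lemma hsq_replace_sym r p h : hmem Y h -> hmem (sl_space (SLsym A)) p ->
  hmem Y (replace_sym r p h) /\
  hsq Y (h - replace_sym r p h) <= hsq (sl_space (SLsym A)) (h (SLsym A) - p) +
    fine (\esum_(i in [set: sl_index A]) (if i \in r then 0 else hsq (sl_space i) (h i))%:E)%E.
Proof.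
move=> hh hp.
have H0 i u : 0 <= hsq (sl_space i) u := hsq_ge0 (semihilbert_sl i) u.
(* A single coordinate as a summable family, so that the radial error and the tail can be added
   termwise. *)
have only (c : R) : 0 <= c -> (\esum_(i in [set: sl_index A])
    (if i == SLsym A then c else 0)%:E = c%:E)%E.
  move=> c0; rewrite (@esum_image_finType _ _ unit (fun=> SLsym A))//=.
  - by rewrite (big_pred1 tt) ?eqxx// => -[].
  - by case=> [[]].
  - by move=> i; rewrite lee_fin; case: ifP.
  - by move=> i no; case: eqP => // e; case: (no tt).
have fh := hh.2.
have tail0 i : 0 <= (if i \in r then 0 else hsq (sl_space i) (h i)) by case: ifP.
have ftail : (\esum_(i in [set: sl_index A])
    (if i \in r then 0 else hsq (sl_space i) (h i))%:E < +oo)%E.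
  by apply: le_lt_trans fh; apply: le_esum => i _; rewrite lee_fin; case: ifP => // _; exact: H0.
have hr : hmem Y (replace_sym r p h).
  split.
    move=> i; rewrite /replace_sym; case: eqP => [->//|_]; case: ifP => _; first exact: hh.1.
    exact: hmem0 (semihilbert_sl i).
  have : (\esum_(i in [set: sl_index A])
      ((if i == SLsym A then hsq (sl_space (SLsym A)) p else 0)%:E +
       (hsq (sl_space i) (h i))%:E) < +oo)%E.
    rewrite esumD => [|i _|i _]; last 2 first.
    - by rewrite lee_fin; case: ifP => // _; exact: H0.
    - by rewrite lee_fin; exact: H0.
    by rewrite only//; apply: lte_add_pinfty; rewrite ?ltry.
  apply: le_lt_trans; apply: le_esum => i _; rewrite -EFinD lee_fin -/(hsq _ _) /replace_sym.
  case: eqP => [->|_]; first by rewrite lerDl H0.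
  by rewrite add0r; case: ifP => // _; rewrite (hsq0 (semihilbert_sl i)) H0.
have hB := hmemB (semihilbert_sl_sum A) hh hr; split; first exact: hr.
rewrite -lee_fin (hsq_hsum_EFin (@semihilbert_sl R A) hB) EFinD.
rewrite (fineK (esum_fin_num tail0 ftail)) -(only _ (H0 (SLsym A) (h (SLsym A) - p))).
rewrite -esumD => [|i _|i _]; last 2 first.
- by rewrite lee_fin; case: ifP => // _; exact: H0.
- by rewrite lee_fin.
apply: le_esum => i _; rewrite -EFinD lee_fin.
change (hsq (sl_space i) (h i - replace_sym r p h i) <=
  (if i == SLsym A then hsq (sl_space (SLsym A)) (h (SLsym A) - p) else 0) +
  (if i \in r then 0 else hsq (sl_space i) (h i))).
rewrite /replace_sym; case: eqP => [->|_]; first by rewrite lerDl.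
by rewrite add0r; case: ifP => _; rewrite ?subrr ?(hsq0 (semihilbert_sl i)) ?subr0.
Qed.

Lemma mode_solution0 i : mode_solution i 0 0 (fun=> 0) (fun=> 0) (fun=> 0).
Proof.
have H0 a b : H2 a b (0 : cfun R) 0 0 0.
  split; [exact: nearW|exact: abscont0|exact: abscont0|].
  exact: hmem0 (semihilbert_L2c _ _).
split=> // [n p _|n k _]; first by apply: nearW => x _; rewrite oppr0.
  exact: etrans (mulr0 _) (esym (mulr0 _)).
Qed.

Lemma sl_op_mode i (f g : cfun R) : i != SLsym A -> sl_op i f g ->
  (exists F F1 F2, mode_solution i f g F F1 F2) /\ vanishes_far i f.
Proof.
case: i => [|n q|n k]; first by rewrite eqxx.
- move=> _ fg; split; [exact: (mode_of_h_edge q fg)|exact: vanishes_far_zero].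
- move=> _ fg; split; [exact: (mode_of_h_vertex k fg)|exact: vanishes_far_anti].
Qed.

Lemma sl_kirchhoff f g : hmem X f -> hmem X g -> sl_sum_op A (Ut f) (Ut g) -> kirchhoff A f g.
Proof.
move=> hf hg [hUf hUg fg]; split => // eps e0.
have HX := semihilbert_L2A A; have HS := @semihilbert_sl R A.
(* The squared error is a radial part plus a tail; each gets half of [eps ^+ 2]. *)
pose d := eps ^+ 2 / 2; have d0 : 0 < d by rewrite divr_gt0 ?exprn_gt0.
have e'0 : 0 < Num.sqrt d by rewrite sqrtr_gt0.
have tail u : hmem Y u -> exists r : seq (sl_index A), (\esum_(i in [set: sl_index A])
    (if i \in r then 0 else hsq (sl_space i) (u i))%:E < d%:E)%E.
  by move=> hu; apply: esum_tail => //; [move=> i; exact: hsq_ge0 (HS i) _|exact: hu.2].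
have [r1 tf] := tail _ hUf; have [r2 tg] := tail _ hUg.
(* The same coordinates are kept for [f] and for [g], so that the two approximants still form a pair
   in every component. *)
pose r := r1 ++ r2.
have {tail} sub u r' : {subset r' <= r} -> (\esum_(i in [set: sl_index A])
    (if i \in r' then 0 else hsq (sl_space i) (u i))%:E < d%:E)%E ->
    fine (\esum_(i in [set: sl_index A])
    (if i \in r then 0 else hsq (sl_space i) (u i))%:E)%E < d.
  move=> r'r t; rewrite -lte_fin fineK.
    apply: le_lt_trans t; apply: le_esum => i _; rewrite lee_fin.
    case: (boolP (i \in r')) => [/r'r -> //|_]; case: ifP => // _; exact: hsq_ge0 (HS i) _.
  apply: esum_fin_num => [i|]; first by case: ifP => // _; exact: hsq_ge0 (HS i) _.
  apply: lt_trans (ltry d); apply: le_lt_trans t; apply: le_esum => i _; rewrite lee_fin.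
  case: (boolP (i \in r')) => [/r'r -> //|_]; case: ifP => // _; exact: hsq_ge0 (HS i) _.
have {}tf : fine (\esum_(i in [set: sl_index A])
    (if i \in r then 0 else hsq (sl_space i) (Ut f i))%:E)%E < d.
  by apply: sub tf => i ir; rewrite mem_cat ir.
have {sub}tg : fine (\esum_(i in [set: sl_index A])
    (if i \in r then 0 else hsq (sl_space i) (Ut g i))%:E)%E < d.
  by apply: sub tg => i ir; rewrite mem_cat ir orbT.
have [_ _ cl] : H_line A (Ut f (SLsym A)) (Ut g (SLsym A)) by exact: (fg (SLsym A)).
have [p [q [pq fp gq]]] := cl _ e'0.
have [hp hq _] := pq.
have [[G [G1 [G2 solp]]] [Mp vanp]] := mode_of_H0_line pq.
have close u v : hmem X u -> hmem (sl_space (SLsym A)) v ->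
    fine (\esum_(i in [set: sl_index A])
      (if i \in r then 0 else hsq (sl_space i) (Ut u i))%:E)%E < d ->
    hnorm (sl_space (SLsym A)) (Ut u (SLsym A) - v) < Num.sqrt d ->
    hmem X (Vt (replace_sym r v (Ut u))) /\
    hnorm X (u - Vt (replace_sym r v (Ut u))) < eps.
  move=> hu hv tu uv0.
  have uv : hsq (sl_space (SLsym A)) (Ut u (SLsym A) - v) < d.
    by rewrite -(sqr_sqrtr (ltW d0)) -(hnorm_lt (sl_space (SLsym A)) (Ut u (SLsym A) - v) e'0).
  have [hr le] := hsq_replace_sym r (hmem_Ut hu) hv.
  have hV := hmem_Vt hr; split => //.
  have hB := hmemB HX hu hV.
  rewrite (hnorm_lt _ _ e0) -(hsq_Ut hB) UtB.
  rewrite (@hsq_sl_dom _ (Ut u - replace_sym r v (Ut u))) => [|i x Dx]; last first.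
    by rewrite !fctE Ut_Vt_dom.
  by apply: le_lt_trans le _; rewrite [ltRHS](splitr (eps ^+ 2)) ltrD.
have [hVf cf] := close _ _ hf hp tf fp.
have [hVg cg] := close _ _ hg hq tg gq.
exists (Vt (replace_sym r p (Ut f))), (Vt (replace_sym r q (Ut g))).
split; [|exact: cf|exact: cg].
(* The data are packed into one triple in order to choose them for all [i] at once; discarded
   coordinates get the zero solution. *)
have sol i : exists F : (nat -> cfun R) * (nat -> cfun R) * (nat -> cfun R),
    mode_solution i (replace_sym r p (Ut f) i) (replace_sym r q (Ut g) i) F.1.1 F.1.2 F.2.
  rewrite /replace_sym; case: eqVneq => [->|ns]; first by exists (G, G1, G2).
  case: ifP => _; last by exists (fun=> 0, fun=> 0, fun=> 0); exact: mode_solution0.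
  by have [[F [F1 [F2 s]]] _] := sl_op_mode ns (fg i); exists (F, F1, F2).
have {sol}[F sol] := choice sol.
have van i : exists M, forall m, (M <= m)%N -> forall p0 : mode A m, midx p0 = i ->
    aeq (Iseg A m) (replace_sym r p (Ut f) i) (cst 0).
  rewrite /replace_sym; case: eqVneq => [->|ns]; first by exists Mp.
  case: ifP => _; last by exists 0%N => *; exact: nearW.
  by have [_ [M vM]] := sl_op_mode ns (fg i); exists M.
have [M vM] := choice van.
(* The radial index may lie outside [r], so its bound [Mp] enters separately. *)
apply: (@H0_antitree_of_modes _ _ _ _ (fun i => (F i).1.1) (fun i => (F i).1.2) (fun i => (F i).2)
  (maxn Mp (\max_(i <- r) M i)) hVf hVg sol) => m Mm s.
have [ir|ir] := boolP (midx s \in r).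
  apply: (vM (midx s) m _ s erefl); apply: leq_trans Mm.
  by rewrite leq_max (leq_bigmax_seq _ ir isT) orbT.
rewrite /replace_sym (negPf ir); case: eqVneq => [e|_]; last exact: nearW.
by apply: (vanp m _ s e); apply: leq_trans Mm; rewrite leq_maxl.
Qed.

Lemma kirchhoffP f g : hmem X f -> hmem X g ->
  (kirchhoff A f g <-> sl_sum_op A (Ut f) (Ut g)).
Proof. by move=> hf hg; split; [exact: kirchhoff_sl|exact: sl_kirchhoff]. Qed.

(** Through [kirchhoff_sl] this supplies the pair (0, 0) for every component operator, which the
    coordinates cut off by a projection require. *)
Lemma kirchhoff0 : kirchhoff A 0 0.
Proof.
have h0 := hmem0 (semihilbert_L2A A); have V0 : Vt (0 : sl_index A -> cfun R) = 0.
  apply/funext => e; apply/funext => x.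
  change (\sum_p (scoef p (tagged e))%:C * 0 = 0 :> R[i]); apply: big1 => j _; exact: mulr0.
split=> // eps e0; exists 0, 0; rewrite subrr /hnorm -/(hsq _ _) (hsq0 (semihilbert_L2A A)) sqrtr0.
split=> //; rewrite -V0.
apply: (@H0_antitree_of_modes _ _ 0 0 (fun=> fun=> 0) (fun=> fun=> 0) (fun=> fun=> 0) 0).
- by rewrite V0.
- by rewrite V0.
- exact: mode_solution0.
- by move=> *; exact: nearW.
Qed.

Lemma kirchhoff_commutes k : commutes_with_projection X (summand A k) (kirchhoff A).
Proof.
move=> f g fg; have [hf hg _] := fg.
exists (summand_proj k f), (summand_proj k g).
split; [exact: summand_orthproj|exact: summand_orthproj|].
apply/kirchhoffP; [exact: hmem_summand_proj|exact: hmem_summand_proj|].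
have [hUf hUg op] := kirchhoff_sl fg; have [_ _ op0] := kirchhoff_sl kirchhoff0.
rewrite !Ut_summand_proj; split; [exact: hmem_sl_restrict|exact: hmem_sl_restrict|move=> i].
rewrite /sl_restrict; case: ifP => _; first exact: op.
by have := op0 i; rewrite Ut0.
Qed.

End Equivalence.

Theorem theorem3p5 (R : realType) (A : antitree R) :
  [/\ orthogonal_decomposition (L2A A) (summand A),
      forall k : component,
        commutes_with_projection (L2A A) (summand A k) (kirchhoff A) &
      exists U : (edge A -> cfun R) -> (sl_index A -> cfun R),
      [/\ unitary (L2A A) (sl_sum_space A) U,
          forall f g, hmem (L2A A) f -> hmem (L2A A) g ->
            (kirchhoff A f g <-> sl_sum_op A (U f) (U g)) &
          forall (k : component) f, hmem (L2A A) f ->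
            (summand A k f <->
             forall i : sl_index A, sl_component i <> k ->
               hnorm (sl_space i) (U f i) = 0)]].
Proof.
split; [exact: summand_decomposition|exact: kirchhoff_commutes|].
exists (@Ut R A); split; [exact: unitary_Ut|exact: kirchhoffP|].
by move=> k f hf; exact: summand_null.
Qed.
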